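(* Let $n\ge0$, let $\tau$ be a framed $(2n,2n)$-tangle, and let $(\tau;S^2\times S^1)$ be its circular closure in $S^2\times S^1$. Then for every integer $r\ge n+2$ the $SU(2)$ Witten–Reshetikhin–Turaev invariant of this link at level parameter $r$ (all components colored by the fundamental representation) is $$Z_r(\tau,S^2\times S^1)=\bigl(S^3;\,P_{2n,0}\circ\langle\tau\rangle\bigr)\big|_{q=\exp(i\pi/r)} .$$
   Context: Tangles are unoriented, framed, embedded in $\mathbb R^2\times[0,1]$, considered up to isotopy rel boundary. An $(m,n)$-tangle has $m$ standard marked endpoints on $\mathbb R^2\times\{0\}$ and $n$ on $\mathbb R^2\times\{1\}$; $\tau_2\circ\tau_1$ is stacking with $\tau_1$ applied first. A Temperley–Lieb (TL) tangle is one having a diagram (blackboard framing) without crossings and without closed circles. $\mathfrak C_n$ is the set of TL $(0,2n)$-tangles (crossingless $n$-matchings); $\tau^{\lozenge}$ is $\tau$ rotated by $180^\circ$ about an axis lying in the blackboard plane and perpendicular to the time direction. $\mathrm{QTL}_{m,n}$ is the $\mathbb Q(q^{1/2})$-vector space with basis $\langle\lambda\rangle$, $\lambda$ a TL $(m,n)$-tangle; composition extends bilinearly, each closed circle being replaced by $-(q+q^{-1})$. The Kauffman bracket $\langle\tau\rangle\in\mathrm{QTL}_{m,n}$ replaces each crossing by $q^{1/2}$ times one smoothing plus $q^{-1/2}$ times the other, the convention being that a $+1$ framing twist multiplies the bracket by $-q^{3/2}$. For $x\in\mathrm{QTL}_{n,n}$, $(S^3;x)\in\mathrm{QTL}_{0,0}=\mathbb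 Q(q^{1/2})$ is the linear extension of the bracket of the circular closure in $S^3$. $P_{2n,0}=\sum_{\alpha,\beta\in\mathfrak C_n}(B^{-1})_{\alpha\beta}\langle\beta\circ\alpha^{\lozenge}\rangle\in\mathrm{QTL}_{2n,2n}$, where $B_{\alpha\beta}=\langle\alpha^\lozenge\circ\beta\rangle$ (an invertible matrix). The element $(S^3;P_{2n,0}\circ\langle\tau\rangle)$ is a Laurent polynomial in $q^{1/2}$; evaluation at $q=\exp(i\pi/r)$ means $q^{1/2}=\exp(i\pi/(2r))$. $Z_r(L,M)$, $r\ge2$, is the $SU(2)$ Witten–Reshetikhin–Turaev invariant of a framed link $L$ in a 3-manifold $M$, normalized so that $Z_r(S^2\times S^1)=1$ for the empty link. For the closure of an $(N,N)$-tangle $\tau$ in $S^2\times S^1$, obtained from the closure in $S^3$ by surgery on the $0$-framed meridian circle encircling all $N$ strands, it is given by the Reshetikhin–Turaev surgery formula $$Z_r(\tau,S^2\times S^1)=-\frac{q-q^{-1}}{2r}\sum_{k=0}^{r-2}(-1)^k(q^{k+1}-q^{-k-1})\,\bigl(S^3;\langle\tau\rangle\circ M_{N,k}\bigr)\Big|_{q=\exp(\pi i/r)},$$ where $M_{N,k}\in\mathrm{QTL}_{N,N}$ is the bracket of $N$ vertical strands encircled by the meridian replaced by its $k$-cable with the Jones–Wenzl idempotent $P_k$ inserted; $P_k\in\mathrm{QTL}_{k,k}$ is the idempotent with $P_k\circ\langle\lambda\rangle=\langle\lambda\rangle\circ P_k=0$ for every TL $(k,k)$-tangle $\lambda$ other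 than the identity, and with coefficient $1$ at the identity tangle. *)

(* Defs.v *)
From HB Require Import structures.
From mathcomp Require Import all_boot all_order all_algebra.
From mathcomp Require Import zify.
From mathcomp Require Import complex.
From mathcomp Require Import all_classical all_reals all_analysis.

Set Implicit Arguments.
Unset Strict Implicit.
Unset Printing Implicit Defensive.

Import Order.TTheory GRing.Theory Num.Theory.
Local Open Scope ring_scope.

Definition K : fieldType := {fraction {poly rat}}.

Definition qhalf : K := FracField.tofrac ('X : {poly rat}).
Definition q : K := qhalf ^+ 2.

Definition delta : K := - (q + q^-1).

(** [inl i] is the [i]-th endpoint at time 0, [inr j] the [j]-th one at time 1,
    both numbered from left to right. *)
Definition endpoint (m n : nat) : finType := ('I_m + 'I_n)%type.

(** The position of an endpoint on the boundary of the strip, which is read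
    along the bottom from left to right, then along the top from right to
    left. *)
Definition pos m n (e : endpoint m n) : nat :=
  match e with inl i => i | inr j => (m + rev_ord j)%N end.

(** A TL tangle is determined up to isotopy by the crossingless matching that
    it induces on its endpoints, given here as a fixed-point free involution. *)
Definition is_TL m n (f : {ffun endpoint m n -> endpoint m n}) : bool :=
  [&& [forall e, f e != e],
      [forall e, f (f e) == e] &
      [forall e, forall e', ~~ [&& (pos e < pos e')%N, (pos e' < pos (f e))%N
                                 & (pos (f e) < pos (f e'))%N]]].

Record TL (m n : nat) := MkTL {
  TLfun :> {ffun endpoint m n -> endpoint m n};
  TLP : is_TL TLfun }.

HB.instance Definition _ m n := [isSub for @TLfun m n].
HB.instance Definition _ m n := [Finite of TL m n by <:].

Lemma is_TLP m n (f : {ffun endpoint m n -> endpoint m n}) :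
  (forall e, f e <> e) -> (forall e, f (f e) = e) ->
  (forall e e', (pos e < pos e')%N -> (pos e' < pos (f e))%N ->
    (pos (f e) < pos (f e'))%N -> False) -> is_TL f.
Proof.
move=> f1 f2 f3; apply/and3P; split.
- by apply/forallP => e; apply/eqP; exact: f1.
- by apply/forallP => e; rewrite f2.
- by apply/forallP => e; apply/forallP => e'; apply/negP => /and3P[a b c];
    exact: (f3 e e').
Qed.

Definition flip_end m n (e : endpoint m n) : endpoint n m :=
  match e with inl i => inr i | inr j => inl j end.

Lemma pos_flip m n (e : endpoint m n) :
  (pos (flip_end e) + pos e).+1 = (m + n)%N.
Proof. by case: e => [[i hi]|[i hi]] /=; lia. Qed.

Lemma flipK m n (e : endpoint m n) : flip_end (flip_end e) = e.
Proof. by case: e. Qed.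

Fact idTL_subproof n : is_TL [ffun e : endpoint n n => flip_end e].
Proof.
apply: is_TLP => [e|e|e e']; rewrite !ffunE ?flipK //; first by case: e.
by case: e => [[i hi]|[i hi]]; case: e' => [[j hj]|[j hj]] /=; lia.
Qed.

Definition idTL n : TL n n := MkTL (idTL_subproof n).

(** A cup joining the top endpoints [i] and [i.+1], the [n] other strands being
    vertical up to the resulting shift. Removing [i] from 'I_n.+2 and then [i]
    again from 'I_n.+1 removes the two ends of the cup. *)
Definition cup_fun n (i : 'I_n.+1) (e : endpoint n n.+2) : endpoint n n.+2 :=
  let i0 : 'I_n.+2 := widen_ord (leqnSn _) i in
  match e with
  | inl j => inr (lift i0 (lift i j))
  | inr k => match unlift i0 k with
             | None => inr (lift i0 i)
             | Some k' => match unlift i k' with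
                          | None => inr i0
                          | Some j => inl j
                          end
             end
  end.

Fact cupTL_subproof n (i : 'I_n.+1) : is_TL [ffun e => cup_fun i e].
Proof.
have cupK e : cup_fun i (cup_fun i e) = e.
  rewrite /cup_fun; case: e => [j|k]; first by rewrite !liftK.
  case: unliftP => [k'|] ->; last by rewrite liftK unlift_none.
  by case: unliftP => [j|] ->; rewrite ?unlift_none.
have cup_neq e : cup_fun i e <> e.
  move=> eqe; move: eqe; rewrite /cup_fun; case: e => [j|k] //.
  case: unliftP => [k'|] ->; last first.
    by case=> /=; rewrite /bump; lia.
  case: unliftP => [j|] -> //.
  by case=> /=; rewrite /bump; lia.
apply: is_TLP => [e|e|e e']; rewrite !ffunE //.
move: i cupK cup_neq => [i hi] _ _.
rewrite /cup_fun; case: e => [[j hj]|k]; case: e' => [[j' hj']|k'] /=;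
  do ?[case: unliftP => [?|] ->]; do ?[case: unliftP => [?|] ->] => /=;
  rewrite /bump /=;
  repeat match goal with x : ordinal _ |- _ => case: x => x ? /= end; lia.
Qed.

Definition cupTL n (i : 'I_n.+1) : TL n n.+2 := MkTL (cupTL_subproof i).

(** The tangle written with a lozenge: the rotation by 180 degrees about a
    horizontal axis of the blackboard plane exchanges bottom and top and
    preserves the left-right order. *)
Fact dualTL_subproof m n (l : TL m n) :
  is_TL [ffun e : endpoint n m => flip_end (l (flip_end e))].
Proof.
case: l => f /= /and3P[/forallP f1 /forallP f2 /forallP f3].
apply: is_TLP => [e|e|e e']; rewrite !ffunE.
- by move=> h; move: (f1 (flip_end e)); rewrite -{2}h flipK eqxx.
- by rewrite flipK (eqP (f2 _)) flipK.
- move=> h1 h2 h3; move/forallP: (f3 (f (flip_end e'))) => /(_ (f (flip_end e))).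
  rewrite !(eqP (f2 _)) => /negP; apply; move: h1 h2 h3 => /=.
  have := pos_flip (f (flip_end e)); have := pos_flip (f (flip_end e')).
  have := pos_flip e; have := pos_flip e'.
  move: (pos (f (flip_end e))) (pos (f (flip_end e'))) (pos (flip_end (f (flip_end e)))).
  move: (pos (flip_end (f (flip_end e')))) (pos (flip_end e)) (pos (flip_end e')).
  by move: (pos e) (pos e') => *; apply/and3P; split; lia.
Qed.

Definition dualTL m n (l : TL m n) : TL n m := MkTL (dualTL_subproof l).

Definition capTL n (i : 'I_n.+1) : TL n.+2 n := dualTL (cupTL i).

(** The levels 0, 1 and 2 of two stacked tangles. *)
Definition joint (m n p : nat) : finType := ('I_m + 'I_n + 'I_p)%type.

Definition lower m n p (e : endpoint m n) : joint m n p := inl e.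
Definition upper m n p (e : endpoint n p) : joint m n p :=
  match e with inl j => inl (inr j) | inr k => inr k end.
Definition outer m n p (e : endpoint m p) : joint m n p :=
  match e with inl i => inl (inl i) | inr k => inr k end.

(** The arcs of the stacking, [l1] being applied first. *)
Definition glue m n p (l2 : TL n p) (l1 : TL m n) : rel (joint m n p) :=
  fun x y =>
    [exists e, (x == lower p e) && (y == lower p (l1 e))] ||
    [exists e, (x == upper m e) && (y == upper m (l2 e))].

(** [l] is the stacking of [l2] on top of [l1], closed circles removed. *)
Definition is_comp m n p (l2 : TL n p) (l1 : TL m n) (l : TL m p) : bool :=
  [forall e, connect (glue l2 l1) (outer n e) (outer n (l e))].

Definition circles m n p (l2 : TL n p) (l1 : TL m n) : nat :=
  n_comp (glue l2 l1)
    [pred x | ~~ [exists e, connect (glue l2 l1) x (outer n e)]].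

(** The circular closure joins the two [i]-th endpoints, for every [i]. *)
Definition closing n (l : TL n n) : rel (endpoint n n) :=
  fun x y => (y == l x) || (y == flip_end x).

Definition closure_circles n (l : TL n n) : nat := n_comp (closing l) predT.

Definition QTL (m n : nat) : lmodType K := {ffun TL m n -> K^o}.

Definition coordQ m n (x : QTL m n) (l : TL m n) : K :=
  (x : {ffun TL m n -> K^o}) l.

Definition basisQ m n (l : TL m n) : QTL m n :=
  [ffun l' : TL m n => (l' == l)%:R : K^o].

Definition idQ n : QTL n n := basisQ (idTL n).

(** The coefficient of the composite at [l] collects the pairs of TL tangles
    whose stacking is [l], up to closed circles. *)
Definition compQ m n p (x : QTL n p) (y : QTL m n) : QTL m p :=
  [ffun l : TL m p =>
     (\sum_(l2 : TL n p) \sum_(l1 : TL m n | is_comp l2 l1 l)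
        delta ^+ circles l2 l1 * coordQ x l2 * coordQ y l1) : K^o].

Definition scalarQ (x : QTL 0 0) : K := coordQ x (idTL 0).

(** [(S^3; x)] *)
Definition S3 n (x : QTL n n) : K :=
  \sum_(l : TL n n) coordQ x l * delta ^+ closure_circles l.

(** A framed tangle is presented by a blackboard-framed diagram in Morse
    position, read upwards: each event is a cup, a cap or a crossing placed at
    the positions [i], [i.+1] (numbered from 0). Every framed tangle has such
    a diagram. In [tcross true i] the overstrand goes from bottom left to top
    right, in [tcross false i] from bottom right to top left. *)
Inductive tangle (m : nat) : nat -> Type :=
| tid : tangle m m
| tcup n (i : 'I_n.+1) of tangle m n : tangle m n.+2
| tcap n (i : 'I_n.+1) of tangle m n.+2 : tangle m n
| tcross n (s : bool) (i : 'I_n.-1) of tangle m n : tangle m n.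

(** The cap at [i], [i.+1] followed by the cup at the same place. *)
Definition hook n : 'I_n.-1 -> QTL n n :=
  match n return 'I_n.-1 -> QTL n n with
  | n'.+2 => fun i : 'I_n'.+1 => compQ (basisQ (cupTL i)) (basisQ (capTL i))
  | _ => fun=> 0
  end.

(** Closing the right strand of [crossing true] multiplies by
    q^{1/2} * delta + q^{-1/2} = - q^{3/2}. This is a framing twist +1: with
    both strands oriented upwards, [tcross true] is a positive crossing. *)
Definition crossing n (s : bool) (i : 'I_n.-1) : QTL n n :=
  if s then qhalf *: idQ n + qhalf^-1 *: hook i
  else qhalf^-1 *: idQ n + qhalf *: hook i.

Fixpoint bracket m n (t : tangle m n) : QTL m n :=
  match t in tangle _ n return QTL m n with
  | tid => idQ m
  | tcup _ i t => compQ (basisQ (cupTL i)) (bracket t)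
  | tcap _ i t => compQ (basisQ (capTL i)) (bracket t)
  | tcross _ s i t => compQ (crossing s i) (bracket t)
  end.

Definition crossingless (n : nat) : finType := TL 0 (2 * n).

Definition gram n : 'M[K]_#|crossingless n| :=
  \matrix_(i, j) scalarQ (compQ (basisQ (dualTL (enum_val i : crossingless n)))
                               (basisQ (enum_val j : crossingless n))).

Definition P2n0 n : QTL (2 * n) (2 * n) :=
  \sum_(i < #|crossingless n|) \sum_(j < #|crossingless n|)
     invmx (gram n) i j *:
       compQ (basisQ (enum_val j : crossingless n))
            (basisQ (dualTL (enum_val i : crossingless n))).

Definition is_JW k (P : QTL k k) : Prop :=
  [/\ compQ P P = P,
      coordQ P (idTL k) = 1
    & forall l : TL k k, l != idTL k ->
        compQ P (basisQ l) = 0 /\ compQ (basisQ l) P = 0].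

Definition JW k : QTL k k := xget 0 [set P | is_JW P]%classic.

Fixpoint nested_cups k N : QTL N (k.*2 + N) :=
  match k return QTL N (k.*2 + N) with
  | 0 => idQ N
  | k'.+1 => compQ (basisQ (cupTL (inord k' : 'I_(k'.*2 + N).+1)))
                  (nested_cups k' N)
  end.

Fixpoint nested_caps k N : QTL (k.*2 + N) N :=
  match k return QTL (k.*2 + N) N with
  | 0 => idQ N
  | k'.+1 => compQ (nested_caps k' N)
                  (basisQ (capTL (inord k' : 'I_(k'.*2 + N).+1)))
  end.

(** [l'] is [l] with [n - k] vertical strands added on its right. *)
Definition widen_end k n (le_kn : (k <= n)%N) (e : endpoint k k) :
    endpoint n n :=
  match e with
  | inl i => inl (widen_ord le_kn i)
  | inr i => inr (widen_ord le_kn i)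
  end.

Definition is_widen k n (le_kn : (k <= n)%N) (l : TL k k) (l' : TL n n) :
    bool :=
  [forall e, l' (widen_end le_kn e) == widen_end le_kn (l e)] &&
  [forall i : 'I_n, (k <= i)%N ==> (l' (inl i) == inr i)].

Definition widenQ k n (le_kn : (k <= n)%N) (x : QTL k k) : QTL n n :=
  [ffun l' : TL n n => (\sum_(l | is_widen le_kn l l') coordQ x l) : K^o].

(** The braid in which the crossings [tcross true i], for [i] in [w], are
    applied successively. *)
Definition braid n (w : seq 'I_n.-1) : QTL n n :=
  foldl (fun x i => compQ (crossing true i) x) (idQ n) w.

(** In [shuffle_word k N] the [k] strands starting at the positions
    [k, ..., k.*2.-1] move rightwards over the [N] strands on their right,
    rightmost strand first. The reversed word brings them back under the [N]
    strands. *)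
Definition shuffle_word k N : seq nat :=
  [seq (a + b)%N | a <- rev (iota k k), b <- iota 0 N].

Definition clasp k N : QTL (k.*2 + N) (k.*2 + N) :=
  braid (pmap insub (shuffle_word k N ++ rev (shuffle_word k N))).

Lemma leq_cable k N : (k <= k.*2 + N)%N.
Proof. by rewrite -addnn -addnA leq_addr. Qed.

(** M_{N,k}: the cable of the (0-framed) meridian starts with [k] nested cups;
    its left half carries the idempotent and its right half is clasped with the
    [N] strands. *)
Definition encircle N k : QTL N N :=
  compQ (nested_caps k N)
    (compQ (clasp k N)
       (compQ (widenQ (leq_cable k N) (JW k)) (nested_cups k N))).

(** The value at [q^{1/2} = z] of an element of Q(q^{1/2}), computed from an
    expression of it in lowest terms. *)
Definition eval_at (C : fieldType) (z : C) (f : K) : C :=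
  let num := (frac (repr f)).1 in
  let den := (frac (repr f)).2 in
  let g := gcdp num den in
  (map_poly ratr (num %/ g)).[z] / (map_poly ratr (den %/ g)).[z].

Section RootOfUnity.
Local Open Scope complex_scope.

(** exp (i pi / (2 r)) *)
Definition zeta (R : realType) (r : nat) : R[i] :=
  cos (pi / (2 * r)%N%:R) +i* sin (pi / (2 * r)%N%:R).

End RootOfUnity.

(** The Reshetikhin-Turaev formula for the 0-surgery on the meridian of the
    [N] strands. *)
Definition WRT_S2S1 (R : realType) (r N : nat) (t : tangle N N) : R[i] :=
  eval_at (zeta R r)
    (- ((q - q^-1) / (2 * r)%N%:R) *
     \sum_(k < r.-1)
        (-1) ^+ k * (q ^+ k.+1 - q ^- k.+1) *
        S3 (compQ (bracket t) (encircle N k))).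

(* Main.v *)
(** TL tangles act faithfully on functions of spins attached to the endpoints: every arc joins opposite
    spins, with a weight depending on their order, and stacking becomes a sum over the spins of the
    middle level.

    Both sides of the theorem are linear functionals [T] of the bracket of the tangle, defined for every
    number of strands, such that [T (cup o x) = T (x o cup)]. A TL tangle other than the identity has a
    cup on top, hence such a functional is determined by its values at the identity tangles, the only
    denominators being powers of [delta], which do not vanish at the root of unity.

    On the surgery side, a strand encircled by the meridian of colour [k] contributes the scalar
    [- (q^(k+1) + q^-(k+1))], so that the value at [N] vertical strands is
    [- 1/(2r) sum_(0 < j < r) (q^j - q^-j)^2 (- (q^j + q^-j))^N]. On the other side, [(S^3; P_(2n,0) o x)]
    is the trace of the action of [x] on the crossingless matchings, because [P_(2n,0)] is the sum of the
    products of dual bases for the Gram form; its value at the identity is the number of matchings.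
    At [q = exp(i pi / r)] both numbers count ballot sequences as long as [N <= 2r - 4]. *)

From HB Require Import structures.
Require Import Defs.
From mathcomp Require Import all_boot all_order all_algebra.
From mathcomp Require Import complex zify ring.
From mathcomp Require Import all_classical all_reals all_analysis.

Set Implicit Arguments.
Unset Strict Implicit.
Unset Printing Implicit Defensive.
Import Order.TTheory GRing.Theory Num.Theory.
Local Open Scope ring_scope.

(** * Contraction of adjacent endpoints *)

(** The two sides are in general different elements of [K]: on vertical strands the surgery formula
    gives a Laurent polynomial in [q], which takes a ballot number as value at the root of unity.
    Hence values at a point are compared ([evals], [same_value]), and it matters what gets
    evaluated. The coefficients of the Jones-Wenzl idempotents and of the inverse Gram matrix never
    are: over [K], the former enter through the scalars [ring_scalar] and [dq] alone, and the latter
    disappears into [action_trace]. What remains are coefficients of the bracket, powers of [delta]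
    and values on vertical strands. The spin model replaces isotopies: associativity of stacking,
    slides of cups through crossings and the Wenzl recursion are identities between linear
    operators, which [op_inj] brings back to [QTL]. The price is to show that stacking, which counts
    components of a graph, agrees with the sum over spins. For this the endpoints are glued one
    adjacent pair at a time, since gluing an adjacent pair keeps the matching crossingless. *)

Lemma qhalf_neq0 : qhalf != 0.
Proof. by rewrite tofrac_eq0 polyX_eq0. Qed.

Lemma q_neq0 : q != 0.
Proof. by rewrite expf_neq0 // qhalf_neq0. Qed.

Section Connect.
Variable X : finType.
Implicit Types (G : rel X) (x y : X) (A : {set X}).

Definition add_edge G x y : rel X :=
  fun u v => [|| G u v, (u == x) && (v == y) | (u == y) && (v == x)].

Lemma add_edge_sym G x y : symmetric G -> symmetric (add_edge G x y).
Proof.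
move=> sG u v; rewrite /add_edge sG.
by case: (G v u); case: (u == x); case: (u == y); case: (v == x); case: (v == y).
Qed.

(** A path never needs the new edge twice, so the right-hand side, [rho] in the proof, is stable
    under prepending a step. *)
Lemma connect_add_edge G x y u v : symmetric G ->
  connect (add_edge G x y) u v =
  [|| connect G u v, connect G u x && connect G y v
    | connect G u y && connect G x v].
Proof.
move=> sG; have cs := sym_connect_sym sG.
apply/idP/idP; last first.
  have sub : subrel (connect G) (connect (add_edge G x y)).
    by apply: connect_sub => a b h; apply: connect1; rewrite /add_edge h.
  have exy : connect (add_edge G x y) x y.
    by apply: connect1; rewrite /add_edge !eqxx orbT.
  have eyx : connect (add_edge G x y) y x.
    by apply: connect1; rewrite /add_edge !eqxx !orbT.
  case/or3P => [/sub //|/andP[/sub h1 /sub h2]|/andP[/sub h1 /sub h2]].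
    exact: connect_trans h1 (connect_trans exy h2).
  exact: connect_trans h1 (connect_trans eyx h2).
pose rho : rel X := fun u v =>
  [|| connect G u v, connect G u x && connect G y v
    | connect G u y && connect G x v].
move=> /connectP[p pth ->]; rewrite -/(rho u (last u p)).
elim: p u pth => [|w p IH] u /=; first by rewrite /rho connect0.
case/andP => uw /IH {IH}; set t := last w p; rewrite /rho.
case/or3P: uw => [uw|/andP[/eqP-> /eqP->]|/andP[/eqP-> /eqP->]].
- by rewrite !(same_connect cs (connect1 uw)).
- by rewrite !connect0; case: (connect G x t); case: (connect G y t); rewrite ?orbT ?andbF.
- by rewrite !connect0; case: (connect G x t); case: (connect G y t); rewrite ?orbT ?andbF.
Qed.

Definition matched G A (f : X -> X) :=
  {in A &, forall e e', connect G e e' = (e' == e) || (e' == f e)}.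

(** The components made of such vertices are the circles closed so far. *)
Definition isolated G A : pred X :=
  [pred z | ~~ [exists e in A, connect G z e]].

Lemma eq_n_comp_on G G' (a : pred X) :
  (forall x, a x -> connect G x =1 connect G' x) -> n_comp G a = n_comp G' a.
Proof.
move=> h; rewrite /n_comp_mem; apply: eq_card => x; rewrite !inE.
have [ax|] := boolP (x \in a); last by rewrite !andbF.
have eq_root : fingraph.root G x = fingraph.root G' x.
  by rewrite /fingraph.root (eq_pick (h x ax)).
by rewrite !andbT; congr (_ == _).
Qed.

(** Gluing [x] to [y] makes their partners partners of each other. If [x] and [y] are already
    partners, a circle closes and the other arcs are unchanged. *)
Definition contract (f : X -> X) x y z :=
  if f z == x then f y else if f z == y then f x else f z.

Section AddEdge.
Variables (G : rel X) (A : {set X}) (f : X -> X) (x y : X).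
Hypotheses (sG : symmetric G) (Gf : matched G A f).
Hypotheses (fA : {in A, forall e, f e \in A}) (ff : {in A, forall e, f (f e) = e}).
Hypotheses (f_neq : {in A, forall e, f e != e}).
Hypotheses (xA : x \in A) (yA : y \in A) (neq_xy : x != y).

Let A' := A :\ x :\ y.
Let G' := add_edge G x y.

Let inA' e : (e \in A') = [&& e != y, e != x & e \in A].
Proof. by rewrite !inE. Qed.

Lemma matched_contract : matched G' A' (contract f x y).
Proof.
move=> e e'; rewrite !inA' => /and3P[ey ex eA] /and3P[e'y e'x e'A].
rewrite connect_add_edge // !Gf // [x == e]eq_sym [y == e]eq_sym.
rewrite (negbTE ex) (negbTE ey) (negbTE e'x) (negbTE e'y) /= /contract.
rewrite (eq_sym x) (eq_sym y); have [->|_] := eqVneq (f e) x.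
  by rewrite (negbTE e'x) (negbTE neq_xy) /= !orbF.
by have [->|_] := eqVneq (f e) y; rewrite ?(negbTE e'y) /= ?orbF.
Qed.

(** If [x] and [y] end different arcs, the merged arc still has the free ends [f x] and [f y], so no
    component becomes isolated. If they end the same arc, its component loses its last free
    endpoints and becomes one more circle. *)
Lemma n_comp_isolated_add_edge :
  n_comp G' (isolated G' A') = (n_comp G (isolated G A) + (f x == y))%N.
Proof.
have cs := sym_connect_sym sG.
have [fxy|fxy] := eqVneq (f x) y; last first.
  have fyx : f y != x by apply: contraNneq fxy => <-; rewrite ff.
  have cfx z : connect G z x -> connect G z (f x).
    by move=> h; apply: connect_trans h _; rewrite Gf ?fA // eqxx orbT.
  have cfy z : connect G z y -> connect G z (f y).
    by move=> h; apply: connect_trans h _; rewrite Gf ?fA // eqxx orbT.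
  have fx' : f x \in A' by rewrite inA' fxy f_neq ?fA.
  have fy' : f y \in A' by rewrite inA' fyx f_neq ?fA.
  have iso : isolated G' A' =i isolated G A.
    move=> z; rewrite !inE; congr (~~ _).
    apply/existsP/existsP => [[e /andP[eA']]|[e /andP[eA ze]]].
      rewrite connect_add_edge // => h.
      case/or3P: h => [ze|/andP[zx _]|/andP[zy _]].
      - by exists e; move: eA'; rewrite inA' => /and3P[_ _ ->].
      - by exists x; rewrite xA.
      - by exists y; rewrite yA.
    have h e' : e' \in A' -> connect G z e' -> e' \in A' /\ connect G' z e'.
      by rewrite connect_add_edge // => -> ->.
    case: (eqVneq e x) ze => [->|ex] ze.
      by exists (f x); case: (h _ fx' (cfx _ ze)) => -> ->.
    case: (eqVneq e y) ze => [->|ey] ze.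
      by exists (f y); case: (h _ fy' (cfy _ ze)) => -> ->.
    have eA' : e \in A' by rewrite inA' ex ey.
    by exists e; case: (h _ eA' ze) => -> ->.
  rewrite addn0 (eq_n_comp_r iso); apply: eq_n_comp_on => z /existsPn iz u.
  rewrite connect_add_edge //.
  have := iz x; rewrite xA /= => /negbTE ->.
  by have := iz y; rewrite yA /= => /negbTE ->; rewrite orbF.
have cxy : connect G x y by rewrite Gf // fxy eqxx orbT.
have eqc : connect G' =2 connect G.
  move=> u v; rewrite connect_add_edge //; apply/idP/idP; last by move=> ->.
  case/or3P => // /andP[h1 h2]; first exact: connect_trans h1 (connect_trans cxy h2).
  by apply: connect_trans h1 (connect_trans _ h2); rewrite cs.
rewrite (eq_n_comp eqc).
have fyx : f y = x by rewrite -fxy ff.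
have nx e : e \in A' -> connect G x e = false.
  by rewrite inA' => /and3P[ey ex eA]; rewrite Gf // fxy (negbTE ex) (negbTE ey).
(* The extra 1 is the number of roots in the component of [x], which is disjoint from the old
   circles because it contains the free endpoint [x]. *)
rewrite -[nat_of_bool true]/1%N -(n_comp_connect cs x) /n_comp_mem -cardUI.
rewrite [X in (_ + X)%N](_ : _ = 0%N) ?addn0; last first.
  apply: eq_card0 => z; rewrite !inE; apply/negP => /andP[/andP[_ /existsP h] /andP[_ xz]].
  by apply: h; exists x; rewrite xA cs.
apply: eq_card => z; rewrite !inE -andb_orr; congr (_ && _).
apply/existsPn/orP => [h|h e].
  have [xz|xz] := boolP (connect G x z); [by right|left].
  apply/existsPn => e; apply/negP => /andP[eA ze].
  case: (eqVneq e x) ze => [->|ex] ze; first by rewrite cs ze in xz.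
  case: (eqVneq e y) ze => [->|ey] ze.
    by rewrite (connect_trans cxy) // cs in xz.
  by have := h e; rewrite inA' ex ey eA eqc ze.
apply/negP => /andP[eA']; rewrite eqc => ze; case: h.
  by move/existsPn/(_ e); rewrite ze; move: eA'; rewrite inA' => /and3P[_ _ ->].
by move=> xz; have := nx _ eA'; rewrite (connect_trans xz ze).
Qed.

End AddEdge.
End Connect.

(** The weight of an arc running along the boundary from a spin [a] to a spin [b], the first endpoint
    being the one with the smaller position. A turn joins two endpoints of opposite spins; as
    matrices, [arc_wt] and [turn_wt] are inverse to each other, and a closed circle contributes
    [- q - q^-1 = delta]. *)
Definition arc_wt (a b : bool) : K :=
  match a, b with true, false => 1 | false, true => - q^-1 | _, _ => 0 end.

Definition turn_wt (b : bool) : K := if b then - q else 1.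

Definition upd (I : eqType) (s : I -> bool) i b : I -> bool :=
  fun j => if j == i then b else s j.

Definition between (a b c : nat) : bool := (a < c < b)%N || (b < c < a)%N.

(** Seen from [u], [v] and [c], the points [x] and [y] coincide, and separation from [c] is additive
    modulo 2 along the path from [u] to [v] through that point. *)
Lemma between_addb x y u v c : (x < y)%N ->
  (u < x)%N || (y < u)%N -> (v < x)%N || (y < v)%N -> (c < x)%N || (y < c)%N ->
  c <> u -> c <> v ->
  between u v c = between x u c (+) between y v c.
Proof.
rewrite /between => xy hu hv hc cu cv; apply/idP/idP; last first.
  by case/orP: hu => hu; case/orP: hv => hv; case/orP: hc => hc; lia.
by case/orP: hu => hu; case/orP: hv => hv; case/orP: hc => hc; lia.
Qed.

Lemma between_adj x y a b : (x < y)%N ->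
  (a < x)%N || (y < a)%N -> (b < x)%N || (y < b)%N ->
  between a b x = between a b y.
Proof.
rewrite /between => xy ha hb.
by case/orP: ha => ha; case/orP: hb => hb; apply/idP/idP; lia.
Qed.

Lemma not_between (x y z : nat) : z <> y -> z <> x -> ~~ (x < z < y)%N ->
  (z < x)%N || (y < z)%N.
Proof. by lia. Qed.

Lemma between_end a b : (between a b b = false) * (between a b a = false).
Proof. by rewrite /between !ltnn !andbF. Qed.

(** Here [u] and [v] are the partners of [x] and [y]. The three outcomes are the planar ones: nested
    arcs to the right, one arc on each side, nested arcs to the left. In the three other orders the
    arcs cross. *)
Lemma between_orient x y u v : (x < y)%N ->
  (u < x)%N || (y < u)%N -> (v < x)%N || (y < v)%N -> u <> v ->
  between x u y = between x u v ->
  [|| [&& x < u, y < v & (u < v) == false], [&& (x < u) == false, y < v & u < v]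
    | [&& (x < u) == false, (y < v) == false & (u < v) == false]]%N.
Proof.
rewrite /between => xy hu hv uv.
by case/orP: hu => hu; case/orP: hv => hv; lia.
Qed.

Section Noncrossing.
Variables (X : finType) (pos : X -> nat).
Hypothesis pos_inj : injective pos.
Implicit Types (A : {set X}) (f : X -> X) (s : X -> bool).

(** Unlike in [is_TL], the test ignores which end of an arc comes first, because a contraction may
    turn a first end into a second one. *)
Definition noncrossing A f :=
  [/\ {in A, forall e, f e \in A}, {in A, forall e, f e != e},
      {in A, forall e, f (f e) = e} &
      {in A &, forall e e', e' != e -> e' != f e ->
        between (pos e) (pos (f e)) (pos e') =
        between (pos e) (pos (f e)) (pos (f e'))}].

Definition state_wt A f s : K :=
  \prod_(e in A | (pos e < pos (f e))%N) arc_wt (s e) (s (f e)).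

(** An arc is charged to its first end and its second end gets 1, so that products run over all
    endpoints and split along any partition of them. *)
Definition end_wt f s e : K :=
  if (pos e < pos (f e))%N then arc_wt (s e) (s (f e)) else 1.

Lemma state_wtE A f s : state_wt A f s = \prod_(e in A) end_wt f s e.
Proof. by rewrite /state_wt big_mkcondr. Qed.

Section Contract.
Variables (A : {set X}) (f : X -> X) (x y : X).
Hypotheses (nc : noncrossing A f) (xA : x \in A) (yA : y \in A).
Hypotheses (ltxy : (pos x < pos y)%N).
Hypothesis adj : {in A, forall z, ~~ (pos x < pos z < pos y)%N}.

Let A' := A :\ x :\ y.
Let inA' e : (e \in A') = [&& e != y, e != x & e \in A].
Proof. by rewrite !inE. Qed.

Let neq_pos e e' : e != e' -> pos e <> pos e'.
Proof. by move=> /eqP h /pos_inj. Qed.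

Let neqxy : x != y.
Proof. by apply: contraTneq ltxy => ->; rewrite ltnn. Qed.

Let fA : {in A, forall e, f e \in A}. Proof. by case: nc. Qed.
Let f1 : {in A, forall e, f e != e}. Proof. by case: nc. Qed.
Let ff : {in A, forall e, f (f e) = e}. Proof. by case: nc. Qed.

Let fE e z : e \in A -> z \in A -> (f e == z) = (e == f z).
Proof. by move=> eA zA; apply/eqP/eqP => [<-|->]; rewrite ff. Qed.

Lemma contractE e : e \in A' -> contract f x y e =
  if e == f x then f y else if e == f y then f x else f e.
Proof. by rewrite inA' => /and3P[ey ex eA]; rewrite /contract !fE. Qed.

(** For the new arc from [f x] to [f y], [between_addb] reduces the test to the two arcs that it
    replaces. Any other arc has the adjacent points [x] and [y] on the same side, hence also [f x]
    and [f y]. *)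
Lemma noncrossing_contract : noncrossing A' (contract f x y).
Proof.
case: nc => _ _ _ fnc.
have fxA := fA xA; have fyA := fA yA.
have cA e : e \in A' -> contract f x y e \in A'.
  move=> eA'; rewrite contractE //; move: eA'; rewrite !inA' => /and3P[ey ex eA].
  have [eu|eu] := eqVneq e (f x).
    by rewrite f1 // fA // andbT /= fE // -eu eq_sym.
  have [ev|ev] := eqVneq e (f y).
    by rewrite f1 // fA // !andbT fE // -ev eq_sym.
  by rewrite !fE // eu ev fA.
split => //.
- move=> e eA'; rewrite contractE //; move: eA'; rewrite !inA' => /and3P[ey ex eA].
  have [->|eu] := eqVneq e (f x); first by rewrite fE // ff // eq_sym.
  by have [->|ev] := eqVneq e (f y); [rewrite fE // ff|exact: f1].
- move=> e eA'; rewrite contractE ?cA // contractE //.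
  move: eA'; rewrite !inA' => /and3P[ey ex eA].
  have [->|eu] := eqVneq e (f x).
    by rewrite (fE yA) // ff // eq_sym (negbTE neqxy) eqxx.
  have [->|ev] := eqVneq e (f y); first by rewrite eqxx.
  by rewrite !fE // !ff // (negbTE ex) (negbTE ey).
- move=> e e' eA' e'A'; rewrite !contractE //.
  move: eA' e'A'; rewrite !inA' => /and3P[ey ex eA] /and3P[e'y e'x e'A].
  have out z : z \in A -> z != x -> z != y -> (pos z < pos x)%N || (pos y < pos z)%N.
    by move=> /adj h /neq_pos hx /neq_pos hy; exact: not_between.
  have gen z : f x != y -> z \in A -> z != x -> z != y -> z != f x -> z != f y ->
     between (pos (f x)) (pos (f y)) (pos z) =
     between (pos (f x)) (pos (f y)) (pos (f z)).
    move=> fxy zA zx zy zu zv.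
    have fzx : f z != x by rewrite fE.
    have fzy : f z != y by rewrite fE.
    have h a b : f a == f b -> a \in A -> b \in A -> a == b.
      by move=> /eqP h aA bA; rewrite -(ff aA) h ff.
    have fzu : f z != f x by apply: contraNneq zx => h'; apply: h; rewrite ?h'.
    have fzv : f z != f y by apply: contraNneq zy => h'; apply: h; rewrite ?h'.
    have uv : f x != f y by apply: contraNneq neqxy => h'; apply: h; rewrite ?h'.
    have fyx : f y != x by rewrite fE // eq_sym.
    have ou := out _ fxA (f1 xA) fxy; have ov := out _ fyA fyx (f1 yA).
    rewrite (between_addb ltxy ou ov (out _ zA zx zy) (neq_pos zu) (neq_pos zv)).
    rewrite (between_addb ltxy ou ov (out _ (fA zA) fzx fzy) (neq_pos fzu) (neq_pos fzv)).
    by rewrite (fnc _ _ xA zA zx zu) (fnc _ _ yA zA zy zv).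
  have bs a b c : between a b c = between b a c by rewrite /between orbC.
  have [eu|eu] := eqVneq e (f x).
    rewrite eu; have [->|e'u] := eqVneq e' (f x); first by rewrite !between_end.
    have [->|e'v] := eqVneq e' (f y); first by rewrite !between_end.
    by move=> _ _; apply: gen; rewrite // -eu.
  have [ev|ev] := eqVneq e (f y).
    rewrite ev; have [->|e'u] := eqVneq e' (f x); first by rewrite !between_end.
    have [->|e'v] := eqVneq e' (f y); first by rewrite !between_end.
    by move=> _ _; rewrite ![between (pos (f y)) _ _]bs; apply: gen; rewrite // fE // -ev eq_sym.
  move=> e'e e'fe.
  have adj_between e0 : e0 \in A -> e0 != x -> e0 != y -> e0 != f x -> e0 != f y ->
      between (pos e0) (pos (f e0)) (pos x) = between (pos e0) (pos (f e0)) (pos y).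
    move=> h hx hy hu hv.
    by rewrite (between_adj ltxy) // ?out // ?fA // ?fE.
  have xe : x != e by rewrite eq_sym.
  have ye : y != e by rewrite eq_sym.
  have xfe : x != f e by rewrite eq_sym fE.
  have yfe : y != f e by rewrite eq_sym fE.
  have hx := fnc _ _ eA xA xe xfe; have hy := fnc _ _ eA yA ye yfe.
  have hxy := adj_between _ eA ex ey eu ev.
  have [->|e'u] := eqVneq e' (f x); first by rewrite -hx -hy.
  have [->|e'v] := eqVneq e' (f y); first by rewrite -hx -hy.
  exact: fnc.
Qed.

(** The sum over [b] is a matrix product of an arc, a turn and an arc. As the turn is inverse to the
    arc matrix, one arc matrix is left; when both ends belong to the same arc the sum is the trace
    [delta]. *)
Lemma state_wt_contract s :
  \sum_(b : bool) turn_wt b * state_wt A f (upd (upd s x b) y (~~ b)) =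
  delta ^+ (f x == y) * state_wt A' (contract f x y) s.
Proof.
case: nc => _ _ _ fnc.
have neq := neq_pos.
have DA F : \prod_(e in A) F e = F x * (F y * \prod_(e in A') F e) :> K.
  rewrite (bigD1 x) //= (bigD1 y) /= ?yA 1?eq_sym //; congr (_ * (_ * _)).
  by apply: eq_bigl => e; rewrite inA'; case: (e \in A); case: (e == x); case: (e == y).
have [fxy|fxy] := eqVneq (f x) y.
  have fyx : f y = x by rewrite -fxy ff.
  have eqA b : state_wt A f (upd (upd s x b) y (~~ b)) = arc_wt b (~~ b) * state_wt A' (contract f x y) s.
    rewrite state_wtE DA /end_wt fxy fyx ltxy ltnNge (ltnW ltxy) /= mul1r.
    rewrite /upd !eqxx (negbTE neqxy) state_wtE; congr (_ * _).
    apply: eq_bigr => e eA'; rewrite /end_wt contractE // fxy fyx.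
    move: (eA'); rewrite inA' => /and3P[ey ex eA]; rewrite (negbTE ex) (negbTE ey).
    by rewrite !fE // fxy fyx (negbTE ex) (negbTE ey).
  rewrite big_bool !eqA /= /delta /=; set z := state_wt _ _ _.
  by rewrite expr1; ring.
have fyx : f y != x by rewrite fE // eq_sym.
have uA : f x \in A' by rewrite inA' fxy f1 // fA.
have vA : f y \in A' by rewrite inA' fyx f1 // fA.
have uv : f x != f y.
  by rewrite -fE ?fA // ff.
have DA' F : \prod_(e in A') F e =
    F (f x) * (F (f y) * \prod_(e in A' | (e != f x) && (e != f y)) F e) :> K.
  rewrite (bigD1 (f x)) //= (bigD1 (f y)) /= ?vA 1?eq_sym //; congr (_ * (_ * _)).
  by apply: eq_bigl => e; rewrite andbA.
rewrite [state_wt A' _ _]state_wtE DA'; set R := \prod_(e in A' | _) _.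
have eqA b : state_wt A f (upd (upd s x b) y (~~ b)) =
    (if (pos x < pos (f x))%N then arc_wt b (s (f x)) else arc_wt (s (f x)) b) *
    (if (pos y < pos (f y))%N then arc_wt (~~ b) (s (f y)) else arc_wt (s (f y)) (~~ b)) * R.
  rewrite state_wtE DA DA' /end_wt !ff // /upd !eqxx (negbTE neqxy) (negbTE fxy) (negbTE fyx) !(negbTE (f1 _)) //.
  rewrite [X in _ * (_ * (_ * (_ * X)))](_ : _ = R).
    have := neq _ _ (f1 xA); have := neq _ _ (f1 yA).
    move=> n1 n2; case: ltngtP => [_|_|h]; last by case: n2.
      case: ltngtP => [_|_|h]; last by case: n1.
        by rewrite !(mul1r, mulr1, mulrA).
      by rewrite !(mul1r, mulr1, mulrA).
    case: ltngtP => [_|_|h]; last by case: n1.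
      by rewrite !(mul1r, mulr1, mulrA) [X in X * R]mulrC.
    by rewrite !(mul1r, mulr1, mulrA).
  apply: eq_bigr => e /andP[eA' /andP[eu ev]]; rewrite /end_wt contractE // (negbTE eu) (negbTE ev).
  move: (eA'); rewrite inA' => /and3P[ey ex eA]; rewrite (negbTE ex) (negbTE ey).
  by rewrite !fE // (negbTE eu) (negbTE ev).
rewrite big_bool !eqA /= /end_wt !contractE // eqxx [f y == f x]eq_sym (negbTE uv) eqxx expr0 mul1r.
have ou := not_between (neq _ _ fxy) (neq _ _ (f1 xA)) (adj (fA xA)).
have ov := not_between (neq _ _ (f1 yA)) (neq _ _ fyx) (adj (fA yA)).
have yx : y != x by rewrite eq_sym.
have yu : y != f x by rewrite eq_sym.
(* Each planar order fixes which of the three arc matrices are transposed, and the identity is then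
   checked on the four values of the remaining spins. *)
have := between_orient ltxy ou ov (neq _ _ uv) (fnc _ _ xA yA yx yu).
have q0 := q_neq0; clear eqA; move: (s (f x)) (s (f y)) R => su sv R0.
have qq : q * q^-1 = 1 by rewrite divff.
have h1 : (pos (f y) < pos (f x))%N = ~~ (pos (f x) < pos (f y))%N.
  by rewrite ltnNge leq_eqVlt; have /eqP/negbTE -> := neq _ _ uv.
rewrite h1.
case/or3P => /and3P[].
- by move=> -> -> /eqP ->; case: su; case: sv; rewrite /= ?(mulr0, mul0r, mul1r, mulr1, addr0, add0r) // mulrA mulrNN qq mul1r.
- by move=> /eqP -> -> ->; case: su; case: sv; rewrite /= ?(mulr0, mul0r, mul1r, mulr1, addr0, add0r) // ?mulrA ?mulrNN ?qq ?mul1r.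
- by move=> /eqP -> /eqP -> /eqP ->; case: su; case: sv; rewrite /= ?(mulr0, mul0r, mul1r, mulr1, addr0, add0r) // ?mulrA ?mulrNN ?qq ?mul1r.
Qed.
End Contract.
End Noncrossing.

(** * Gluing a nested list of pairs *)

Section Glue.
Variables (X : finType) (ps : seq (X * X)).

Definition glue_rel (G : rel X) : rel X :=
  foldl (fun G p => add_edge G p.1 p.2) G ps.

Definition glue_rest (A : {set X}) : {set X} :=
  foldl (fun A p => A :\ p.1 :\ p.2) A ps.

Definition glue_sum (g : (X -> bool) -> K) : (X -> bool) -> K :=
  foldl (fun g p s => \sum_(b : bool) turn_wt b * g (upd (upd s p.1 b) p.2 (~~ b))) g ps.

Lemma in_glue_rest A z : (z \in glue_rest A) =
  (z \in A) && all (fun p => (z != p.1) && (z != p.2)) ps.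
Proof.
rewrite /glue_rest; elim: ps A => [|p s IH] A /=; first by rewrite andbT.
by rewrite IH !inE; case: (z == p.1); case: (z == p.2); case: (z \in A).
Qed.

Lemma glue_relE G u v : glue_rel G u v =
  G u v || has (fun p => (u == p.1) && (v == p.2) || (u == p.2) && (v == p.1)) ps.
Proof.
rewrite /glue_rel; elim: ps G => [|p s IH] G /=; first by rewrite orbF.
by rewrite IH /add_edge -!orbA.
Qed.

Lemma glue_rel_sym G : symmetric G -> symmetric (glue_rel G).
Proof.
rewrite /glue_rel; elim: ps G => [|p s IH] G //= sG.
by apply: IH; exact: add_edge_sym.
Qed.

End Glue.

(** Adjacency is required only among the endpoints still free when the turn of the pair comes, so
    the order of the list matters. *)
Fixpoint nested (X : finType) (pos : X -> nat) (A : {set X}) (ps : seq (X * X)) :=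
  if ps is p :: ps' then
    [/\ p.1 \in A, p.2 \in A, (pos p.1 < pos p.2)%N,
        {in A, forall z, ~~ (pos p.1 < pos z < pos p.2)%N} &
        nested pos (A :\ p.1 :\ p.2) ps']
  else True.

Lemma eq_glue_sum (X : finType) (ps : seq (X * X)) g g' s :
  g =1 g' -> glue_sum ps g s = glue_sum ps g' s.
Proof.
rewrite /glue_sum; elim: ps g g' s => [|p ps IH] g g' s h //=.
by apply: IH => t; apply: eq_bigr => b _; rewrite h.
Qed.

Lemma glue_sumZ (X : finType) (ps : seq (X * X)) c g s :
  glue_sum ps (fun t => c * g t) s = c * glue_sum ps g s.
Proof.
rewrite /glue_sum; elim: ps g s => [|p ps IH] g s //=.
rewrite -IH; apply: eq_glue_sum => t.
by rewrite big_distrr; apply: eq_bigr => b _; rewrite mulrCA.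
Qed.

(** The point is that a single [c] is both the number of circles closed in the graph and the
    exponent of [delta] in the spin sum. *)
Lemma glue_pairs (X : finType) (pos : X -> nat) (ps : seq (X * X)) A f G :
  injective pos -> symmetric G -> noncrossing pos A f -> matched G A f ->
  nested pos A ps ->
  exists f' c, [/\ noncrossing pos (glue_rest ps A) f',
    matched (glue_rel ps G) (glue_rest ps A) f',
    n_comp (glue_rel ps G) (isolated (glue_rel ps G) (glue_rest ps A)) =
      (n_comp G (isolated G A) + c)%N &
    forall s, glue_sum ps (state_wt pos A f) s =
      delta ^+ c * state_wt pos (glue_rest ps A) f' s].
Proof.
move=> pi; elim: ps A f G => [|[x y] ps IH] A f G sG nc mt /=.
  by move=> _; exists f, 0%N; split=> // [|s]; rewrite ?addn0 ?mul1r.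
move=> [xA yA xy adj nst].
have nxy : x != y by apply: contraTneq xy => ->; rewrite ltnn.
have [fA f1 ff _] := nc.
have nc' := noncrossing_contract pi nc xA yA xy adj.
have mt' : matched (add_edge G x y) (A :\ x :\ y) (contract f x y).
  exact: matched_contract.
have sG' : symmetric (add_edge G x y) by apply: add_edge_sym.
have [f' [c [h1 h2 h3 h4]]] := IH _ _ _ sG' nc' mt' nst.
exists f', ((f x == y) + c)%N; split => //.
  by rewrite h3 (@n_comp_isolated_add_edge _ _ _ f) ?addnA.
move=> s; rewrite exprD -mulrA -h4 -glue_sumZ; apply: eq_glue_sum => t.
exact: state_wt_contract.
Qed.

Lemma pos_inj m n : injective (@pos m n).
Proof.
move=> [i|i] [j|j] /=; rewrite ?/rev_ord /=.
- by move/ord_inj ->.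
- by case: i j => i hi [j hj] /=; lia.
- by case: i j => i hi [j hj] /=; lia.
- by case: i j => i hi [j hj] /= h; congr inr; apply: ord_inj => /=; lia.
Qed.

Lemma between_of_nc (a a' b b' : nat) :
  b <> a -> b <> a' -> b' <> a -> b' <> a' ->
  (forall c c' d d', c = a /\ c' = a' \/ c = a' /\ c' = a ->
     d = b /\ d' = b' \/ d = b' /\ d' = b ->
     (c < d -> d < c' -> c' < d' -> False) /\ (d < c -> c < d' -> d' < c' -> False))%N ->
  between a a' b = between a a' b'.
Proof.
move=> h1 h2 h3 h4 h.
have [] := h a a' b b' (or_introl (conj erefl erefl)) (or_introl (conj erefl erefl)).
have [] := h a' a b b' (or_intror (conj erefl erefl)) (or_introl (conj erefl erefl)).
have [] := h a a' b' b (or_introl (conj erefl erefl)) (or_intror (conj erefl erefl)).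
have [] := h a' a b' b (or_intror (conj erefl erefl)) (or_intror (conj erefl erefl)).
by clear h; rewrite /between => *; apply/idP/idP => /orP[]; lia.
Qed.

Lemma nc_of_between (a a' b b' : nat) : between a a' b = between a a' b' ->
  (a < b)%N -> (b < a')%N -> (a' < b')%N -> False.
Proof. by rewrite /between => h h1 h2 h3; move: h; rewrite h1 h2 /= => /esym/orP[] ?; lia. Qed.

Lemma TL_noncrossing m n (l : TL m n) : noncrossing (@pos m n) [set: endpoint m n] l.
Proof.
case: l => f /= /and3P[/forallP f1 /forallP f2 /forallP f3].
have ff e : f (f e) = e by apply/eqP.
have nc e e' : (pos e < pos e' -> pos e' < pos (f e) -> pos (f e) < pos (f e') -> False)%N.
  by move=> h1 h2 h3; move/forallP: (f3 e) => /(_ e'); rewrite h1 h2 h3.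
split => [e _|e _|e _|e e' _ _ h1 h2]; rewrite ?inE //.
apply: between_of_nc.
- by move/pos_inj/eqP; rewrite (negbTE h1).
- by move/pos_inj/eqP; rewrite (negbTE h2).
- by move/pos_inj => h; move/eqP: h2; rewrite -h ff.
- by move/pos_inj/(congr1 f); rewrite !ff; apply/eqP.
by move=> c c' d d' [] [-> ->] [] [-> ->]; split;
  [have := nc e e'|have := nc e' e|have := nc e (f e')|have := nc (f e') e
  |have := nc (f e) e'|have := nc e' (f e)|have := nc (f e) (f e')|have := nc (f e') (f e)]; rewrite ?ff.
Qed.

Lemma noncrossing_TL m n (f : endpoint m n -> endpoint m n) :
  noncrossing (@pos m n) [set: endpoint m n] f -> is_TL [ffun e => f e].
Proof.
case=> _ f1 ff nc; apply: is_TLP => [e|e|e e']; rewrite !ffunE.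
- by apply/eqP/f1; rewrite inE.
- by apply: ff; rewrite inE.
move=> h1 h2 h3; apply: (nc_of_between _ h1 h2 h3); apply: nc; rewrite ?inE //.
  by apply: contraTneq h1 => ->; rewrite ltnn.
by apply: contraTneq h2 => ->; rewrite ltnn.
Qed.

Lemma connect_homo (T T' : finType) (h : T -> T') (e : rel T) (e' : rel T') :
  (forall x y, e x y -> connect e' (h x) (h y)) ->
  forall x y, connect e x y -> connect e' (h x) (h y).
Proof.
move=> he x y /connectP[p pth ->]; elim: p x pth => [|z p IH] x /=; first by rewrite connect0.
by case/andP => /he xz /IH; exact: connect_trans.
Qed.

Section Involution.
Variables (X : finType) (f : X -> X).
Hypothesis ff : involutive f.

Definition graph_of : rel X := fun x y => y == f x.

Lemma graph_of_sym : symmetric graph_of.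
Proof. by move=> x y; rewrite /graph_of; apply/eqP/eqP => ->. Qed.

Lemma matched_graph_of A : matched graph_of A f.
Proof.
move=> e e' _ _; apply/idP/orP; last first.
  by case=> /eqP ->; [exact: connect0|apply: connect1; rewrite /graph_of].
case/connectP => p pth ->; elim: p e pth => [|z p IH] e /=; first by left.
case/andP => /eqP -> /IH; rewrite ff; case => /eqP ->; last by left; rewrite eqxx.
by right.
Qed.

Lemma n_comp_graph_of : n_comp graph_of (isolated graph_of [set: X]) = 0%N.
Proof.
apply: eq_card0 => z; rewrite !inE; apply/negP => /andP[_ /existsP []].
by exists z; rewrite inE connect0.
Qed.

End Involution.

(** Spins are total functions and the summed positions form a list: concatenating and permuting
    lists then replaces the reindexing of sums over functions on finite types. *)
Definition sum_bits (I : eqType) (L : seq I) (g : (I -> bool) -> K) : (I -> bool) -> K :=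
  foldl (fun g i s => \sum_(b : bool) g (upd s i b)) g L.

Section SumBits.
Variable I : eqType.
Implicit Types (L : seq I) (g : (I -> bool) -> K) (s : I -> bool).

Lemma eq_sum_bits L g g' s : g =1 g' -> sum_bits L g s = sum_bits L g' s.
Proof. by move=> /funext ->. Qed.

Lemma sum_bitsZ L a g s : sum_bits L (fun t => a * g t) s = a * sum_bits L g s.
Proof.
rewrite /sum_bits; elim: L g s => [|i L IH] g s //=.
by rewrite -IH; congr (foldl _ _ _ _); apply: funext => t; rewrite big_distrr.
Qed.

Lemma sum_bits_sum (J : Type) (r : seq J) L (g : J -> (I -> bool) -> K) s :
  sum_bits L (fun t => \sum_(j <- r) g j t) s = \sum_(j <- r) sum_bits L (g j) s.
Proof.
rewrite /sum_bits; elim: L g s => [|i L IH] g s //=.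
by rewrite -IH; congr (foldl _ _ _ _); apply: funext => t; rewrite exchange_big.
Qed.

End SumBits.

Lemma sum_bits_exchange (I J : eqType) (L : seq I) (L' : seq J) g s t :
  sum_bits L (fun s => sum_bits L' (g s) t) s = sum_bits L' (fun t => sum_bits L (g^~ t) s) t.
Proof.
elim: L g s => [|i L IH] g s //.
transitivity (sum_bits L (fun s => sum_bits L' (fun t => \sum_(b : bool) g (upd s i b) t) t) s).
  by apply: (@eq_sum_bits _ L) => s'; rewrite sum_bits_sum.
by rewrite (IH (fun s t => \sum_b g (upd s i b) t)).
Qed.

(** * The spin model *)

(** Bottom spins are negated because the two ends of a turn carry opposite spins: one spin at the
    middle level then labels both the top end below it and the bottom end above it. *)
Definition label m n (b t : nat -> bool) (e : endpoint m n) : bool :=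
  match e with inl i => ~~ b i | inr j => t j end.

(** The turns of the top endpoints are included, so that stacking two weights supplies exactly one
    turn per middle endpoint and a vertical strand has weight [(b == t)%:R]. *)
Definition weight m n (l : TL m n) (b t : nat -> bool) : K :=
  (\prod_(j < n) turn_wt (t j)) *
  state_wt (@pos m n) [set: endpoint m n] l (label b t).

Lemma TLK m n (l : TL m n) : involutive l.
Proof. by case: (TL_noncrossing l) => _ _ h _ e; apply: h; rewrite inE. Qed.

Lemma TL_neq m n (l : TL m n) e : l e != e.
Proof. by case: (TL_noncrossing l) => _ h _ _; apply: h; rewrite inE. Qed.

Lemma glue_sum_bits (X : finType) (I : eqType) (J : eqType) (v : J -> I)
    (pr : J -> X * X) (lab : (I -> bool) -> X -> bool) (L : seq J) g t :
  uniq [seq v j | j <- L] ->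
  (forall t j b, j \in L ->
     upd (upd (lab t) (pr j).1 b) (pr j).2 (~~ b) = lab (upd t (v j) b)) ->
  glue_sum [seq pr j | j <- L] g (lab t) =
  sum_bits [seq v j | j <- L]
    (fun t => (\prod_(j <- L) turn_wt (t (v j))) * g (lab t)) t.
Proof.
rewrite /glue_sum /sum_bits; elim: L g t => [|j L IH] g t /=.
  by rewrite big_nil mul1r.
case/andP => jL uL h; rewrite IH //; last by move=> *; apply: h; rewrite inE; apply/orP; right.
congr (foldl _ _ _ _); apply: funext => s; rewrite big_distrr; apply: eq_bigr => b _.
rewrite /= h ?mem_head // big_cons [upd s (v j) b (v j)]/upd eqxx mulrA [turn_wt b * _]mulrC; congr (_ * _ * _).
apply: eq_big_seq => i iL; rewrite /upd; case: eqP => // e.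
by move: jL; rewrite -e map_f.
Qed.

Lemma between_above a b c : (a < c)%N -> (b < c)%N -> between a b c = false.
Proof. by rewrite /between => h1 h2; lia. Qed.

Lemma between_below a b c : (c < a)%N -> (c < b)%N -> between a b c = false.
Proof. by rewrite /between => h1 h2; lia. Qed.

Section Stack.
Variables (m n p : nat) (l2 : TL n p) (l1 : TL m n).

Let X : finType := (endpoint m n + endpoint n p)%type.
Let posX (x : X) : nat := match x with inl e => pos e | inr e => (m + n + pos e)%N end.
Let f0 (x : X) : X := match x with inl e => inl (l1 e) | inr e => inr (l2 e) end.
Let pr (j : 'I_n) : X * X := (inl (inr j), inr (inl j)).
Let ps := [seq pr j | j <- enum 'I_n].
Let k (e : endpoint m p) : X := match e with inl i => inl (inl i) | inr i => inr (inr i) end.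
Let G' := glue_rel ps (graph_of f0).
Let A' := glue_rest ps [set: X].

Let f0K : involutive f0.
Proof. by case=> e /=; rewrite TLK. Qed.

Let pos_lt a b (e : endpoint a b) : (pos e < a + b)%N.
Proof. by have := pos_flip e; lia. Qed.

Let posX_inj : injective posX.
Proof.
move=> [e|e] [e'|e'] /=.
- by move/pos_inj ->.
- by have := pos_lt e; lia.
- by have := pos_lt e'; lia.
- by move/addnI/pos_inj ->.
Qed.

Let nc0 : noncrossing posX [set: X] f0.
Proof.
have [_ n1 k1 c1] := TL_noncrossing l1; have [_ n2 k2 c2] := TL_noncrossing l2.
split => [e _|e _|e _|]; rewrite ?inE ?f0K //.
  by case: e => e /=; [have := TL_neq l1 e|have := TL_neq l2 e]; apply: contra_neq => -[].
move=> [e|e] [e'|e'] _ _ h1 h2 /=.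
- by apply: c1; rewrite ?inE.
- by rewrite !between_above // ltn_addr // pos_lt.
- by rewrite !between_below // ltn_addr // pos_lt.
- have := c2 e e'; rewrite !inE /between !ltn_add2l => -> //.
Qed.

Let kA x : (x \in A') = (x \in codom k).
Proof.
rewrite in_glue_rest inE /=; apply/allP/codomP; last first.
  by move=> [e ->] p' /mapP[j _ ->]; case: e.
case: x => [[i|j]|[j|i]] h.
- by exists (inl i).
- by have := h (pr j) (map_f _ (mem_enum _ j)); rewrite eqxx.
- by have := h (pr j) (map_f _ (mem_enum _ j)); rewrite eqxx andbF.
- by exists (inr i).
Qed.

(** The two copies of the middle endpoint [j] sit at the positions [m + n - 1 - j] and [m + n + j];
    everything between them has smaller index and is already glued. *)
Let nested_map (L : seq 'I_n) (A : {set X}) :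
  sorted (fun i j : 'I_n => i < j)%N L ->
  {in L, forall j, ((pr j).1 \in A) && ((pr j).2 \in A)} ->
  {in A, forall z, (forall j, z = (pr j).1 \/ z = (pr j).2 -> j \in L)} ->
  nested posX A [seq pr j | j <- L].
Proof.
have lt_trans : transitive (fun i j : 'I_n => i < j)%N by move=> ? ? ?; exact: ltn_trans.
elim: L A => [|j L IH] A //= sL inA ALL.
have jL i : i \in L -> (j < i)%N.
  by move=> iL; have /allP := order_path_min lt_trans sL; apply.
have /andP[xA yA] := inA _ (mem_head _ _).
split=> //.
- by have := ltn_ord j; rewrite /=; clear; lia.
- move=> z zA; apply/negP => /andP[h1 h2].
  have {}jL i : i \in j :: L -> (j <= i)%N.
    by rewrite inE => /orP[/eqP -> //|/jL/ltnW].
  case: z zA h1 h2 => [[i|i]|[i|i]] zA /= h1 h2.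
  + by move: h1 (ltn_ord i); clear; lia.
  + have := jL i (ALL _ zA i (or_introl erefl)).
    by have := ltn_ord i; have := ltn_ord j; move: h1 h2; clear; lia.
  + have := jL i (ALL _ zA i (or_intror erefl)).
    by have := ltn_ord i; have := ltn_ord j; move: h1 h2; clear; lia.
  + by move: h2 (ltn_ord i) (ltn_ord j); clear; lia.
- apply: IH; first exact: path_sorted sL.
    move=> i iL; have /andP[xiA yiA] := inA i (mem_behead (s := j :: L) iL).
    have ij : i != j by apply: contraTneq (jL _ iL) => ->; rewrite ltnn.
    by rewrite !inE xiA yiA !andbT /=; apply/andP; split; apply: contra_neq ij => -[].
  move=> z; rewrite !inE => /and3P[zy zx zA] i h.
  have := ALL z zA i h; rewrite inE => /orP[/eqP ij|//].
  by case: h => h; [move: zx|move: zy]; rewrite h ij eqxx.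
Qed.

Let nested_ps : nested posX [set: X] ps.
Proof.
apply: nested_map => [|j _|z _ j _]; rewrite ?inE ?mem_enum //.
have := iota_ltn_sorted 0 n; rewrite -val_enum_ord sorted_map.
by apply: sub_sorted.
Qed.

Let hJ (x : X) : joint m n p := match x with inl e => lower p e | inr e => upper m e end.
Let rJ (y : joint m n p) : X :=
  match y with inl (inl i) => inl (inl i) | inl (inr j) => inl (inr j) | inr i => inr (inr i) end.

Let hk e : hJ (k e) = outer n e. Proof. by case: e. Qed.

Let G'sym : symmetric G'.
Proof. by apply: glue_rel_sym; exact: graph_of_sym. Qed.

Let glue_sym : symmetric (Defs.glue l2 l1).
Proof.
move=> x y; apply/orP/orP => [] [] /existsP[e /andP[/eqP -> /eqP ->]].
- by left; apply/existsP; exists (l1 e); rewrite TLK !eqxx.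
- by right; apply/existsP; exists (l2 e); rewrite TLK !eqxx.
- by left; apply/existsP; exists (l1 e); rewrite TLK !eqxx.
- by right; apply/existsP; exists (l2 e); rewrite TLK !eqxx.
Qed.

Let rhJ x : connect G' x (rJ (hJ x)).
Proof.
case: x => [[i|j]|[j|i]] /=; try exact: connect0.
apply: connect1; rewrite /G' glue_relE; apply/orP; right; apply/hasP.
by exists (pr j); rewrite ?map_f ?mem_enum // !eqxx orbT.
Qed.

(** The map [hJ] identifies the two copies of a middle endpoint, which a gluing edge connects in
    [X]; collapsing such edges does not affect connectedness. *)
Let connect_glue x y : connect (Defs.glue l2 l1) (hJ x) (hJ y) = connect G' x y.
Proof.
have cs := sym_connect_sym G'sym.
have f0G u : connect G' u (f0 u).
  by apply: connect1; rewrite /G' glue_relE /graph_of eqxx.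
apply/idP/idP.
  move=> h; apply: connect_trans (rhJ x) _; rewrite cs.
  apply: connect_trans (rhJ y) _; rewrite cs; move: h; apply: connect_homo => {x y}.
  have step u : connect G' (rJ (hJ u)) (rJ (hJ (f0 u))).
    by apply: connect_trans (connect_trans _ (f0G u)) (rhJ _); rewrite cs.
  move=> x y /orP[] /existsP[e /andP[/eqP -> /eqP ->]].
    exact: (step (inl e)).
  exact: (step (inr e)).
apply: connect_homo => {x y} x y.
rewrite /G' glue_relE /graph_of => /orP[/eqP ->|/hasP[_ /mapP[j _ ->] /orP[] /andP[/eqP -> /eqP ->]]];
  try exact: connect0.
apply: connect1; apply/orP; case: x => e; [left|right]; apply/existsP; exists e => /=; exact/andP.
Qed.

(** Stacking contracts the pairs of endpoints at the middle level from left to right: each pair is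
    adjacent along the boundary of what is left of the two strips placed side by side. *)
Lemma stack_TL : exists l : TL m p,
  [/\ is_comp l2 l1 l, forall l', is_comp l2 l1 l' -> l' = l &
   forall b s t0, sum_bits (iota 0 n) (fun t => weight l2 t s * weight l1 b t) t0 =
     delta ^+ circles l2 l1 * weight l b s].
Proof.
have mt : matched (graph_of f0) [set: X] f0 by exact: matched_graph_of.
have sG : symmetric (graph_of f0) by exact: graph_of_sym.
have [f' [c []]] := glue_pairs posX_inj sG nc0 mt nested_ps.
rewrite -/G' -/A' n_comp_graph_of // add0n => nc' mt' nc_c wt'.
have [f'A f'1 f'f' f'c] := nc'.
have kA' e : k e \in A' by rewrite kA codom_f.
have k_inj : injective k by move=> [e|e] [e'|e'] //= [->].
(* This transports [f'] along the injection [k]; the default [e] never occurs, since [f'] preserves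
   the image of [k]. *)
pose g e := odflt e [pick e' | k e' == f' (k e)].
have kg e : k (g e) = f' (k e).
  rewrite /g; case: pickP => [e' /eqP //|h].
  by have := f'A _ (kA' e); rewrite kA => /codomP[e' /eqP]; rewrite eq_sym h.
have pos_k e e' : (posX (k e) < posX (k e'))%N = (pos e < pos e')%N.
  case: e e' => [i|i] [j|j] //=; have := ltn_ord i; have := ltn_ord j; clear; lia.
have ncg : noncrossing (@pos m p) [set: endpoint m p] g.
  split=> [e _|e _|e _|e e' _ _ h1 h2]; rewrite ?inE //.
  - by apply: contraNneq (f'1 _ (kA' e)) => h; rewrite -kg h.
  - by apply: k_inj; rewrite !kg f'f'.
  - have kh1 : k e' != k e by rewrite (inj_eq k_inj).
    have kh2 : k e' != f' (k e) by rewrite -kg (inj_eq k_inj).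
    by have := f'c _ _ (kA' e) (kA' e') kh1 kh2; rewrite -!kg /between !pos_k.
pose l := MkTL (noncrossing_TL ncg).
have lE e : l e = g e by rewrite /= ffunE.
have out e e' : connect (Defs.glue l2 l1) (outer n e) (outer n e') = (e' == e) || (e' == l e).
  by rewrite -!hk connect_glue mt' // lE -kg !(inj_eq k_inj).
exists l; split.
- by apply/forallP => e; rewrite out eqxx orbT.
- move=> l' /forallP h; apply: val_inj; apply/ffunP => e /=.
  by have := h e; rewrite out (negbTE (TL_neq _ _)) => /eqP ->.
move=> b s t0.
pose lab t (x : X) : bool := match x with inl e => label b t e | inr e => label t s e end.
have -> : circles l2 l1 = c.
  rewrite -nc_c /circles; rewrite (adjunction_n_comp hJ (e' := G')); last 4 first.
  - exact: sym_connect_sym.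
  - exact: sym_connect_sym.
  - move=> x y xy; rewrite !inE; congr (~~ _); apply: eq_existsb => e.
    by rewrite (same_connect (sym_connect_sym glue_sym) (connect1 xy)).
  - split=> [y _|x y _]; last by rewrite connect_glue.
    by case: y => [[i|j]|i];
      [exists (inl (inl i))|exists (inl (inr j))|exists (inr (inr i))]; exact: connect0.
  apply: eq_n_comp_r => x; rewrite !inE; congr (~~ _).
  apply/existsP/existsP => [[e h]|[e /andP[]]].
    by exists (k e); rewrite kA' -connect_glue hk.
  by rewrite kA => /codomP[e' ->]; exists e'; rewrite -hk connect_glue.
have split_wt t : weight l2 t s * weight l1 b t =
    (\prod_(i < p) turn_wt (s i)) *
    ((\prod_(j <- enum 'I_n) turn_wt (t j)) * state_wt posX [set: X] f0 (lab t)).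
  rewrite /weight big_enum /= -!mulrA; congr (_ * _); rewrite mulrCA; congr (_ * _).
  rewrite mulrC !state_wtE; under eq_bigl do rewrite inE.
  under [X in _ * X]eq_bigl do rewrite inE.
  under [in RHS]eq_bigl do rewrite inE.
  rewrite [RHS]big_sumType; congr (_ * _); apply: eq_bigr => e _; rewrite /end_wt //=.
  by rewrite ltn_add2l.
rewrite (funext split_wt).
rewrite sum_bitsZ -val_enum_ord.
rewrite -(@glue_sum_bits X nat _ val pr lab); last 2 first.
- by rewrite map_inj_uniq ?enum_uniq //; exact: val_inj.
- move=> t j b' _; apply: funext => -[[i|i]|[i|i]] //=; rewrite /upd /=.
  by rewrite -[inr _ == _]/(nat_of_ord i == nat_of_ord j); case: (_ == _ :> nat).
rewrite wt' mulrCA; congr (_ * (_ * _)).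
have A'E : A' = k @: [set: endpoint m p].
  apply/setP => x; rewrite kA; apply/codomP/imsetP => [[e ->]|[e _ ->]]; exists e => //.
rewrite !state_wtE A'E big_imset /=; last by move=> ? ? _ _; exact: k_inj.
apply: eq_bigr => e _; rewrite /end_wt -kg pos_k ffunE.
have labk e' : lab t0 (k e') = label b s e' by case: e'.
by rewrite !labk.
Qed.

End Stack.

(** This is [turn_wt (~~ b) / turn_wt b]: the closing turn starts at the bottom end, and the top
    turn already contained in [weight] is divided out. The resulting closure is a quantum trace,
    with [delta] as the value of one strand. *)
Definition close_wt (b : bool) : K := if b then - q^-1 else - q.

Lemma sum_bits_neg (I : eqType) (L : seq I) (g : (I -> bool) -> K) s :
  sum_bits L (fun t => g (negb \o t)) s = sum_bits L g (negb \o s).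
Proof.
rewrite /sum_bits; elim: L g s => [|i L IH] g s //=.
rewrite -IH; congr (foldl _ _ _ _); apply: funext => t.
rewrite /= !big_bool /= addrC; congr (g _ + g _); apply: funext => j /=; rewrite /upd /=; by case: eqP.
Qed.

Section PermSum.
Variable I : eqType.

Let sum1 (g : (I -> bool) -> K) i s := \sum_(b : bool) g (upd s i b).

Lemma upd_swap (s : I -> bool) i j b c : i != j -> upd (upd s i b) j c = upd (upd s j c) i b.
Proof.
move=> ij; apply: funext => k; rewrite /upd.
by have [->|//] := eqVneq k j; rewrite eq_sym (negbTE ij).
Qed.

Let sum1C g i j : sum1 (sum1 g i) j = sum1 (sum1 g j) i.
Proof.
have [->//|ij] := eqVneq i j; apply: funext => s; rewrite /sum1 exchange_big.
by apply: eq_bigr => b _; apply: eq_bigr => c _; rewrite upd_swap 1?eq_sym.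
Qed.

Let sum_bits_sum1 L g i : sum_bits L (sum1 g i) = sum1 (sum_bits L g) i.
Proof.
by rewrite /sum_bits; elim: L g => [|j L IH] g //=; rewrite -IH; congr (foldl _ _ _); exact: sum1C.
Qed.

Lemma sum_bits_cat (L L' : seq I) g : sum_bits (L ++ L') g = sum_bits L' (sum_bits L g).
Proof. by rewrite /sum_bits foldl_cat. Qed.

Lemma sum_bitsC (L L' : seq I) g : sum_bits L (sum_bits L' g) = sum_bits L' (sum_bits L g).
Proof.
elim: L g => [|i L IH] g //.
have E h : sum_bits (i :: L) h = sum_bits L (sum1 h i) by [].
by rewrite !E -sum_bits_sum1 IH.
Qed.

Lemma perm_sum_bits (L L' : seq I) g : perm_eq L L' -> sum_bits L g = sum_bits L' g.
Proof.
move=> p; move: p (erefl (sum_bits L g)); pose P M := sum_bits L g = sum_bits M g.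
apply: (@catCA_perm_ind _ P) => s1 s2 s3; rewrite /P => ->.
by rewrite !sum_bits_cat (sum_bitsC s2 s1).
Qed.

End PermSum.

Section Closure.
Variables (n : nat) (l : TL n n).

Let pr (j : 'I_n) : endpoint n n * endpoint n n := (inl j, inr j).
Let ps := [seq pr j | j <- rev (enum 'I_n)].

(** For the closure the rightmost strand comes first: its ends, at the positions [n - 1] and [n],
    are the adjacent ones. *)
Let nested_map (L : seq 'I_n) (A : {set endpoint n n}) :
  sorted (fun i j : 'I_n => j < i)%N L ->
  {in L, forall j, ((pr j).1 \in A) && ((pr j).2 \in A)} ->
  {in A, forall z, (forall j, z = (pr j).1 \/ z = (pr j).2 -> j \in L)} ->
  nested (@pos n n) A [seq pr j | j <- L].
Proof.
have lt_trans : transitive (fun i j : 'I_n => j < i)%N by move=> ? ? ? h1 h2; exact: ltn_trans h2 h1.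
elim: L A => [|j L IH] A //= sL inA ALL.
have jL i : i \in L -> (i < j)%N.
  by move=> iL; have /allP := order_path_min lt_trans sL; apply.
have /andP[xA yA] := inA _ (mem_head _ _).
split=> //.
- by have := ltn_ord j; rewrite /=; clear; lia.
- move=> z zA; apply/negP => /andP[h1 h2].
  have {}jL i : i \in j :: L -> (i <= j)%N.
    by rewrite inE => /orP[/eqP -> //|/jL/ltnW].
  case: z zA h1 h2 => [i|i] zA /= h1 h2.
  + have := jL i (ALL _ zA i (or_introl erefl)).
    by have := ltn_ord i; have := ltn_ord j; move: h1 h2; clear; lia.
  + have := jL i (ALL _ zA i (or_intror erefl)).
    by have := ltn_ord i; have := ltn_ord j; move: h1 h2; clear; lia.
- apply: IH; first exact: path_sorted sL.
    move=> i iL; have /andP[xiA yiA] := inA i (mem_behead (s := j :: L) iL).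
    have ij : i != j by apply: contraTneq (jL _ iL) => ->; rewrite ltnn.
    by rewrite !inE xiA yiA !andbT /=; apply/andP; split; apply: contra_neq ij => -[].
  move=> z; rewrite !inE => /and3P[zy zx zA] i h.
  have := ALL z zA i h; rewrite inE => /orP[/eqP ij|//].
  by case: h => h; [move: zx|move: zy]; rewrite h ij eqxx.
Qed.

Let nested_ps : nested (@pos n n) [set: endpoint n n] ps.
Proof.
apply: nested_map => [|j _|z _ j _]; rewrite ?inE ?mem_rev ?mem_enum //.
rewrite rev_sorted; have := iota_ltn_sorted 0 n; rewrite -val_enum_ord sorted_map.
by apply: sub_sorted.
Qed.

Lemma closure_TL s :
  sum_bits (iota 0 n) (fun b => (\prod_(i < n) close_wt (b i)) * weight l b b) s =
  delta ^+ closure_circles l.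
Proof.
(* The first end of each glued pair is the bottom one, whose label is a negated spin; summing over
   negated spins makes that label [t j]. *)
pose lab (t : nat -> bool) : endpoint n n -> bool := label (negb \o t) (negb \o t).
have mt : matched (graph_of l) [set: endpoint n n] l by apply: matched_graph_of; exact: TLK.
have sG : symmetric (graph_of l) by apply: graph_of_sym; exact: TLK.
have [f' [c []]] := glue_pairs (@pos_inj n n) sG (TL_noncrossing l) mt nested_ps.
rewrite n_comp_graph_of add0n.
have A'0 : glue_rest ps [set: endpoint n n] = finset.set0.
  apply/setP => z; rewrite in_glue_rest !inE /=; apply/negP => /allP h.
  by case: z h => j /(_ (pr j)); rewrite map_f ?mem_rev ?mem_enum // eqxx ?andbF => /(_ isT).
rewrite A'0 => _ _ nc_c wt'.
have -> : closure_circles l = c.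
  rewrite -nc_c; have e : glue_rel ps (graph_of l) =2 closing l.
    move=> u v; rewrite glue_relE /closing /graph_of; congr (_ || _).
    apply/hasP/eqP => [[_ /mapP[j _ ->] /orP[] /andP[/eqP -> /eqP ->]] //|->].
    by case: u => j; exists (pr j); rewrite ?map_f ?mem_rev ?mem_enum //= !eqxx ?orbT.
  rewrite /closure_circles (eq_n_comp (eq_connect e)); apply: eq_n_comp_r => z.
  by rewrite !inE; apply/esym/existsPn => u; rewrite inE.
rewrite -[RHS]mulr1 -[X in _ * X](_ : state_wt (@pos n n) finset.set0 f' (lab (negb \o s)) = 1); last first.
  by rewrite state_wtE big_pred0 // => e; rewrite inE.
rewrite -wt' (@glue_sum_bits _ nat _ val pr lab); last 2 first.
- by rewrite map_inj_uniq ?rev_uniq ?enum_uniq //; exact: val_inj.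
- move=> t j b' _; apply: funext => -[i|i] //=; rewrite /upd /=.
    by rewrite negbK -[inl _ == _]/(nat_of_ord i == nat_of_ord j); case: (_ == _ :> nat); rewrite negbK.
  by rewrite -[inr _ == _]/(nat_of_ord i == nat_of_ord j); case: (_ == _ :> nat).
rewrite -[in LHS](_ : negb \o (negb \o s) = s); last by apply: funext => i /=; rewrite negbK.
rewrite -sum_bits_neg map_rev val_enum_ord.
rewrite (@perm_sum_bits _ (rev _) (iota 0 n)); last by rewrite perm_rev.
apply: eq_sum_bits => t; rewrite /weight mulrA -big_split /=; congr (_ * _).
rewrite [RHS](perm_big (enum 'I_n)) ?perm_rev // [RHS]big_enum /=; apply: eq_bigr => i _.
have q0 := q_neq0; rewrite /close_wt /turn_wt.
by case: (t i); rewrite /= ?mulr1 // mulrNN mulVf.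
Qed.

End Closure.

(** Only finitely many strands are acted upon, but functions of infinitely many spins make the action
    of a tangle independent of the strands on its right. *)
Definition Vec := (nat -> bool) -> K^o.

Definition splice m n (b s : nat -> bool) : nat -> bool :=
  fun j => if (j < m)%N then b j else s (j - m + n)%N.

(** The base point [fun=> false] is arbitrary, since the summand reads only the first [m] values of
    [b]. *)
Definition op_of_TL m n (l : TL m n) (v : Vec) : Vec := fun s =>
  sum_bits (iota 0 m) (fun b => weight l b s * v (splice m n b s)) (fun=> false).

Definition op m n (x : QTL m n) (v : Vec) : Vec := fun s =>
  \sum_(l : TL m n) coordQ x l * op_of_TL l v s.

Definition agree m (s t : nat -> bool) := forall j, (j < m)%N -> s j = t j.

Lemma eq_weight m n (l : TL m n) b b' s s' : agree m b b' -> agree n s s' ->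
  weight l b s = weight l b' s'.
Proof.
move=> hb hs; rewrite /weight; congr (_ * _).
  by apply: eq_bigr => j _; rewrite hs.
congr (state_wt _ _ _ _); apply: funext => -[i|i] /=; by rewrite ?hb ?hs.
Qed.

Lemma splice_splice m n p b t s : splice m n b (splice n p t s) = splice m p b s.
Proof.
apply: funext => j; rewrite /splice; case: ltnP => // mj.
by rewrite ltnNge leq_addl /= addnK.
Qed.

Lemma op_of_TL_comp m n p (l2 : TL n p) (l1 : TL m n) : exists l : TL m p,
  [/\ is_comp l2 l1 l, forall l', is_comp l2 l1 l' -> l' = l &
   forall v s, op_of_TL l2 (op_of_TL l1 v) s = delta ^+ circles l2 l1 * op_of_TL l v s].
Proof.
have [l [h1 h2 h3]] := stack_TL l2 l1; exists l; split=> // v s.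
rewrite /op_of_TL -sum_bitsZ.
transitivity (sum_bits (iota 0 n) (fun t => sum_bits (iota 0 m) (fun b =>
    weight l2 t s * weight l1 b t * v (splice m p b s)) (fun=> false)) (fun=> false)).
  apply: eq_sum_bits => t; rewrite -sum_bitsZ; apply: eq_sum_bits => b.
  rewrite splice_splice mulrA; congr (_ * _ * _); apply: eq_weight => // j jn.
  by rewrite /splice jn.
rewrite sum_bits_exchange; apply: eq_sum_bits => b.
rewrite mulrA -(h3 _ _ (fun=> false)) mulrC -sum_bitsZ; apply: eq_sum_bits => t.
by rewrite mulrC.
Qed.

Lemma op_comp m n p (x : QTL n p) (y : QTL m n) v : op (compQ x y) v = op x (op y v).
Proof.
apply: funext => s; rewrite /op.
under eq_bigr => l _.
  rewrite /coordQ /compQ ffunE /= big_distrl /=.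
  under eq_bigr do rewrite big_distrl /= big_mkcond /=.
  over.
rewrite exchange_big; apply: eq_bigr => l2 _; rewrite exchange_big /=.
have -> : op_of_TL l2 (fun s0 => \sum_(l : TL m n) coordQ y l * op_of_TL l v s0) s =
   \sum_(l : TL m n) coordQ y l * op_of_TL l2 (op_of_TL l v) s.
  rewrite /op_of_TL; under eq_bigr do rewrite -sum_bitsZ.
  rewrite -sum_bits_sum; apply: eq_sum_bits => b; rewrite big_distrr.
  by apply: eq_bigr => l _; rewrite mulrCA.
rewrite big_distrr; apply: eq_bigr => l1 _ /=.
have [l [h1 h2 h3]] := op_of_TL_comp l2 l1.
rewrite (bigD1 l) //= h1 big1 ?addr0; last first.
  by move=> l' ll'; case: ifP => // /h2 e; rewrite e eqxx in ll'.
by rewrite h3 (mulrCA (coordQ y l1)) (mulrCA (coordQ x l2)) !mulrA.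
Qed.

Lemma op_basis m n (l : TL m n) v : op (basisQ l) v = op_of_TL l v.
Proof.
apply: funext => s; rewrite /op (bigD1 l) //= /coordQ ffunE eqxx mul1r big1 ?addr0 // => l' ll'.
by rewrite ffunE (negbTE ll') mul0r.
Qed.

Definition kernel m n (x : QTL m n) b s := \sum_(l : TL m n) coordQ x l * weight l b s.

Lemma opE m n (x : QTL m n) v s :
  op x v s = sum_bits (iota 0 m) (fun b => kernel x b s * v (splice m n b s)) (fun=> false).
Proof.
rewrite /op /op_of_TL; under eq_bigr do rewrite -sum_bitsZ.
rewrite -sum_bits_sum; apply: eq_sum_bits => b; rewrite /kernel big_distrl.
by apply: eq_bigr => l _; rewrite mulrA.
Qed.

Lemma S3E n (x : QTL n n) s :
  S3 x = sum_bits (iota 0 n) (fun b => (\prod_(i < n) close_wt (b i)) * kernel x b b) s.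
Proof.
rewrite /S3; under eq_bigr do rewrite -(closure_TL _ s) -sum_bitsZ.
rewrite -sum_bits_sum; apply: eq_sum_bits => b; rewrite /kernel big_distrr.
by apply: eq_bigr => l _; rewrite mulrCA.
Qed.

Lemma sum_bits_delta (I : eqType) (L : seq I) (c : I -> bool) g s : uniq L ->
  sum_bits L (fun b => (\prod_(i <- L) (b i == c i)%:R) * g b) s =
  g (fun i => if i \in L then c i else s i).
Proof.
elim: L g s => [|i L IH] g s /=; first by rewrite /sum_bits /= big_nil mul1r.
case/andP => iL uL.
transitivity (sum_bits L (fun b => (\prod_(j <- L) (b j == c j)%:R) * g (upd b i (c i))) s).
  apply: (@eq_sum_bits _ L) => b.
  have E b0 : \prod_(j <- i :: L) (upd b i b0 j == c j)%:R = (b0 == c i)%:R * \prod_(j <- L) (b j == c j)%:R :> K.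
    rewrite big_cons [upd b i b0 i]/upd eqxx; congr (_ * _); apply: eq_big_seq => j jL; rewrite /upd.
    by have [e|//] := eqVneq j i; rewrite -e jL in iL.
  by rewrite big_bool !E; case: (c i); rewrite /= !(mul0r, mul1r, addr0, add0r).
rewrite IH //; congr g; apply: funext => j; rewrite /upd inE.
by case: eqP => [->|].
Qed.

Lemma prod_iota n (F : nat -> K) : \prod_(i < n) F i = \prod_(i <- iota 0 n) F i.
Proof. by rewrite -(big_mkord predT) /index_iota subn0. Qed.

Lemma sum_bits_delta_ord n (c : nat -> bool) g s :
  sum_bits (iota 0 n) (fun b => (\prod_(i < n) (b i == c i)%:R) * g b) s =
  g (fun i => if (i < n)%N then c i else s i).
Proof.
rewrite (_ : (fun b => _) = (fun b => (\prod_(i <- iota 0 n) (b i == c i)%:R) * g b)).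
  rewrite sum_bits_delta ?iota_uniq //; congr g; apply: funext => i.
  by rewrite mem_iota add0n leq0n.
by apply: funext => b; rewrite (prod_iota n (fun i => (b i == c i)%:R)).
Qed.

Lemma turn_arc b s : turn_wt s * arc_wt (~~ b) s = (b == s)%:R.
Proof. by have := q_neq0; case: b; case: s => q0; rewrite /= ?mulr0 ?mulr1 // mulrNN mulfV. Qed.

Lemma op_id n v : op (idQ n) v = v.
Proof.
rewrite op_basis; apply: funext => s; rewrite /op_of_TL.
transitivity (sum_bits (iota 0 n) (fun b => (\prod_(i < n) (b i == s i)%:R) * v (splice n n b s)) (fun=> false)).
  apply: eq_sum_bits => b; congr (_ * _); rewrite /weight state_wtE.
  under [X in _ * X]eq_bigl do rewrite inE.
  rewrite big_sumType /= [X in _ * (_ * X)]big1 ?mulr1; last first.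
    move=> i _; rewrite /end_wt ffunE /= ltnNge ltnW //.
    by have := ltn_ord i; clear; lia.
  rewrite -big_split; apply: eq_bigr => i _ /=.
  rewrite /end_wt ffunE /= ltn_addr // turn_arc //.
rewrite sum_bits_delta_ord; congr v; apply: funext => j; rewrite /splice.
by case: ltnP => // nj; rewrite subnK.
Qed.

Definition del i (s : nat -> bool) : nat -> bool := fun j => s (if (j < i)%N then j else j.+2).

Definition ins i b (s : nat -> bool) : nat -> bool := fun j =>
  if (j < i)%N then s j else if j == i then b else if j == i.+1 then ~~ b else s j.-2.

(** This is [turn_wt a * turn_wt b * arc_wt b a]: along the boundary the right end of a cup comes
    first. Likewise [cap_wt b] below is [arc_wt (~~ b) b], with the negated labels of bottom
    ends. *)
Definition cup_wt (a b : bool) : K :=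
  match a, b with true, false => 1 | false, true => - q | _, _ => 0 end.

Definition cap_wt (b : bool) : K := if b then - q^-1 else 1.

Definition Cup i (v : Vec) : Vec := fun s => cup_wt (s i) (s i.+1) * v (del i s).

Definition Cap i (v : Vec) : Vec := fun s => \sum_(b : bool) cap_wt b * v (ins i b s).

Lemma bump2 i j : bump i (bump i j) = if (j < i)%N then j else j.+2.
Proof. by rewrite /bump; case: ltnP; lia. Qed.

Definition skip i (j : nat) : nat := if (j < i)%N then j else j.+2.

Lemma skip_inj i : injective (skip i).
Proof. by move=> j k; rewrite /skip; case: ltnP => h1; case: ltnP => h2; lia. Qed.

Lemma skip_neq i j : skip i j != i /\ skip i j != i.+1.
Proof. by rewrite /skip; case: (ltnP j i) => h; lia. Qed.

Lemma mem_skip n i k : (i <= n)%N -> (k < n.+2)%N ->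
  (k \in map (skip i) (iota 0 n)) = (k != i) && (k != i.+1).
Proof.
move=> le_in kn; apply/mapP/andP => [[j _ ->]|[ki ki1]]; first by have [] := skip_neq i j.
have [h|h] := ltnP k i.
  by exists k; [rewrite mem_iota /=; lia|rewrite /skip h].
exists k.-2; first by rewrite mem_iota /=; lia.
by rewrite /skip; case: (ltnP k.-2 i) => h2; lia.
Qed.

Lemma perm_skip n i : (i <= n)%N ->
  perm_eq (iota 0 n.+2) (map (skip i) (iota 0 n) ++ [:: i.+1; i]).
Proof.
move=> le_in; have notin j : j = i \/ j = i.+1 -> j \notin map (skip i) (iota 0 n).
  by move=> h; apply/mapP => -[k _ e]; have [/eqP h1 /eqP h2] := skip_neq i k; case: h; rewrite e.
apply: uniq_perm; first exact: iota_uniq.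
  rewrite cat_uniq map_inj_uniq ?iota_uniq /=; last exact: skip_inj.
  by rewrite !(negbTE (notin _ _)) ?inE ?gtn_eqF //; auto.
move=> k; rewrite mem_iota mem_cat !inE /=; have [kn|nk] := ltnP k n.+2.
  by rewrite mem_skip //; case: (k == i); case: (k == i.+1).
apply/esym/negbTE; rewrite !negb_or; apply/and3P; split; last 2 first.
- by rewrite gtn_eqF // (leq_trans _ nk) // !ltnS.
- by rewrite gtn_eqF // (leq_trans _ nk) // ltnS leqW.
apply/mapP => -[j]; rewrite mem_iota /= add0n => jn e; move: nk; rewrite e /skip.
by case: (ltnP j i) => h; lia.
Qed.

Section CupTL.
Variables (n : nat) (i : 'I_n.+1).

Definition cup_left : 'I_n.+2 := widen_ord (leqnSn _) i.
Definition cup_right : 'I_n.+2 := lift cup_left i.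
Definition cup_shift (j : 'I_n) : 'I_n.+2 := lift cup_left (lift i j).

Lemma cup_rightE : cup_right = i.+1 :> nat.
Proof. by rewrite /= /bump leqnn. Qed.

Lemma cup_shiftE j : cup_shift j = (if (j < i)%N then j : nat else j.+2) :> nat.
Proof. exact: bump2. Qed.

Lemma cupTL_inl j : cupTL i (inl j) = inr (cup_shift j).
Proof. by rewrite /= ffunE. Qed.

Lemma cupTL_left : cupTL i (inr cup_left) = inr cup_right.
Proof. by rewrite /= ffunE /= unlift_none. Qed.

Lemma cupTL_right : cupTL i (inr cup_right) = inr cup_left.
Proof. by rewrite /= ffunE /= liftK unlift_none. Qed.

Lemma cupTL_shift j : cupTL i (inr (cup_shift j)) = inl j.
Proof. by rewrite /= ffunE /= !liftK. Qed.

Lemma big_cup (F : 'I_n.+2 -> K) :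
  \prod_(k < n.+2) F k = F cup_left * (F cup_right * \prod_(j < n) F (cup_shift j)).
Proof. by rewrite (bigD1_ord cup_left) //= (bigD1_ord i). Qed.

Lemma cup_weight b s : weight (cupTL i) b s =
  (\prod_(j < n) (b j == del i s j)%:R) * cup_wt (s i) (s i.+1).
Proof.
rewrite /weight state_wtE; under [X in _ * X]eq_bigl do rewrite inE.
rewrite big_sumType /= !big_cup.
set E := end_wt _ _ _.
have E1 j : E (inl j) = arc_wt (~~ b j) (s (cup_shift j)).
  by rewrite /E /end_wt cupTL_inl /= ltn_addr // ltn_ord.
have E2 j : E (inr (cup_shift j)) = 1.
  by rewrite /E /end_wt cupTL_shift /= ltnNge (leq_trans (ltnW (ltn_ord j))) ?leq_addr.
have E3 : E (inr cup_left) = 1.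
  rewrite /E /end_wt cupTL_left /= /bump leqnn /= ifF //.
  by clear; lia.
have E4 : E (inr cup_right) = arc_wt (s i.+1) (s i).
  rewrite /E /end_wt cupTL_right /= /bump leqnn /= ifT //.
  by have := ltn_ord i; clear; lia.
rewrite (eq_bigr _ (fun j _ => E1 j)) (eq_bigr _ (fun j _ => E2 j)) big1_eq E3 E4 mulr1 mul1r.
have shuffle (x1 x2 x3 x4 x5 : K) : x1 * (x2 * x3) * (x4 * x5) = x3 * x4 * (x1 * x2 * x5) by ring.
rewrite cup_rightE shuffle.
have -> : \prod_(j < n) turn_wt (s (cup_shift j)) * \prod_(j < n) arc_wt (~~ b j) (s (cup_shift j)) =
   \prod_(j < n) (b j == del i s j)%:R.
  by rewrite -big_split; apply: eq_bigr => j _ /=; rewrite turn_arc /del bump2.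
congr (_ * _); have := q_neq0; rewrite /cup_left /=.
by case: (s i); case: (s i.+1) => q0; rewrite /= ?(mulr0, mulr1, mul1r) // mulrNN mulfV.
Qed.

Lemma op_cup v : op (basisQ (cupTL i)) v = Cup i v.
Proof.
rewrite op_basis; apply: funext => s; rewrite /op_of_TL /Cup.
transitivity (sum_bits (iota 0 n) (fun b => (\prod_(j < n) (b j == del i s j)%:R) *
   (cup_wt (s i) (s i.+1) * v (splice n n.+2 b s))) (fun=> false)).
  by apply: eq_sum_bits => b; rewrite mulrA cup_weight.
rewrite sum_bits_delta_ord; congr (_ * v _); apply: funext => j; rewrite /splice /del.
case: ltnP => // nj; rewrite addnS addnS subnK // ltnNge (leq_trans _ nj) //.
by rewrite -ltnS.
Qed.

Lemma capTL_inr j : capTL i (inr j) = inl (cup_shift j).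
Proof. by rewrite /= ffunE /= ffunE. Qed.

Lemma capTL_left : capTL i (inl cup_left) = inl cup_right.
Proof. by rewrite /= ffunE -[X in flip_end X]/(cupTL i (inr cup_left)) cupTL_left. Qed.

Lemma capTL_right : capTL i (inl cup_right) = inl cup_left.
Proof. by rewrite /= ffunE -[X in flip_end X]/(cupTL i (inr cup_right)) cupTL_right. Qed.

Lemma capTL_shift j : capTL i (inl (cup_shift j)) = inr j.
Proof. by rewrite /= ffunE -[X in flip_end X]/(cupTL i (inr (cup_shift j))) cupTL_shift. Qed.

Lemma cap_weight b s : weight (capTL i) b s =
  arc_wt (~~ b i) (~~ b i.+1) * \prod_(j < n) (del i b j == s j)%:R.
Proof.
rewrite /weight state_wtE; under [X in _ * X]eq_bigl do rewrite inE.
rewrite big_sumType /= !big_cup.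
set E := end_wt _ _ _.
have E1 j : E (inr j) = 1.
  by rewrite /E /end_wt capTL_inr ltnNge (leq_trans (ltnW (ltn_ord (cup_shift j)))) //= leq_addr.
have E2 j : E (inl (cup_shift j)) = arc_wt (~~ b (cup_shift j)) (s j).
  by rewrite /E /end_wt capTL_shift ltn_addr // ltn_ord.
have E3 : E (inl cup_left) = arc_wt (~~ b i) (~~ b i.+1).
  by rewrite /E /end_wt capTL_left /= /bump leqnn /= ltnSn.
have E4 : E (inl cup_right) = 1.
  by rewrite /E /end_wt capTL_right /= /bump leqnn /= ifF //; clear; lia.
rewrite (eq_bigr _ (fun j _ => E1 j)) (eq_bigr _ (fun j _ => E2 j)) big1_eq E3 E4 mulr1 mul1r.
rewrite mulrCA; congr (_ * _).
by rewrite -big_split; apply: eq_bigr => j _ /=; rewrite turn_arc /del bump2.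
Qed.

Lemma op_cap v : op (basisQ (capTL i)) v = Cap i v.
Proof.
rewrite op_basis; apply: funext => s; rewrite /op_of_TL /Cap.
have le_in : (i <= n)%N by rewrite -ltnS.
pose shift := skip i.
rewrite (perm_sum_bits _ (perm_skip le_in)) sum_bits_cat -/shift.
have c_shift j : ins i true s (shift j) = s j.
  rewrite /ins /shift /skip; case: (ltnP j i) => [-> //|ij].
  by rewrite !gtn_eqF ?ltnS // ?leqW // ltnNge !leqW.
have shift_inj : injective shift by exact: skip_inj.
(* The vertical strands force all spins but those at [i] and [i.+1]; [fill] is the forced
   assignment, which does not depend on the inserted value [true]. *)
pose fill (b : nat -> bool) k := if k \in map shift (iota 0 n) then ins i true s k else b k.
have -> : sum_bits (map shift (iota 0 n)) (fun b => weight (capTL i) b s * v (splice n.+2 n b s)) =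
   fun b => arc_wt (~~ fill b i) (~~ fill b i.+1) * v (splice n.+2 n (fill b) s).
  apply: funext => b; rewrite -/(fill b).
  rewrite -(@sum_bits_delta _ _ (ins i true s) (fun b => arc_wt (~~ b i) (~~ b i.+1) * v (splice n.+2 n b s)));
    last by rewrite map_inj_uniq // iota_uniq.
  apply: eq_sum_bits => {}b; rewrite cap_weight mulrAC [RHS]mulrC; congr (_ * _).
  rewrite big_map; apply: etrans (prod_iota n (fun j => (del i b j == s j)%:R)) _.
  by apply: eq_bigr => j _; rewrite c_shift.
have mem_shift k : (k < n.+2)%N -> (k \in map shift (iota 0 n)) = (k != i) && (k != i.+1).
  exact: mem_skip.
have memi : ((i : nat) \in map shift (iota 0 n)) = false.
  by rewrite mem_shift ?eqxx // ltnS ltnW.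
have memi1 : (i.+1 \in map shift (iota 0 n)) = false.
  by rewrite mem_shift ?eqxx ?andbF // ltnS.
rewrite /sum_bits /=; apply: eq_bigr => b _; rewrite big_bool /fill memi memi1 /upd !eqxx.
have -> : (i == i.+1 :> nat) = false by rewrite ltn_eqF.
have fillE : splice n.+2 n (fun k => if k \in [seq shift i | i <- iota 0 n] then ins i true s k
   else if k == i.+1 then ~~ b else if k == i then b else false) s = ins i b s.
  apply: funext => k; rewrite /splice; case: ltnP => kn.
    rewrite mem_shift // /ins; have [->|_] := eqVneq k i => /=; first by rewrite ltnn ltn_eqF.
    by have [->|_] := eqVneq k i.+1; rewrite //= ltnNge leqW // gtn_eqF.
  have [h1 [h2 h3]] : (i.+1 < k)%N /\ k.-2 = (k - n.+2 + n)%N /\ (k < i)%N = false.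
    by have := ltn_ord i; clear -kn; lia.
  by rewrite /ins h3 !gtn_eqF // ?h2 // ltnW.
rewrite (_ : cap_wt b = arc_wt (~~ b) b); last by clear; case: b.
by case: b fillE => /= e; rewrite e !mul0r ?addr0 ?add0r.
Qed.

End CupTL.

(** * Faithfulness of the spin model *)

Lemma TLP4 m n (l : TL m n) e e' : e' != e -> e' != l e ->
  between (pos e) (pos (l e)) (pos e') = between (pos e) (pos (l e)) (pos (l e')).
Proof. by case: (TL_noncrossing l) => _ _ _ h; apply: h; rewrite inE. Qed.

Definition opener m n (l : TL m n) e := (pos e < pos (l e))%N.

Lemma opener_TL m n (l : TL m n) e : opener l (l e) = ~~ opener l e.
Proof.
rewrite /opener TLK ltnNge leq_eqVlt; case: eqP => // /pos_inj e'.
by have := TL_neq l e; rewrite -e' eqxx.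
Qed.

(** If [l'] closes [e] later than [l] does, then in [l'] the arc ending at [l e] must be nested
    inside the arc of [e]. Its opener is the new disagreement, further along the boundary. *)
Lemma opener_step m n (l l' : TL m n) e : opener l =1 opener l' -> opener l e ->
  (pos (l e) < pos (l' e))%N ->
  exists z, [/\ opener l z, (pos e < pos z)%N & l z != l' z].
Proof.
move=> ll' oe lt; pose y := l e; pose z := l' y.
have oy : ~~ opener l y by rewrite opener_TL oe.
have oz : opener l z by rewrite ll' opener_TL -ll'.
have nze : z != e.
  apply: contraTneq lt => h; have -> : l' e = l e by apply: (can_inj (TLK l')); rewrite TLK -{1}h.
  by rewrite ltnn.
exists z; split => //; last first.
  rewrite /z TLK -/z; apply: contraNneq nze => h; apply/eqP.
  by rewrite -(TLK l z) h /y TLK.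
rewrite ltn_neqAle; apply/andP; split; first by apply: contraNneq nze => /pos_inj ->.
rewrite leqNgt; apply/negP => ze.
have := @TLP4 _ _ l' z e; rewrite eq_sym nze /z TLK => /(_ isT).
have ye : e != y by rewrite eq_sym TL_neq.
rewrite -/z => /(_ ye); move: oe lt; rewrite /opener -/y /between => h1 h2.
by move: ze h1 h2; clear; lia.
Qed.

Lemma opener_inj m n (l l' : TL m n) : opener l =1 opener l' -> l = l'.
Proof.
move=> ll'; apply: val_inj; apply/ffunP => e.
have key e0 : opener l e0 -> l e0 = l' e0.
  move=> oe0; apply/eqP/negPn/negP => ne0.
  pose P e := opener l e && (l e != l' e).
  have P0 : P e0 by rewrite /P oe0.
  (* At the last disagreement, [opener_step] yields a later one, whichever tangle closes it
     first. *)
  case: (@arg_maxnP _ e0 P (@pos m n) P0) => e1 /andP[oe1 ne1] maxe1.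
  have [h|h] : (pos (l e1) < pos (l' e1))%N \/ (pos (l' e1) < pos (l e1))%N.
  - by apply/orP; rewrite -neq_ltn; apply: contra ne1 => /eqP/pos_inj ->.
  - have [z [oz ez nz]] := opener_step ll' oe1 h.
    have := maxe1 z; rewrite /P oz nz => /(_ isT).
    by move: ez; clear; lia.
  - have [z [oz ez nz]] := opener_step (fsym ll') (etrans (esym (ll' _)) oe1) h.
    have := maxe1 z; rewrite /P ll' oz eq_sym nz => /(_ isT).
    by move: ez; clear; lia.
have [/key //|ne] := boolP (opener l e).
have := key (l e); rewrite opener_TL ne TLK => /(_ isT) h.
by rewrite [in RHS]h TLK.
Qed.

Definition opener_bits m n (l : TL m n) : (nat -> bool) * (nat -> bool) :=
  (fun i => if insub i is Some i' then ~~ opener l (inl i') else false,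
   fun j => if insub j is Some j' then opener l (inr j') else false).

Lemma label_opener m n (l : TL m n) :
  label (opener_bits l).1 (opener_bits l).2 = opener l :> (endpoint m n -> bool).
Proof. by apply: funext => -[i|i] /=; rewrite valK ?negbK. Qed.

Lemma arc_wt_neq0 a b : (arc_wt a b != 0) = (a != b).
Proof.
have q0 := q_neq0; case: a; case: b.
- by rewrite [arc_wt _ _]/(0 : K) !eqxx.
- by rewrite [arc_wt _ _]/(1 : K) oner_neq0.
- by rewrite [arc_wt _ _]/(- q^-1) oppr_eq0 invr_eq0 q0.
- by rewrite [arc_wt _ _]/(0 : K) !eqxx.
Qed.

Lemma turn_wt_neq0 a : turn_wt a != 0.
Proof.
by have q0 := q_neq0; case: a; rewrite /turn_wt; [rewrite oppr_eq0|rewrite oner_neq0].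
Qed.

Lemma weight_neq0 m n (l : TL m n) b s : (weight l b s != 0) =
  [forall e, opener l e ==> (label b s e != label b s (l e))].
Proof.
rewrite /weight mulf_eq0 negb_or.
have turn0 : \prod_(j < n) turn_wt (s j) != 0.
  by apply/prodf_neq0 => j _; exact: turn_wt_neq0.
apply/andP/forallP => [[_ /prodf_neq0 h] e|h].
  by apply/implyP => oe; rewrite -arc_wt_neq0; apply: h; rewrite inE.
split; first exact: turn0.
apply/prodf_neq0 => e; rewrite inE => oe; rewrite arc_wt_neq0.
exact: (implyP (h e)).
Qed.

Definition height m n (l : TL m n) : nat :=
  \sum_(e : endpoint m n) opener l e * (m + n - pos e).

(** The weight does not vanish only if each arc of [l'] has exactly one end that is an opener of
    [l]. Among all such choices of ends, the first ends give the largest height, and they are the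
    only choice that does. *)
Lemma height_compat m n (l l' : TL m n) :
  weight l' (opener_bits l).1 (opener_bits l).2 != 0 ->
  (height l <= height l')%N /\ (height l = height l' -> l = l').
Proof.
rewrite weight_neq0 label_opener => /forallP h.
have compat e : opener l e != opener l (l' e).
  have [oe|ne] := boolP (opener l' e); first exact: (implyP (h e)).
  by have := h (l' e); rewrite opener_TL ne TLK eq_sym.
pose w (e : endpoint m n) := (m + n - pos e)%N.
(* Doubling the sum pairs each endpoint with its partner under [l'], which compares the heights arc
   by arc. *)
have dbl (g : endpoint m n -> nat) :
    ((\sum_e g e).*2 = \sum_e (g e + g (l' e)))%N.
  rewrite big_split /= -addnn; congr (_ + _)%N.
  by rewrite [LHS](reindex_inj (can_inj (TLK l'))).
have le e : (opener l e * w e + opener l (l' e) * w (l' e) <=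
    opener l' e * w e + opener l' (l' e) * w (l' e) ?= iff (opener l e == opener l' e))%N.
  have -> : opener l (l' e) = ~~ opener l e.
    by have := compat e; case: (opener l e); case: (opener l (l' e)).
  rewrite opener_TL.
  have p1 : (pos e < m + n)%N by have := pos_flip e; clear; lia.
  have p2 : (pos (l' e) < m + n)%N by have := pos_flip (l' e); clear; lia.
  have ne0 : pos e <> pos (l' e) by move/pos_inj/eqP; rewrite eq_sym (negbTE (TL_neq _ _)).
  rewrite [opener l' e]/opener /w; apply/leqifP.
  move: p1 p2 ne0; move: (pos e) (pos (l' e)) (opener l e) => x y o; clear.
  by move=> p1 p2 ne0; case: o; case: (ltnP x y) => h1; rewrite ?(mul0n, mul1n) ?(addn0, add0n) /=; lia.
have := leqif_sum (fun (e : endpoint m n) (_ : xpredT e) => le e) => /=; rewrite -!dbl => -[h1 h2]; split.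
  by rewrite leq_double in h1.
move=> e; move: h2; rewrite -!/(height _) e eqxx => /esym/forallP h2.
by apply: opener_inj => e1; have /implyP/(_ isT)/eqP := h2 e1.
Qed.

(** A TL tangle is determined by its openers, and its kernel does not vanish there. Every other TL
    tangle of at most the same height has a kernel vanishing there. *)
Lemma kernel_inj m n (x : QTL m n) : (forall b s, kernel x b s = 0) -> x = 0.
Proof.
move=> x0; apply/ffunP => l0; rewrite [RHS]ffunE; apply/eqP/negPn/negP => ne0.
pose P (l : TL m n) := coordQ x l != 0.
case: (@arg_maxnP _ l0 P (@height m n) ne0) => l Pl maxl.
have := x0 (opener_bits l).1 (opener_bits l).2; rewrite /kernel (bigD1 l) //= big1 ?addr0.
  have : weight l (opener_bits l).1 (opener_bits l).2 != 0.
    rewrite weight_neq0 label_opener; apply/forallP => e; apply/implyP => oe.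
    by rewrite opener_TL oe.
  by move=> w0 h; have := mulf_neq0 Pl w0; rewrite h eqxx.
move=> l' ll'; apply/eqP; rewrite mulf_eq0 -[_ || _]negbK negb_or; apply/negP => /andP[Pl' h].
have [h1 h2] := height_compat h.
have h4 : (height l' <= height l)%N by exact: maxl l' Pl'.
have h3 : height l = height l' by apply/eqP; rewrite eqn_leq h1 h4.
by move: ll'; rewrite -(h2 h3) eqxx.
Qed.

Lemma kernelB m n (x y : QTL m n) b s : kernel (x - y) b s = kernel x b s - kernel y b s.
Proof.
rewrite /kernel -sumrB; apply: eq_bigr => l _.
by rewrite /coordQ !ffunE mulrBl.
Qed.

Lemma op_kernel m n (x : QTL m n) c s :
  kernel x c s = op x (fun t => \prod_(i < m) (t i == c i)%:R) s.
Proof.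
rewrite opE.
transitivity (sum_bits (iota 0 m) (fun b => (\prod_(i < m) (b i == c i)%:R) * kernel x b s) (fun=> false)).
  rewrite sum_bits_delta_ord; apply: eq_bigr => l _; congr (_ * _); apply: eq_weight => // j jm.
  by rewrite jm.
apply: eq_sum_bits => b; rewrite mulrC; congr (_ * _); apply: eq_bigr => i _.
by rewrite /splice ltn_ord.
Qed.

(** From here on identities in [QTL], including the associativity of [compQ], are proved on spin
    functions. *)
Lemma op_inj m n (x y : QTL m n) : op x =1 op y -> x = y.
Proof.
move=> h; apply/eqP; rewrite -subr_eq0; apply/eqP/kernel_inj => b s.
by rewrite kernelB !op_kernel h subrr.
Qed.

(** * Cups and caps *)

(** Just inside an arc that is not innermost there is an endpoint whose partner, by planarity, is
    also inside: this gives a shorter arc. *)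
Lemma inner_bottom_arc m n (l : TL m n) i j : l (inl i) = inl j ->
  exists i' j', l (inl i') = inl j' /\ j' = i'.+1 :> nat.
Proof.
have [d] := ubnP (j - i + (i - j))%N; elim: d i j => // d IH i j.
wlog ij : i j / (i < j)%N => [H|].
  case: (ltngtP i j) => [lt|lt|/val_inj ->] le e.
  - exact: (H i j).
  - by apply: (H j i) => //; [rewrite addnC|rewrite -e TLK].
  - by have := TL_neq l (inl j); rewrite e eqxx.
move=> le e; have [e1|ne] := eqVneq (j : nat) i.+1; first by exists i, j.
have i1j : (i.+1 < j)%N by rewrite ltn_neqAle eq_sym ne.
pose k : 'I_m := Ordinal (ltn_trans i1j (ltn_ord j)).
have := @TLP4 _ _ l (inl i) (inl k); rewrite e.
have ki : inl k != inl i :> endpoint m n by apply/eqP => -[] /eqP; rewrite -val_eqE /= gtn_eqF.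
have kj : inl k != inl j :> endpoint m n.
  by apply/eqP => -[] /eqP; rewrite -val_eqE /= ltn_eqF.
move=> /(_ ki kj); rewrite [in X in X = _]/between /= ltnSn i1j /= => /esym.
case lk: (l (inl k)) => [k'|k'] /=; rewrite /between => h; last first.
  by move: h (ltn_ord i) (ltn_ord j); clear; lia.
by apply: (IH k k') lk; have i1j' := i1j; move: h le ij i1j' => /=; clear; lia.
Qed.

Lemma incr_id k (g : 'I_k -> 'I_k) : (forall i j : 'I_k, (i < j)%N -> (g i < g j)%N) ->
  forall i, g i = i.
Proof.
move=> mono i; apply: val_inj.
have ge_id d (i0 : 'I_k) : i0 = d :> nat -> (d <= g i0)%N.
  elim: d i0 => // d IH i0 e.
  have dk : (d < k)%N by rewrite ltnW // -e ltn_ord.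
  apply: leq_ltn_trans (IH (Ordinal dk) erefl) _; apply: mono => /=.
  by rewrite e.
apply/eqP; rewrite eqn_leq ge_id // andbT leqNgt; apply/negP => gt.
have gt_id (d : nat) (j : 'I_k) : j = (i + d)%N :> nat -> (j < g j)%N.
  elim: d j => [|d IH] j e.
    by have -> : j = i by apply: ord_inj; rewrite e addn0.
  have dk : (i + d < k)%N by have := ltn_ord j; rewrite e addnS; exact: ltnW.
  have := IH (Ordinal dk) erefl; have := mono (Ordinal dk) j; rewrite /= e addnS.
  by move=> /(_ (ltnSn _)) h1 h2; exact: leq_ltn_trans h2 h1.
have k0 : (0 < k)%N by apply: leq_ltn_trans (ltn_ord i).
have last : (k.-1 < k)%N by rewrite prednK.
have := gt_id (k.-1 - i)%N (Ordinal last); rewrite /= subnKC; last first.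
  by have := ltn_ord i; clear; lia.
by move=> /(_ erefl); have := ltn_ord (g (Ordinal last)); clear -k0; lia.
Qed.

(** Without bottom arcs all strands go through, and planarity makes the induced map on positions
    increasing. *)
Lemma through_idTL k (l : TL k k) : (forall i j, l (inl i) != inl j) -> l = idTL k.
Proof.
move=> h; pose g i := if l (inl i) is inr j then j else i.
have gE i : l (inl i) = inr (g i).
  by rewrite /g; case e: (l (inl i)) => [j|j] //; have := h i j; rewrite e eqxx.
have gi : forall i, g i = i.
  apply: incr_id => i j ij; have := @TLP4 _ _ l (inl i) (inl j); rewrite !gE.
  have ji : inl j != inl i :> endpoint k k by apply/eqP => -[] /eqP; rewrite -val_eqE /= gtn_eqF.
  move=> /(_ ji isT); rewrite /between /=.
  by have := ltn_ord i; have := ltn_ord j; have := ltn_ord (g i); have := ltn_ord (g j); move: ij; clear; lia.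
apply: val_inj; apply/ffunP => -[i|i] /=; rewrite ffunE /=.
  by rewrite gE gi.
by rewrite -{1}(gi i) -gE TLK.
Qed.

Lemma dualTLE m n (l : TL m n) e : dualTL l e = flip_end (l (flip_end e)).
Proof. by rewrite /= ffunE. Qed.

Lemma bottom_cap k (l : TL k k) : l != idTL k ->
  exists i j, l (inl i) = inl j /\ j = i.+1 :> nat.
Proof.
move=> nl; have [h|h] := boolP [exists i, exists j, l (inl i) == inl j].
  by have /existsP[i /existsP[j /eqP e]] := h; exact: inner_bottom_arc e.
case/negP: nl; apply/eqP/through_idTL => i j; apply: contra h => e.
by apply/existsP; exists i; apply/existsP; exists j.
Qed.

Lemma top_of_dual m n (l : TL m n) i j : dualTL l (inl i) = inl j -> l (inr i) = inr j.
Proof. by rewrite dualTLE /=; case: (l (inr i)) => // k [->]. Qed.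

Lemma top_cup k (l : TL k k) : l != idTL k ->
  exists i j, l (inr i) = inr j /\ j = i.+1 :> nat.
Proof.
move=> nl; have nd : dualTL l != idTL k.
  apply: contra nl => /eqP e; apply/eqP/through_idTL => i j; apply/eqP => h.
  have := dualTLE l (inr i); rewrite e /= h ffunE /= => h'; by [].
have [i [j [/top_of_dual e ji]]] := bottom_cap nd.
by exists i, j.
Qed.

Lemma top_cup0 N (l : TL 0 N) : (0 < N)%N ->
  exists i j, l (inr i) = inr j /\ j = i.+1 :> nat.
Proof.
case: N l => // N l _; case e: (dualTL l (inl ord0)) => [j|[]//].
have [i [j' [/top_of_dual e' h]]] := inner_bottom_arc e.
by exists i, j'.
Qed.

Lemma ins_del_other i b s k : k != i -> k != i.+1 -> ins i b (del i s) k = s k.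
Proof.
rewrite /ins /del => ki ki1; case: (ltnP k i) => [h|h] //.
rewrite (negbTE ki) (negbTE ki1) ltnNge; have -> /= : (i <= k.-2)%N.
  by move: ki ki1 h; clear; lia.
by congr s; move: ki ki1 h; clear; lia.
Qed.

Lemma ins_left i b s : ins i b s i = b.
Proof. by rewrite /ins ltnn eqxx. Qed.

Lemma ins_right i b s : ins i b s i.+1 = ~~ b.
Proof. by rewrite /ins ltnNge leqW // gtn_eqF // eqxx. Qed.

Lemma ins_del i s : s i.+1 = ~~ s i -> ins i (s i) (del i s) = s.
Proof.
move=> h; apply: funext => k; have [->|ki] := eqVneq k i; first exact: ins_left.
by have [->|ki1] := eqVneq k i.+1; [rewrite ins_right|rewrite ins_del_other].
Qed.

Lemma del_ins i b s : del i (ins i b s) = s.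
Proof.
apply: funext => k; rewrite /del /ins; case: (ltnP k i) => h; first by rewrite ?h.
have [h1 [h2 h3]] : (k.+2 < i)%N = false /\ (k.+2 == i) = false /\ (k.+2 == i.+1) = false.
  by move: h; clear; lia.
by rewrite h1 h2 h3.
Qed.

Lemma sum_cup_cap : \sum_(b : bool) cap_wt b * cup_wt b (~~ b) = delta.
Proof.
by rewrite big_bool /cap_wt /cup_wt [~~ true]/= [~~ false]/= mulr1 mul1r /delta opprD addrC.
Qed.

Section TopCup.
Variables (m n : nat) (l : TL m n) (i j : 'I_n).
Hypotheses (lij : l (inr i) = inr j) (ji : j = i.+1 :> nat).

Let rest (b s : nat -> bool) :=
  (\prod_(k < n | (k != i) && (k != j)) turn_wt (s k)) *
  \prod_(e | (e != inr i) && (e != inr j)) end_wt (@pos m n) l (label b s) e.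

Let weight_rest b s : weight l b s = cup_wt (s i) (s i.+1) * rest b s.
Proof.
have nij : j != i by rewrite -val_eqE /= ji gtn_eqF.
rewrite /weight state_wtE (bigD1 i) //= (bigD1 j) //=; under [X in _ * X]eq_bigl do rewrite inE.
have nij' : inr j != inr i :> endpoint m n by apply: contra_neq nij => -[].
rewrite (bigD1 (inr i)) //= [X in _ * (_ * X)](bigD1 (inr j)) //=.
have lji : l (inr j) = inr i by rewrite -lij TLK.
have e1 : end_wt (@pos m n) l (label b s) (inr i) = 1.
  by rewrite /end_wt lij /= ji ifF //; clear; lia.
have e2 : end_wt (@pos m n) l (label b s) (inr j) = arc_wt (s i.+1) (s i).
  by rewrite /end_wt lji /= -ji ifT //; rewrite ji; have := ltn_ord j; rewrite ji; clear; lia.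
rewrite e1 e2 /rest; rewrite -ji.
have shuffle (x1 x2 x3 x4 x5 : K) : x1 * (x2 * x3) * (1 * (x4 * x5)) = (x1 * x2 * x4) * (x3 * x5) by ring.
rewrite shuffle; congr (_ * _); have q0 := q_neq0; rewrite ji.
case: (s i); case: (s i.+1); rewrite /turn_wt /arc_wt /cup_wt ?mulr0 ?mulr1 ?mul1r //.
by rewrite mulrNN mulfV.
Qed.

Lemma weight_top b s : weight l b s = cup_wt (s i) (s i.+1) * weight l b (ins i true (del i s)).
Proof.
rewrite !weight_rest ins_left ins_right [cup_wt true _]/(1 : K) mul1r; congr (_ * _).
have other k : (k != i) && (k != j) -> s k = ins i true (del i s) k.
  by rewrite -!val_eqE /= ji => /andP[k1 k2]; rewrite ins_del_other.
congr (_ * _); first by apply: eq_bigr => k /other ->.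
have lab e : (e != inr i) && (e != inr j) -> label b s e = label b (ins i true (del i s)) e.
  case: e => [//|k] h /=; apply: other; move: h => /andP[h1 h2].
  by apply/andP; split; [move: h1|move: h2]; apply: contra_neq => ->.
apply: eq_bigr => e h; rewrite /end_wt !lab //; apply/andP; split.
  by apply: contraTneq h => le; rewrite -(TLK l e) le lij eqxx andbF.
by apply: contraTneq h => le; rewrite -(TLK l e) le -lij TLK eqxx.
Qed.

(** By [weight_top] the spins at the cup enter only through [cup_wt], so the vector lies in the
    image of [Cup i], on which [Cap i] followed by [Cup i] is [delta]. *)
Lemma op_of_TL_top v : Cup i (Cap i (op_of_TL l v)) = delta *: op_of_TL l v.
Proof.
have E s : op_of_TL l v s = cup_wt (s i) (s i.+1) * op_of_TL l v (ins i true (del i s)).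
  rewrite /op_of_TL -sum_bitsZ; apply: eq_sum_bits => b; rewrite mulrA -weight_top; congr (_ * v _).
  apply: funext => k; rewrite /splice; case: ltnP => // mk; rewrite ins_del_other //;
    have := ltn_ord j; rewrite ji; move: mk; clear; lia.
apply: funext => s; rewrite /Cup /Cap.
have -> : \sum_(b : bool) cap_wt b * op_of_TL l v (ins i b (del i s)) =
    delta * op_of_TL l v (ins i true (del i s)).
  rewrite -sum_cup_cap big_distrl; apply: eq_bigr => b _ /=.
  by rewrite E ins_left ins_right del_ins mulrA.
by rewrite mulrCA -E.
Qed.

End TopCup.

Section BottomCap.
Variables (m n : nat) (l : TL m n) (i j : 'I_m).
Hypotheses (lij : l (inl i) = inl j) (ji : j = i.+1 :> nat).

Let rest (b s : nat -> bool) :=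
  (\prod_(k < n) turn_wt (s k)) *
  \prod_(e | (e != inl i) && (e != inl j)) end_wt (@pos m n) l (label b s) e.

Let weight_rest b s : weight l b s = arc_wt (~~ b i) (~~ b i.+1) * rest b s.
Proof.
have nij : j != i by rewrite -val_eqE /= ji gtn_eqF.
rewrite /weight state_wtE; under [X in _ * X]eq_bigl do rewrite inE.
have nij' : inl j != inl i :> endpoint m n by apply: contra_neq nij => -[].
rewrite (bigD1 (inl i)) //= [X in _ * (_ * X)](bigD1 (inl j)) //=.
have lji : l (inl j) = inl i by rewrite -lij TLK.
have e1 : end_wt (@pos m n) l (label b s) (inl j) = 1.
  by rewrite /end_wt lji /= ji ifF //; clear; lia.
have e2 : end_wt (@pos m n) l (label b s) (inl i) = arc_wt (~~ b i) (~~ b i.+1).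
  by rewrite /end_wt lij /= ji ltnSn.
by rewrite e1 e2 /rest mul1r mulrCA.
Qed.

Lemma weight_bottom b s : weight l b s =
  arc_wt (~~ b i) (~~ b i.+1) * weight l (ins i false (del i b)) s.
Proof.
rewrite !weight_rest ins_left ins_right [arc_wt (~~ false) _]/(1 : K) mul1r; congr (_ * (_ * _)).
have other k : (k != i) && (k != j) -> b k = ins i false (del i b) k.
  by rewrite -!val_eqE /= ji => /andP[k1 k2]; rewrite ins_del_other.
have lab e : (e != inl i) && (e != inl j) -> label b s e = label (ins i false (del i b)) s e.
  case: e => [k|//] h /=; congr (~~ _); apply: other; move: h => /andP[h1 h2].
  by apply/andP; split; [move: h1|move: h2]; apply: contra_neq => ->.
apply: eq_bigr => e h; rewrite /end_wt !lab //; apply/andP; split.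
  by apply: contraTneq h => le; rewrite -(TLK l e) le lij eqxx andbF.
by apply: contraTneq h => le; rewrite -(TLK l e) le -lij TLK eqxx.
Qed.

Lemma op_of_TL_bottom v : Cap i v = 0 -> op_of_TL l v = 0.
Proof.
move=> v0; apply: funext => s; rewrite /op_of_TL.
(* The spins at [i] and [j] are summed first: their sum alone is a multiple of a value of
   [Cap i v]. *)
pose L := rem (j : nat) (rem (i : nat) (iota 0 m)).
have nij : j != i :> nat by rewrite ji gtn_eqF.
have pL : perm_eq (iota 0 m) [:: i : nat, j : nat & L].
  have hi : (i : nat) \in iota 0 m by rewrite mem_iota /= add0n.
  apply: perm_trans (perm_to_rem hi) _; rewrite perm_cons; apply: perm_to_rem.
  by rewrite mem_rem_uniq ?iota_uniq // inE nij mem_iota /= add0n.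
rewrite (perm_sum_bits _ pL) -[[:: _, _ & L]]/([:: i : nat; j : nat] ++ L) sum_bits_cat.
rewrite [sum_bits [:: _; _] _](_ : _ = fun=> 0).
  have -> : (fun=> 0) = (fun t : nat -> bool => 0 * (0 : K)) by apply: funext => t; rewrite mul0r.
  by rewrite sum_bitsZ mul0r.
apply: funext => b; rewrite [LHS]/sum_bits /= exchange_big /= ji.
pose W := weight l (ins i false (del i b)) s.
have E c d : weight l (upd (upd b i.+1 d) i c) s * v (splice m n (upd (upd b i.+1 d) i c) s) =
   arc_wt (~~ c) (~~ d) * W * v (splice m n (upd (upd b i.+1 d) i c) s).
  rewrite weight_bottom /W; congr (_ * _ * _); first by rewrite /upd eqxx gtn_eqF // eqxx.
  congr (weight _ _ _); apply: funext => k; have [->|ki] := eqVneq k i; first by rewrite !ins_left.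
  have [->|ki1] := eqVneq k i.+1; first by rewrite !ins_right.
  by rewrite !ins_del_other // /upd (negbTE ki) (negbTE ki1).
have := congr1 (fun f : Vec => f (del i (splice m n b s))) v0.
rewrite /Cap [X in _ = X](_ : _ = 0) // => h.
transitivity (W * \sum_(c : bool) cap_wt c * v (ins i c (del i (splice m n b s)))); last by rewrite h mulr0.
rewrite big_distrr; apply: eq_bigr => c _ /=; rewrite big_bool /=.
have ins_splice d : splice m n (upd (upd b i.+1 (~~ d)) i d) s = ins i d (del i (splice m n b s)).
  apply: funext => k; have [->|ki] := eqVneq k i.
    by rewrite ins_left /splice ltn_ord /upd eqxx.
  have [->|ki1] := eqVneq k i.+1.
    by rewrite ins_right /splice -ji ltn_ord /upd (negbTE nij) eqxx.
  by rewrite ins_del_other // /splice /upd (negbTE ki) (negbTE ki1).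
rewrite !E; case: c; [have /= <- := ins_splice true|have /= <- := ins_splice false].
  by rewrite /arc_wt /cap_wt !mul0r add0r [RHS]mulrCA mulrA.
by rewrite /arc_wt /cap_wt !mul0r addr0 [RHS]mulrCA mulrA.
Qed.

End BottomCap.

(** * Vertical strands added on the right *)

Section Widen.
Variables (k n : nat) (le_kn : (k <= n)%N) (l : TL k k).

Definition narrow_end (e : endpoint n n) : option (endpoint k k) :=
  match e with
  | inl i => omap inl (insub (i : nat) : option 'I_k)
  | inr i => omap inr (insub (i : nat) : option 'I_k)
  end.

Definition widen_fun (e : endpoint n n) : endpoint n n :=
  if narrow_end e is Some e' then widen_end le_kn (l e') else flip_end e.

Let widen_endK e : narrow_end (widen_end le_kn e) = Some e.
Proof. by case: e => i /=; rewrite valK. Qed.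

Let narrowP e : if narrow_end e is Some e' then e = widen_end le_kn e'
  else (k <= pos e < n + n - k)%N.
Proof.
case: e => i /=; case: insubP => [i' _ h|] /=.
- by congr inl; apply: ord_inj.
- by rewrite -leqNgt => ki; have := ltn_ord i; move: ki le_kn; clear; lia.
- by congr inr; apply: ord_inj.
- by rewrite -leqNgt => ki; have := ltn_ord i; move: ki le_kn; clear; lia.
Qed.

Let narrow_flip e : narrow_end e = None -> narrow_end (flip_end e) = None.
Proof. by case: e => i /=; case: insubP. Qed.

Let pos_widen_lt e e' : (pos (widen_end le_kn e) < pos (widen_end le_kn e'))%N = (pos e < pos e')%N.
Proof.
by case: e e' => [i|i] [j|j] //=; have := ltn_ord i; have := ltn_ord j; move: le_kn; clear; lia.
Qed.

Let pos_widen_out e : (pos (widen_end le_kn e) < k)%N || (n + n - k <= pos (widen_end le_kn e))%N.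
Proof. by case: e => i /=; have := ltn_ord i; move: le_kn; clear; lia. Qed.

Fact widenTL_subproof : is_TL [ffun e => widen_fun e].
Proof.
have ff e : widen_fun (widen_fun e) = e.
  rewrite {2}/widen_fun; have := narrowP e; case ne: (narrow_end e) => [e'|] h.
    by rewrite /widen_fun widen_endK TLK h.
  by rewrite /widen_fun narrow_flip // flipK.
apply: is_TLP => [e|e|e e']; rewrite !ffunE //.
  rewrite /widen_fun; have := narrowP e; case ne: (narrow_end e) => [e'|] h.
    by move=> h'; have := widen_endK (l e'); rewrite h' ne => -[] /eqP; rewrite eq_sym (negbTE (TL_neq _ _)).
  by case: e {ne h}.
rewrite /widen_fun; have := narrowP e; have := narrowP e'.
case: (narrow_end e) => [d|]; case: (narrow_end e') => [d'|] h' h.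
- rewrite h h' !pos_widen_lt => h1 h2 h3; apply: (nc_of_between _ h1 h2 h3).
  by apply: TLP4; [apply: contraTneq h1|apply: contraTneq h2] => ->; rewrite ltnn.
- rewrite h; have := pos_widen_out d; have := pos_widen_out (l d); have := pos_flip e'.
  by move: h'; clear; lia.
- rewrite h'; have := pos_widen_out d'; have := pos_widen_out (l d'); have := pos_flip e.
  by move: h; clear; lia.
- by have := pos_flip e; have := pos_flip e'; clear; lia.
Qed.

Definition widenTL : TL n n := MkTL widenTL_subproof.

Lemma is_widenE l' : is_widen le_kn l l' = (l' == widenTL).
Proof.
apply/andP/eqP => [[/forallP h1 /forallP h2]|->].
  have e1 (i : 'I_n) : (k <= i)%N -> l' (inl i) = inr i by move=> ki; apply/eqP/(implyP (h2 i)).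
  apply: val_inj; apply/ffunP => e /=; rewrite ffunE /widen_fun.
  have := narrowP e; case: (narrow_end e) => [e'|] h; first by rewrite h; apply/eqP.
  case: e h => i /= h; first by rewrite e1 //; case/andP: h.
  by rewrite -e1 ?TLK //; have := ltn_ord i; move: h le_kn; clear; lia.
split; apply/forallP => e; first by rewrite /= ffunE /widen_fun widen_endK.
by apply/implyP => ke; rewrite /= ffunE /widen_fun /= insubF // ltnNge ke.
Qed.

Lemma weight_widen b s : weight widenTL b s =
  weight l b s * \prod_(j <- iota k (n - k)) (b j == s j)%:R.
Proof.
have prodT (T : finType) (F : T -> K) : \prod_(e in [set: T]) F e = \prod_e F e.
  by apply: eq_bigl => e; rewrite inE.
rewrite /weight !state_wtE !prodT.
rewrite !big_sumType /=; set E := end_wt _ _ _; set E' := end_wt _ _ _.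
have Ew e : E (widen_end le_kn e) = E' e.
  rewrite /E /E' /end_wt; have -> : widenTL (widen_end le_kn e) = widen_end le_kn (l e).
    by rewrite /= ffunE /widen_fun widen_endK.
  rewrite pos_widen_lt; have lab e0 : label b s (widen_end le_kn e0) = label b s e0 by case: e0.
  by rewrite !lab.
have El (i : 'I_n) : (k <= i)%N -> E (inl i) = arc_wt (~~ b i) (s i) /\ E (inr i) = 1.
  move=> ki; have n1 : widenTL (inl i) = inr i by rewrite /= ffunE /widen_fun /= insubF // ltnNge ki.
  have n2 : widenTL (inr i) = inl i by rewrite -n1 TLK.
  rewrite /E /end_wt n1 n2 /= ltn_addr // ifF //.
  by have := ltn_ord i; clear; lia.
have split_prod (F : 'I_n -> K) (F' : 'I_k -> K) : (forall i, F (widen_ord le_kn i) = F' i) ->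
   \prod_(i < n) F i = \prod_(i < k) F' i * \prod_(i < n | (k <= i)%N) F i.
  move=> FF'; rewrite (bigID (fun i : 'I_n => (i < k)%N)) /=; congr (_ * _).
    by rewrite (big_ord_narrow le_kn); apply: eq_bigr => i _.
  by apply: eq_bigl => i; rewrite -leqNgt.
rewrite (split_prod _ (fun i : 'I_k => turn_wt (s i))) //.
rewrite (split_prod _ (fun i : 'I_k => E' (inl i))); last by move=> i; exact: (Ew (inl i)).
rewrite (split_prod _ (fun i : 'I_k => E' (inr i))); last by move=> i; exact: (Ew (inr i)).
have shuffle (x1 x2 x3 x4 x5 x6 : K) : x1 * x2 * (x3 * x4 * (x5 * x6)) = x1 * (x3 * x5) * (x2 * x4 * x6) by ring.
rewrite shuffle; congr (_ * _); rewrite -!big_split /=.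
have -> : iota k (n - k) = [seq j <- iota 0 n | (k <= j)%N].
  rewrite -{2}(subnKC le_kn) iotaD filter_cat add0n.
  rewrite (@eq_in_filter _ _ pred0 (iota 0 k)) ?filter_pred0; last first.
    by move=> j; rewrite mem_iota /= add0n ltnNge => /negbTE.
  rewrite (@eq_in_filter _ _ predT (iota k _)) ?filter_predT // => j.
  by rewrite mem_iota => /andP[->].
rewrite big_filter -val_enum_ord big_map big_enum_cond /=; apply: eq_bigr => i ki.
by have [-> ->] := El i ki; rewrite mulr1 turn_arc.
Qed.

Lemma op_widenTL v : op_of_TL widenTL v = op_of_TL l v.
Proof.
apply: funext => s; rewrite /op_of_TL -{1}(subnKC le_kn) iotaD add0n sum_bits_cat sum_bitsC.
rewrite (_ : sum_bits (iota k (n - k)) _ = fun b => weight l b s * v (splice k k b s)) //.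
apply: funext => b.
transitivity (sum_bits (iota k (n - k)) (fun b => (\prod_(j <- iota k (n - k)) (b j == s j)%:R) *
   (weight l b s * v (splice n n b s))) b).
  by apply: (@eq_sum_bits _ (iota k (n - k))) => t; rewrite weight_widen mulrA [X in X * _]mulrC.
rewrite sum_bits_delta ?iota_uniq //; congr (_ * v _).
  by apply: eq_weight => // j jk; rewrite mem_iota leqNgt jk.
apply: funext => j; rewrite /splice mem_iota (subnKC le_kn); case: (ltnP j n) => jn.
  by rewrite ltnNge; case: leqP => //= kj; rewrite ?subnK.
by rewrite ltnNge (leq_trans le_kn jn) /= !subnK ?(leq_trans le_kn jn).
Qed.

End Widen.

Lemma op_widen k n (le_kn : (k <= n)%N) (x : QTL k k) v : op (widenQ le_kn x) v = op x v.
Proof.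
apply: funext => s; rewrite /op; under eq_bigr => l' _.
  rewrite /coordQ /widenQ ffunE big_distrl /= big_mkcond; over.
rewrite exchange_big; apply: eq_bigr => l _ /=.
rewrite (bigD1 (widenTL le_kn l)) //= is_widenE eqxx big1 ?addr0 ?op_widenTL // => l' ll'.
by rewrite is_widenE (negbTE ll').
Qed.

Fact Cup_linear i : linear (Cup i).
Proof.
move=> a u v; apply: funext => s.
change (cup_wt (s i) (s i.+1) * (a * u (del i s) + v (del i s)) =
  a * (cup_wt (s i) (s i.+1) * u (del i s)) + cup_wt (s i) (s i.+1) * v (del i s)).
by rewrite mulrDr mulrCA.
Qed.

HB.instance Definition _ i := GRing.isLinear.Build K Vec Vec _ (Cup i) (Cup_linear i).

Fact Cap_linear i : linear (Cap i).
Proof.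
move=> a u v; apply: funext => s.
rewrite /Cap; change (\sum_(b : bool) cap_wt b * (a * u (ins i b s) + v (ins i b s)) =
  a * (\sum_(b : bool) cap_wt b * u (ins i b s)) + \sum_(b : bool) cap_wt b * v (ins i b s)).
rewrite big_distrr -big_split; apply: eq_bigr => b _ /=.
by rewrite mulrDr mulrCA.
Qed.

HB.instance Definition _ i := GRing.isLinear.Build K Vec Vec _ (Cap i) (Cap_linear i).

Ltac case_index :=
  match goal with
  | |- context [(S ?a <= ?b)%N] =>
    lazymatch a with
    | context [if _ then _ else _] => fail
    | _ => case: (ltnP a b) => ? /=
    end
  | |- context [@eq_op _ ?a ?b] =>
    lazymatch a with
    | context [if _ then _ else _] => fail
    | _ => case: (eqVneq a b) => ? /=
    end
  end.

Ltac bits k s := apply: funext => k; rewrite /ins /del; repeat case_index;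
  first [reflexivity | congr s; lia | congr (~~ _); lia | lia].

Lemma del_del i j s : (i <= j)%N -> del j (del i s) = del i (del j.+2 s).
Proof. by move=> ij; bits k s. Qed.

Lemma ins_ins i j b c s : (i <= j)%N -> ins j.+2 c (ins i b s) = ins i b (ins j c s).
Proof. by move=> ij; bits k s. Qed.

Lemma del_ins_lt i j b s : (i <= j)%N -> del i (ins j.+2 b s) = ins j b (del i s).
Proof. by move=> ij; bits k s. Qed.

Lemma del_ins_gt i j b s : (i <= j)%N -> del j.+2 (ins i b s) = ins i b (del j s).
Proof. by move=> ij; bits k s. Qed.

Lemma Cap_Cup i v : Cap i (Cup i v) = delta *: v.
Proof.
apply: funext => s; rewrite /Cap /Cup.
under eq_bigr do rewrite ins_left ins_right del_ins mulrA.
by rewrite -big_distrl sum_cup_cap.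
Qed.

Lemma ins_lt i b s k : (k < i)%N -> ins i b s k = s k.
Proof. by rewrite /ins => ->. Qed.

Lemma ins_ge i b s k : (i <= k)%N -> ins i b s k.+2 = s k.
Proof.
move=> ik; rewrite /ins; have [h1 [h2 h3]] : (k.+2 < i)%N = false /\ (k.+2 == i) = false /\ (k.+2 == i.+1) = false.
  by move: ik; clear; lia.
by rewrite h1 h2 h3.
Qed.

Lemma del_lt i s k : (k < i)%N -> del i s k = s k.
Proof. by rewrite /del => ->. Qed.

Lemma del_ge i s k : (i <= k)%N -> del i s k = s k.+2.
Proof. by rewrite /del leqNgt => /negbTE ->. Qed.

Lemma CupCup i j v : (i <= j)%N -> Cup i (Cup j v) = Cup j.+2 (Cup i v).
Proof.
move=> ij; apply: funext => s; rewrite /Cup (del_del _ ij) mulrCA.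
by rewrite !(del_ge _ ij) (del_ge _ (leqW ij)) !(del_lt s) ?ltnS // ltnW // ltnS.
Qed.

Lemma CapCap i j v : (i <= j)%N -> Cap i (Cap j.+2 v) = Cap j (Cap i v).
Proof.
move=> ij; apply: funext => s; rewrite /Cap.
under eq_bigr do rewrite big_distrr.
under [RHS]eq_bigr do rewrite big_distrr.
rewrite exchange_big; apply: eq_bigr => b _; apply: eq_bigr => c _ /=.
by rewrite (ins_ins _ _ _ ij) mulrCA.
Qed.

Lemma CapCup_gt i j v : (i <= j)%N -> Cap j.+2 (Cup i v) = Cup i (Cap j v).
Proof.
move=> ij; apply: funext => s; rewrite /Cap /Cup big_distrr; apply: eq_bigr => b _ /=.
by rewrite (del_ins_lt _ _ ij) !ins_lt ?ltnS // ?leqW // mulrCA.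
Qed.

Lemma CapCup_lt i j v : (i <= j)%N -> Cap i (Cup j.+2 v) = Cup j (Cap i v).
Proof.
move=> ij; apply: funext => s; rewrite /Cap /Cup big_distrr; apply: eq_bigr => b _ /=.
by rewrite (del_ins_gt _ _ ij) !ins_ge ?leqW // mulrCA.
Qed.

Lemma cap_cup_wt b c : cap_wt b * cup_wt c b = (~~ c == b)%:R.
Proof.
have q0 := q_neq0; case: b; case: c; rewrite /cap_wt /cup_wt ?mulr0 ?mulr1 //.
by rewrite mulrNN mulVf.
Qed.

Lemma cap_cup_wt' b c : cap_wt b * cup_wt (~~ b) c = (c == b)%:R.
Proof.
have q0 := q_neq0; case: b; case: c; rewrite /cap_wt /cup_wt ?mulr0 ?mulr1 //.
by rewrite mulrNN mulVf.
Qed.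

Lemma sum_bool_delta c (g : bool -> K) : \sum_(b : bool) (c == b)%:R * g b = g c.
Proof.
rewrite (bigD1 c) //= eqxx mul1r big1 ?addr0 // => b; rewrite eq_sym => /negbTE ->.
by rewrite mul0r.
Qed.

Lemma CapS_Cup i v : Cap i.+1 (Cup i v) = v.
Proof.
apply: funext => s; rewrite /Cap /Cup; under eq_bigr => b _.
  rewrite ins_left (ins_lt _ _ (ltnSn i)) mulrA cap_cup_wt; over.
have E b : s i = ~~ b -> del i (ins i.+1 b s) = s.
  move=> h; apply: funext => k; rewrite /del; case: ltnP => ki; first by rewrite ins_lt // ltnW.
  have [->|ne] := eqVneq k i; first by rewrite ins_right h.
  by rewrite ins_ge // ltn_neqAle eq_sym ne.
by rewrite sum_bool_delta E ?negbK.
Qed.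

Lemma Cap_CupS i v : Cap i (Cup i.+1 v) = v.
Proof.
apply: funext => s; rewrite /Cap /Cup; under eq_bigr => b _.
  rewrite ins_right (ins_ge _ _ (leqnn i)) mulrA cap_cup_wt'; over.
have E b : s i = b -> del i.+1 (ins i b s) = s.
  move=> h; apply: funext => k; rewrite /del; case: ltnP => ki.
    move: ki; rewrite ltnS leq_eqVlt => /orP[/eqP ->|ki]; first by rewrite ins_left h.
    by rewrite ins_lt.
  by rewrite ins_ge // ltnW.
by rewrite sum_bool_delta E.
Qed.

(** The algebra behind every slide of a cup or cap through two crossings: three of the four
    smoothings are multiples of [x] and cancel by the choice of [d]. *)
Lemma kauffman_scale (F : fieldType) (V : lmodType F) (a d : F) (x y : V) :
  a != 0 -> a * a + d + a^-1 * a^-1 = 0 ->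
  a *: (a *: x + a^-1 *: (d *: x)) + a^-1 *: (a *: y + a^-1 *: x) = y.
Proof.
move=> a0 e; rewrite !scalerDr !scalerA mulVf // mulfV // scale1r mul1r [y + _]addrC addrA.
by rewrite -!scalerDl e scale0r add0r.
Qed.

(** * The idempotents and the encircled strands *)

(** Cups and caps are abstract here: slides, idempotents and rings need only the planar relations
    listed as hypotheses and the value [d] of a circle. *)
Section TLModule.
Variables (F : fieldType) (A : F) (V : lmodType F) (cup cap : nat -> {linear V -> V}).

Let d : F := - (A * A + (A * A)^-1).

Hypothesis A_neq0 : A != 0.
Hypothesis cap_cup : forall i v, cap i (cup i v) = d *: v.
Hypothesis capS_cup : forall i v, cap i.+1 (cup i v) = v.
Hypothesis cap_cupS : forall i v, cap i (cup i.+1 v) = v.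
Hypothesis cupcup : forall i j v, (i <= j)%N -> cup i (cup j v) = cup j.+2 (cup i v).
Hypothesis capcap : forall i j v, (i <= j)%N -> cap i (cap j.+2 v) = cap j (cap i v).
Hypothesis capcup_gt : forall i j v, (i <= j)%N -> cap j.+2 (cup i v) = cup i (cap j v).
Hypothesis capcup_lt : forall i j v, (i <= j)%N -> cap i (cup j.+2 v) = cup j (cap i v).

Let kauffman_coef : A * A + d + A^-1 * A^-1 = 0.
Proof. by rewrite -invfM /d opprD addrA subrr add0r addNr. Qed.

Definition turnback i (v : V) : V := cup i (cap i v).

Definition sigma i (v : V) : V := A *: v + A^-1 *: turnback i v.

Lemma cupD i u v : cup i (u + v) = cup i u + cup i v.
Proof. exact: linearD. Qed.

Lemma cupZ i x v : cup i (x *: v) = x *: cup i v.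
Proof. exact: linearZ. Qed.

Lemma capD i u v : cap i (u + v) = cap i u + cap i v.
Proof. exact: linearD. Qed.

Lemma capZ i x v : cap i (x *: v) = x *: cap i v.
Proof. exact: linearZ. Qed.

Lemma turnbackD i u v : turnback i (u + v) = turnback i u + turnback i v.
Proof. by rewrite /turnback capD cupD. Qed.

Lemma turnbackZ i x v : turnback i (x *: v) = x *: turnback i v.
Proof. by rewrite /turnback capZ cupZ. Qed.

Lemma sigmaD i u v : sigma i (u + v) = sigma i u + sigma i v.
Proof. by rewrite /sigma turnbackD !scalerDr addrACA. Qed.

Lemma sigmaZ i x v : sigma i (x *: v) = x *: sigma i v.
Proof. by rewrite /sigma turnbackZ scalerDr !scalerA mulrC [A^-1 * _]mulrC. Qed.

Lemma turnback_Cup_gt i j v : (i <= j)%N -> turnback i (cup j.+2 v) = cup j.+2 (turnback i v).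
Proof. by move=> ij; rewrite /turnback capcup_lt // cupcup. Qed.

Lemma turnback_Cup_lt i j v : (i <= j)%N -> turnback j.+2 (cup i v) = cup i (turnback j v).
Proof. by move=> ij; rewrite /turnback capcup_gt // -cupcup. Qed.

Lemma Cap_turnback_gt i j v : (i <= j)%N -> cap j.+2 (turnback i v) = turnback i (cap j.+2 v).
Proof. by move=> ij; rewrite /turnback capcup_gt // capcap. Qed.

Lemma Cap_turnback_lt i j v : (i <= j)%N -> cap i (turnback j.+2 v) = turnback j (cap i v).
Proof. by move=> ij; rewrite /turnback capcup_lt // capcap. Qed.

Lemma sigma_Cup_gt i j v : (i.+1 < j)%N -> sigma i (cup j v) = cup j (sigma i v).
Proof. by case: j => [|[|j]] // ij; rewrite /sigma turnback_Cup_gt // cupD !cupZ. Qed.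

Lemma sigma_Cup_lt i j v : (i <= j)%N -> sigma j.+2 (cup i v) = cup i (sigma j v).
Proof. by move=> ij; rewrite /sigma turnback_Cup_lt // cupD !cupZ. Qed.

Lemma Cap_sigma_gt i j v : (i.+1 < j)%N -> cap j (sigma i v) = sigma i (cap j v).
Proof. by case: j => [|[|j]] // ij; rewrite /sigma -Cap_turnback_gt // capD !capZ. Qed.

Lemma Cap_sigma_lt i j v : (i <= j)%N -> cap i (sigma j.+2 v) = sigma j (cap i v).
Proof. by move=> ij; rewrite /sigma -Cap_turnback_lt // capD !capZ. Qed.

Lemma turnback_sigma i j v : (i.+1 < j)%N -> turnback j (sigma i v) = sigma i (turnback j v).
Proof. by move=> ij; rewrite /turnback Cap_sigma_gt // sigma_Cup_gt. Qed.

Lemma turnback_sigma_gt i j v : (i.+1 < j)%N -> turnback i (sigma j v) = sigma j (turnback i v).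
Proof.
by case: j => [|[|j]] // ij; rewrite /turnback Cap_sigma_lt // sigma_Cup_lt.
Qed.

Lemma sigmaC i j v : (i.+1 < j)%N -> sigma j (sigma i v) = sigma i (sigma j v).
Proof.
by move=> ij; rewrite {1}/sigma turnback_sigma // -!sigmaZ -sigmaD.
Qed.

Lemma sigma_sigma_CupS i v : sigma i.+1 (sigma i (cup i.+1 v)) = cup i v.
Proof.
have -> : sigma i (cup i.+1 v) = A *: cup i.+1 v + A^-1 *: cup i v.
  by rewrite /sigma /turnback cap_cupS.
rewrite sigmaD !sigmaZ /sigma /turnback cap_cup cupZ capS_cup.
exact: kauffman_scale A_neq0 kauffman_coef.
Qed.

Lemma sigma_sigma_Cup i v : sigma i (sigma i.+1 (cup i v)) = cup i.+1 v.
Proof.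
have -> : sigma i.+1 (cup i v) = A *: cup i v + A^-1 *: cup i.+1 v.
  by rewrite /sigma /turnback capS_cup.
rewrite sigmaD !sigmaZ /sigma /turnback cap_cup cupZ cap_cupS.
exact: kauffman_scale A_neq0 kauffman_coef.
Qed.

Lemma CapS_sigma_sigma i v : cap i.+1 (sigma i (sigma i.+1 v)) = cap i v.
Proof.
have E w : cap i.+1 (sigma i w) = A *: cap i.+1 w + A^-1 *: cap i w.
  by rewrite /sigma /turnback capD !capZ capS_cup.
rewrite E /sigma /turnback !capD !capZ cap_cup cap_cupS.
exact: kauffman_scale A_neq0 kauffman_coef.
Qed.

Lemma turnback_braid i v : turnback i.+1 (sigma i (sigma i.+1 v)) = sigma i (sigma i.+1 (turnback i v)).
Proof. by rewrite /turnback CapS_sigma_sigma sigma_sigma_Cup. Qed.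

(** In [rise] the strand at [a] moves rightwards over [N] strands, and in [fall] a strand comes back
    under them. All crossings have the same sign, so the two together clasp the strands instead of
    cancelling. *)
Fixpoint rise a N (v : V) : V := if N is N'.+1 then sigma (a + N') (rise a N' v) else v.

Fixpoint fall a N (v : V) : V := if N is N'.+1 then fall a N' (sigma (a + N') v) else v.

(** The first halves of the clasp and of its reverse, [c] cable strands starting at position [a]. *)
Fixpoint clasp_over a c N (v : V) : V :=
  if c is c'.+1 then clasp_over a c' N (rise (a + c') N v) else v.

Fixpoint clasp_under a c N (v : V) : V :=
  if c is c'.+1 then fall (a + c') N (clasp_under a c' N v) else v.

Fixpoint ncups k (v : V) : V := if k is k'.+1 then cup k' (ncups k' v) else v.

Fixpoint ncaps k (v : V) : V := if k is k'.+1 then ncaps k' (cap k' v) else v.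

Lemma riseS a N v : rise a N.+1 v = sigma (a + N) (rise a N v).
Proof. by []. Qed.

Lemma fallS a N v : fall a N.+1 v = fall a N (sigma (a + N) v).
Proof. by []. Qed.

Lemma clasp_overS a c N v : clasp_over a c.+1 N v = clasp_over a c N (rise (a + c) N v).
Proof. by []. Qed.

Lemma clasp_underS a c N v : clasp_under a c.+1 N v = fall (a + c) N (clasp_under a c N v).
Proof. by []. Qed.

Lemma ncapsS k v : ncaps k.+1 v = ncaps k (cap k v).
Proof. by []. Qed.

Lemma ncupsS k v : ncups k.+1 v = cup k (ncups k v).
Proof. by []. Qed.

Lemma riseZ a N c v : rise a N (c *: v) = c *: rise a N v.
Proof. by elim: N => [//|N IH]; rewrite !riseS IH sigmaZ. Qed.

Lemma riseD a N u v : rise a N (u + v) = rise a N u + rise a N v.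
Proof. by elim: N => [//|N IH]; rewrite !riseS IH sigmaD. Qed.

Lemma fallZ a N c v : fall a N (c *: v) = c *: fall a N v.
Proof. by elim: N v => [//|N IH] v; rewrite !fallS sigmaZ IH. Qed.

Lemma fallD a N u v : fall a N (u + v) = fall a N u + fall a N v.
Proof. by elim: N u v => [//|N IH] u v; rewrite !fallS sigmaD IH. Qed.

Lemma clasp_underZ a c N x v : clasp_under a c N (x *: v) = x *: clasp_under a c N v.
Proof. by elim: c v => [//|c IH] v; rewrite !clasp_underS IH fallZ. Qed.

Lemma ncapsZ k x v : ncaps k (x *: v) = x *: ncaps k v.
Proof. by elim: k v => [//|k IH] v; rewrite !ncapsS capZ IH. Qed.

Lemma rise_Cup_far a N p v : (a + N < p)%N -> rise a N (cup p v) = cup p (rise a N v).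
Proof.
by elim: N => [//|N IH] h; rewrite !riseS IH ?sigma_Cup_gt //; move: h; clear; lia.
Qed.

Lemma fall_Cup_far a N p v : (a + N < p)%N -> fall a N (cup p v) = cup p (fall a N v).
Proof.
by elim: N v => [//|N IH] v h; rewrite !fallS sigma_Cup_gt ?IH //; move: h; clear; lia.
Qed.

Lemma Cap_rise_far a N p v : (a + N < p)%N -> cap p (rise a N v) = rise a N (cap p v).
Proof.
by elim: N => [//|N IH] h; rewrite !riseS Cap_sigma_gt ?IH //; move: h; clear; lia.
Qed.

Lemma Cap_fall_far a N p v : (a + N < p)%N -> cap p (fall a N v) = fall a N (cap p v).
Proof.
by elim: N v => [//|N IH] v h; rewrite !fallS IH ?Cap_sigma_gt //; move: h; clear; lia.
Qed.

(** The two crossings with the legs of the cup disappear by [sigma_sigma_CupS], the others are far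
    from it, and the cup moves one place to the left as the strand has passed it. *)
Lemma rise_Cup a N i v : (i <= N)%N -> rise a N.+2 (cup (a + i).+1 v) = cup (a + i) (rise a N v).
Proof.
elim: N => [|N IH] iN.
  by move: iN; rewrite leqn0 => /eqP ->; rewrite !riseS !addn0 addn1 sigma_sigma_CupS.
move: iN; rewrite leq_eqVlt => /orP[/eqP ->|iN].
  rewrite [LHS]riseS [rise a N.+2 _]riseS rise_Cup_far; last by clear; lia.
  by rewrite [(a + N.+2)%N]addnS sigma_sigma_CupS.
rewrite [LHS]riseS IH // riseS.
by rewrite !addnS sigma_Cup_lt // leq_add2l.
Qed.

Lemma fall_Cup a N i v : (i <= N)%N -> fall a N.+2 (cup (a + i) v) = cup (a + i).+1 (fall a N v).
Proof.
elim: N v => [|N IH] v iN.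
  by move: iN; rewrite leqn0 => /eqP ->; rewrite !fallS !addn0 addn1 sigma_sigma_Cup.
move: iN; rewrite leq_eqVlt => /orP[/eqP ->|iN].
  rewrite [LHS]fallS [LHS]fallS [(a + N.+2)%N]addnS sigma_sigma_Cup fall_Cup_far //.
by rewrite [LHS]fallS !addnS sigma_Cup_lt ?leq_add2l // IH // fallS.
Qed.

Lemma clasp_over_Cup a c N i v : (i <= N)%N ->
  clasp_over a c N.+2 (cup (a + c + i) v) = cup (a + i) (clasp_over a c N v).
Proof.
move=> iN; elim: c v => [|c IH] v; first by rewrite addn0.
by rewrite !clasp_overS addnS [((a + c).+1 + i)%N]addSn rise_Cup // IH.
Qed.

Lemma clasp_under_Cup a c N i v : (i <= N)%N ->
  clasp_under a c N.+2 (cup (a + i) v) = cup (a + c + i) (clasp_under a c N v).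
Proof.
move=> iN; elim: c v => [|c IH] v; first by rewrite addn0.
by rewrite !clasp_underS IH fall_Cup // addnS addSn.
Qed.

Lemma ncups_Cup k i v : ncups k (cup i v) = cup (k.*2 + i) (ncups k v).
Proof.
by elim: k => //= k ->; rewrite cupcup // -addnn -addnA leq_addr.
Qed.

Lemma ncaps_Cup k i v : ncaps k (cup (k.*2 + i) v) = cup i (ncaps k v).
Proof.
elim: k v => //= k IH v; rewrite doubleS !addSn capcup_lt ?IH //.
by rewrite -addnn -addnA leq_addr.
Qed.

Lemma Cap_ncaps k i v : cap i (ncaps k v) = ncaps k (cap (k.*2 + i) v).
Proof.
elim: k v => //= k IH v; rewrite doubleS !addSn IH capcap //.
by rewrite -addnn -addnA leq_addr.
Qed.

Lemma clasp_over_Cup_far a c N p v : (a + c + N <= p)%N ->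
  clasp_over a c N (cup p v) = cup p (clasp_over a c N v).
Proof.
elim: c v => [//|c IH] v h; rewrite !clasp_overS rise_Cup_far ?IH //; move: h; clear; lia.
Qed.

Lemma sigma_rise_far a N p v : (a + N < p)%N -> sigma p (rise a N v) = rise a N (sigma p v).
Proof.
by elim: N => [//|N IH] h; rewrite !riseS sigmaC ?IH //; move: h; clear; lia.
Qed.

Lemma sigma_fall_far a N p v : (a + N < p)%N -> sigma p (fall a N v) = fall a N (sigma p v).
Proof.
elim: N v => [//|N IH] v h; rewrite !fallS IH; last by move: h; clear; lia.
by rewrite (@sigmaC (a + N) p) //; move: h; clear; lia.
Qed.

Lemma cap_under_far a c N p v : (a + c + N <= p)%N ->
  cap p (clasp_under a c N v) = clasp_under a c N (cap p v).
Proof.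
elim: c v => [//|c IH] v h; rewrite !clasp_underS Cap_fall_far ?IH //; move: h; clear; lia.
Qed.

Lemma sigma_over_far a c N p v : (a + c + N <= p)%N ->
  sigma p (clasp_over a c N v) = clasp_over a c N (sigma p v).
Proof.
elim: c v => [//|c IH] v h; rewrite !clasp_overS IH ?sigma_rise_far //; move: h; clear; lia.
Qed.

Lemma sigma_under_far a c N p v : (a + c + N <= p)%N ->
  sigma p (clasp_under a c N v) = clasp_under a c N (sigma p v).
Proof.
elim: c v => [//|c IH] v h; rewrite !clasp_underS sigma_fall_far ?IH //; move: h; clear; lia.
Qed.

(** The last of the [N.+1] strands crosses the [c] cable strands after the other ones. *)
Lemma clasp_over_last a c N v :
  clasp_over a c N.+1 v = fall (a + N) c (clasp_over a c N v).
Proof.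
elim: c v => [//|c IH] v; rewrite [LHS]clasp_overS IH riseS fallS clasp_overS.
by rewrite sigma_over_far; [rewrite addnAC|clear; lia].
Qed.

Lemma clasp_under_last a c N v :
  clasp_under a c N.+1 v = clasp_under a c N (rise (a + N) c v).
Proof.
elim: c v => [//|c IH] v; rewrite [LHS]clasp_underS IH fallS riseS clasp_underS.
by rewrite sigma_under_far; [rewrite addnAC|clear; lia].
Qed.

Lemma turnback_fall_far a N p v : (a + N < p)%N -> turnback p (fall a N v) = fall a N (turnback p v).
Proof. by move=> h; rewrite /turnback Cap_fall_far // fall_Cup_far. Qed.

(** One strand crosses a cable of [k] strands, and [turnback_braid] lets a turnback of the cable
    pass through it. *)
Lemma turnback_fall p k j v : (j.+1 < k)%N ->
  turnback (p + j).+1 (fall p k v) = fall p k (turnback (p + j) v).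
Proof.
elim: k v => [//|k IH] v; rewrite ltnS leq_eqVlt => /orP[/eqP <-|jk].
  rewrite !fallS addnS turnback_fall_far ?turnback_braid //.
by rewrite !fallS IH // turnback_sigma_gt //; move: jk; clear; lia.
Qed.

Lemma turnback_clasp_over a k N j v : (j.+1 < k)%N ->
  turnback (a + N + j) (clasp_over a k N v) = clasp_over a k N (turnback (a + j) v).
Proof.
move=> jk; elim: N v => [|N IH] v.
  rewrite addn0; elim: k {jk} v => [//|k IH] v.
  by rewrite !clasp_overS.
by rewrite !clasp_over_last addnS addSn turnback_fall // IH.
Qed.

(** A turnback on the right half of the nested cups slides round them to the mirror position on the
    left half, where the idempotent is. *)
Lemma ncups_mirror k i j v : (i + j).+2 = k ->
  turnback (k + j) (ncups k v) = turnback i (ncups k v).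
Proof.
elim: j k i v => [|j IH] k i v <-.
  rewrite !addn0 !ncupsS /turnback cap_cupS.
  by rewrite capS_cup [RHS]cupcup.
rewrite (addnS i j) [ncups _ _]ncupsS.
have -> : ((i + j).+3 + j.+1)%N = ((i + j).+2 + j).+2 by rewrite addnS.
rewrite turnback_Cup_lt ?leq_addr // (IH _ i) //.
by rewrite turnback_Cup_gt // leq_addr.
Qed.

Lemma sigma_turnback0 i v : turnback i v = 0 -> sigma i v = A *: v.
Proof. by move=> h; rewrite /sigma h scaler0 addr0. Qed.

Lemma rise_turnback0 p k v : (forall j, (j < k)%N -> turnback (p + j) v = 0) ->
  rise p k v = A ^+ k *: v.
Proof.
elim: k => [|k IH] h; first by rewrite expr0 scale1r.
rewrite riseS IH => [|j jk]; last by apply: h; exact: ltnW.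
by rewrite sigmaZ sigma_turnback0 ?h // scalerA exprSr.
Qed.

Lemma fall_turnback0 p k v : (forall j, (j < k)%N -> turnback (p + j) v = 0) ->
  fall p k v = A ^+ k *: v.
Proof.
elim: k => [|k IH] h; first by rewrite expr0 scale1r.
rewrite fallS sigma_turnback0 ?h // fallZ IH => [|j jk]; last by apply: h; exact: ltnW.
by rewrite scalerA exprS.
Qed.

(** The eigenvalue of a circle around [k] strands carrying the idempotent; for [k = 0] it is [d]. *)
Definition ring_scalar k : F := - ((A * A) ^+ k.+1 + (A * A) ^- k.+1).

Lemma ring_scalarS k : A * (A * (d * (A ^+ k * A ^+ k)) + A^-1 * (A ^+ k * A ^+ k)) +
  A^-1 * (A * (A ^+ k * A ^+ k) + A^-1 * ring_scalar k) = ring_scalar k.+1.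
Proof.
rewrite /ring_scalar /d !exprS -!exprMn_comm; last exact: mulrC.
have Q0 : (A * A) ^+ k != 0 by rewrite expf_neq0 // mulf_neq0.
by move: ((A * A) ^+ k) Q0 => y y0; field; rewrite ?A_neq0 ?y0.
Qed.

(** Geometrically, a circle around [k] strands carrying a vector killed by every turnback. *)
Lemma ring_around p k x : (forall j, (j.+1 < k)%N -> turnback (p + j) x = 0) ->
  cap (p + k) (rise p k (fall p k (cup (p + k) x))) = ring_scalar k *: x.
Proof.
elim: k x => [|k IH] x hx.
  by rewrite addn0 cap_cup /ring_scalar /d expr1.
pose X v := rise p k (fall p k v).
have XZ c v : X (c *: v) = c *: X v by rewrite /X fallZ riseZ.
have XD u v : X (u + v) = X u + X v by rewrite /X fallD riseD.
have XCup v : X (cup (p + k).+1 v) = cup (p + k).+1 (X v).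
  by rewrite /X fall_Cup_far // rise_Cup_far.
have XCap v : cap (p + k).+1 (X v) = X (cap (p + k).+1 v).
  by rewrite /X Cap_rise_far // Cap_fall_far.
have Xx : X x = (A ^+ k * A ^+ k) *: x.
  by rewrite /X fall_turnback0 // riseZ rise_turnback0 // scalerA.
have IHx : cap (p + k) (X (cup (p + k) x)) = ring_scalar k *: x.
  by apply: IH => j jk; apply: hx; exact: ltnW.
rewrite addnS riseS fallS -/(X _).
(* Smoothing the two crossings with the last strand gives four terms. In three of them [X] acts on
   [x] itself, hence by [A ^+ k * A ^+ k], once with an extra circle; the fourth is the ring around
   [k] strands. *)
have -> : sigma (p + k) (cup (p + k).+1 x) = A *: cup (p + k).+1 x + A^-1 *: cup (p + k) x.
  by rewrite /sigma /turnback cap_cupS.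
have Cs w : cap (p + k).+1 (sigma (p + k) w) = A *: cap (p + k).+1 w + A^-1 *: cap (p + k) w.
  by rewrite /sigma /turnback capD !capZ capS_cup.
rewrite XD !XZ XCup Xx Cs !capD !capZ IHx XCap capS_cup Xx cap_cupS cap_cup.
by rewrite !scalerA -!scalerDl !scalerA -scalerDl ring_scalarS.
Qed.

Variable Jc : nat -> F.

(** [Jc k] is the coefficient of the partial-trace term of the [k]-th Wenzl recursion. *)
Fixpoint wenzl k (v : V) : V :=
  if k is k'.+1 then
    if k' is k''.+1 then wenzl k' v + Jc k' *: wenzl k' (turnback k'' (wenzl k' v)) else v
  else v.

Lemma wenzlS k v :
  wenzl k.+2 v = wenzl k.+1 v + Jc k.+1 *: wenzl k.+1 (turnback k (wenzl k.+1 v)).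
Proof. by []. Qed.

Lemma wenzlD k u v : wenzl k (u + v) = wenzl k u + wenzl k v.
Proof.
elim: k u v => [//|[//|k] IH] u v; rewrite !wenzlS !IH turnbackD IH scalerDr.
by rewrite addrACA.
Qed.

Lemma wenzlZ k x v : wenzl k (x *: v) = x *: wenzl k v.
Proof.
elim: k v => [//|[//|k] IH] v; rewrite !wenzlS !IH turnbackZ IH scalerDr.
by rewrite !scalerA [x * _]mulrC.
Qed.

Lemma wenzl0 k : wenzl k 0 = 0.
Proof. by rewrite -(scale0r 0) wenzlZ !scale0r. Qed.

Lemma wenzl_cup k i v : (k <= i)%N -> wenzl k (cup i v) = cup i (wenzl k v).
Proof.
elim: k v => [//|[//|k] IH] v ki; have ki' := ltnW ki.
rewrite !wenzlS !IH // cupD cupZ; congr (_ + _ *: _).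
by case: i ki ki' IH => [|[|i]] // ki ki' IH; rewrite turnback_Cup_gt // IH.
Qed.

Lemma cap_wenzl k i v : (k <= i)%N -> cap i (wenzl k v) = wenzl k (cap i v).
Proof.
elim: k v => [//|[//|k] IH] v ki; have ki' := ltnW ki.
rewrite !wenzlS capD capZ !IH //; congr (_ + _ *: _).
by case: i ki ki' IH => [|[|i]] // ki ki' IH; rewrite Cap_turnback_gt // IH.
Qed.

Lemma wenzl_id k x : (forall i, (i.+1 < k)%N -> cap i x = 0) -> wenzl k x = x.
Proof.
elim: k => [//|[//|k] IH] h; rewrite wenzlS !IH => [|i ik]; last by apply: h; exact: ltnW.
by rewrite /turnback h // linear0 wenzl0 scaler0 addr0.
Qed.

(** The idempotent is the identity plus terms that end with a cup. This is the dual of [wenzl_id],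
    for a map killing cups instead of a vector killed by caps. *)
Lemma absorb_wenzl (f : V -> V) k v : (forall u w, f (u + w) = f u + f w) ->
  (forall x u, f (x *: u) = x *: f u) ->
  (forall i u, (i.+1 < k)%N -> f (cup i u) = 0) -> f (wenzl k v) = f v.
Proof.
move=> fD fZ; elim: k v => [//|[//|k] IH] v h.
have h' i u : (i.+1 < k.+1)%N -> f (cup i u) = 0 by move=> ik; apply: h; exact: ltnW.
by rewrite wenzlS fD fZ !IH // h // scaler0 addr0.
Qed.

(** The factor [d + Jc k] is the partial trace of the idempotent on [k.+1] strands; the equation
    makes the correction term of the next one cancel the leading term under the new cap. *)
Hypothesis Jc_rec : forall k, 1 + Jc k.+1 * (d + Jc k) = 0.
Hypothesis Jc0 : Jc 0 = 0.

Let kills k := (forall i v, (i.+1 < k)%N -> cap i (wenzl k v) = 0) /\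
  (forall i v, (i.+1 < k)%N -> wenzl k (cup i v) = 0).

Let partial_trace k v : kills k -> cap k (wenzl k.+1 (cup k v)) = (d + Jc k) *: wenzl k v.
Proof.
case: k => [|k] [ka _]; first by rewrite /= cap_cup Jc0 addr0.
rewrite wenzlS wenzl_cup // capD capZ cap_cup cap_wenzl // /turnback capS_cup cap_cupS.
by rewrite (@wenzl_id k.+1 (wenzl _ _)) -?scalerDl // => i; exact: ka.
Qed.

(** Strong induction, because the two statements feed each other: the step to [k.+2] uses the case
    [k.+1], and the case [k] through its partial trace. Only the last position is new. *)
Let wenzl_kills k : kills k.
Proof.
elim/ltn_ind: k => -[|[|k]] IH; try by split.
have [a1 b1] := IH k.+1 (ltnSn _); have c1 v := partial_trace v (IH k (ltnW (ltnSn _))).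
split=> i v; rewrite ltnS leq_eqVlt => /orP[/eqP[->]|ik]; rewrite wenzlS.
- rewrite capD capZ /turnback c1 -cap_wenzl //.
  rewrite (@wenzl_id k (wenzl _ _)) => [|j jk]; last by apply: a1; exact: ltnW.
  by rewrite scalerA -[X in X + _]scale1r -scalerDl Jc_rec scale0r.
- by rewrite capD capZ !a1 // scaler0 addr0.
- rewrite /turnback c1 cupZ wenzlZ -wenzl_cup //.
  rewrite (@absorb_wenzl (wenzl k.+1) k (cup k v)).
  + by rewrite scalerA -[X in X + _]scale1r -scalerDl Jc_rec scale0r.
  + by move=> *; rewrite wenzlD.
  + by move=> *; rewrite wenzlZ.
  + by move=> j u jk; apply: b1; exact: ltnW.
- by rewrite b1 // /turnback !linear0 wenzl0 scaler0 addr0.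
Qed.

Lemma cap_wenzl0 k i v : (i.+1 < k)%N -> cap i (wenzl k v) = 0.
Proof. by have [h _] := wenzl_kills k; exact: h. Qed.

Lemma wenzl_cup0 k i v : (i.+1 < k)%N -> wenzl k (cup i v) = 0.
Proof. by have [_ h] := wenzl_kills k; exact: h. Qed.

Lemma wenzl_idem k v : wenzl k (wenzl k v) = wenzl k v.
Proof. by apply: wenzl_id => i ik; exact: cap_wenzl0. Qed.

Lemma wenzl_trace k v : cap k (wenzl k.+1 (cup k v)) = (d + Jc k) *: wenzl k v.
Proof. exact: partial_trace. Qed.

Definition encircling N k v :=
  ncaps k (clasp_under k k N (clasp_over k k N (wenzl k (ncups k v)))).

Lemma encircling_cup N k i v : (i <= N)%N ->
  encircling N.+2 k (cup i v) = cup i (encircling N k v).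
Proof.
move=> iN; rewrite /encircling ncups_Cup wenzl_cup; last by rewrite -addnn -addnA leq_addr.
by rewrite -addnn clasp_over_Cup // clasp_under_Cup // addnn ncaps_Cup.
Qed.

(** Closing the last strand turns it into a circle around the right half of the cable. A turnback on
    that half passes back through the clasp and round the nested cups to the idempotent, which kills
    it, so [ring_around] applies. *)
Lemma encircling_last N k v :
  cap N (encircling N.+1 k (cup N v)) = ring_scalar k *: encircling N k v.
Proof.
rewrite /encircling ncups_Cup wenzl_cup; last by rewrite -addnn -addnA leq_addr.
rewrite Cap_ncaps clasp_over_last clasp_under_last.
rewrite clasp_over_Cup_far ?addnn //.
set x := clasp_over k k N _.
rewrite cap_under_far ?addnn //.
have -> : (k.*2 + N = (k + N) + k)%N by rewrite -addnn addnAC.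
rewrite ring_around => [|j jk]; first by rewrite clasp_underZ ncapsZ.
rewrite turnback_clasp_over // /turnback cap_wenzl ?leq_addr // -wenzl_cup ?leq_addr //.
rewrite -/(turnback _ _) (@ncups_mirror k (k - j.+2)); last by move: jk; clear; lia.
rewrite wenzl_cup0; last by move: jk; clear; lia.
by elim: {2}k => [//|c IH]; rewrite clasp_overS -(scale0r (0 : V)) riseZ !scale0r IH.
Qed.

(** With nothing to encircle, the closure of the idempotent is computed by one partial trace per
    strand. *)
Lemma encircling0 k v : encircling 0 k v = \prod_(i < k) (d + Jc i) *: v.
Proof.
have over0 w : clasp_over k k 0 w = w by elim: {2}k w => [//|c IH] w; rewrite clasp_overS IH.
have under0 w : clasp_under k k 0 w = w by elim: {2}k w => [//|c IH] w; rewrite clasp_underS IH.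
rewrite /encircling over0 under0 {over0 under0}; elim: k v => [|k IH] v.
  by rewrite big_ord0 scale1r.
by rewrite ncapsS ncupsS wenzl_trace ncapsZ IH scalerA big_ord_recr mulrC.
Qed.

End TLModule.

(** An unnormalised quantum integer; the sign makes it satisfy the Chebyshev recursion in
    [- (x + x^-1)], that is, in [delta] when [x] is [q]. *)
Definition signed_qint (F : fieldType) (x : F) n : F := (-1) ^+ n * (x ^+ n - x ^- n).

Definition dq n : K := signed_qint q n.

Lemma signed_qint_rec (F : fieldType) (x : F) n : x != 0 ->
  - (x + x^-1) * signed_qint x n.+1 - signed_qint x n = signed_qint x n.+2.
Proof.
move=> x0; rewrite /signed_qint !exprS.
have y0 : x ^+ n != 0 by rewrite expf_neq0.
by move: (x ^+ n) y0 ((-1) ^+ n) => y y0 e; field; rewrite ?x0 ?y0.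
Qed.

Lemma dq_neq0 n : dq n.+1 != 0.
Proof.
rewrite /dq /signed_qint mulf_neq0 ?signr_eq0 //; apply/negP; rewrite subr_eq0 => /eqP h.
have : q ^+ n.+1 * q ^+ n.+1 = 1 by rewrite {2}h mulfV // expf_neq0 // q_neq0.
rewrite -exprD /q -exprM /qhalf -rmorphXn -[RHS](rmorph1 (@FracField.tofrac {poly rat})).
move=> /eqP; rewrite tofrac_eq => /eqP /(congr1 (fun p : {poly rat} => size p)).
by rewrite size_polyXn size_poly1.
Qed.

(** Minus the ratio of two consecutive traces of Jones-Wenzl idempotents, as the trace of the
    idempotent on [k] strands is [dq k.+1 / dq 1]. *)
Definition wenzl_coef k : K := - (dq k / dq k.+1).

Lemma wenzl_coef0 : wenzl_coef 0 = 0.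
Proof. by rewrite /wenzl_coef /dq /signed_qint !expr0 invr1 subrr mulr0 mul0r oppr0. Qed.

Lemma deltaE : delta = - (qhalf * qhalf + (qhalf * qhalf)^-1).
Proof. by rewrite /delta /q expr2. Qed.

Lemma delta_wenzl k : delta + wenzl_coef k = dq k.+2 / dq k.+1.
Proof.
have := signed_qint_rec k q_neq0; rewrite -/(dq _) -/(dq _) -/(dq _) -/delta => <-.
by rewrite mulrBl mulfK // dq_neq0.
Qed.

Lemma wenzl_coef_rec k : 1 + wenzl_coef k.+1 * (delta + wenzl_coef k) = 0.
Proof.
rewrite delta_wenzl /wenzl_coef mulNr mulf_div [X in _ - X / _]mulrC mulfV ?subrr //.
by rewrite mulf_neq0 // dq_neq0.
Qed.

(** * The spin functions as a Temperley-Lieb module *)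

Definition lCup i : {linear Vec -> Vec} := Cup i.
Definition lCap i : {linear Vec -> Vec} := Cap i.

Lemma lcap_cup i v : lCap i (lCup i v) = - (qhalf * qhalf + (qhalf * qhalf)^-1) *: v.
Proof. by rewrite -deltaE; exact: Cap_Cup. Qed.

Lemma wenzl_coef_rec' k :
  1 + wenzl_coef k.+1 * (- (qhalf * qhalf + (qhalf * qhalf)^-1) + wenzl_coef k) = 0.
Proof. by rewrite -deltaE; exact: wenzl_coef_rec. Qed.

Definition Sigma := sigma qhalf lCup lCap.
Definition Wenzl := wenzl lCup lCap wenzl_coef.
Definition Encircling := encircling qhalf lCup lCap wenzl_coef.

Ltac tl_module :=
  first [exact: qhalf_neq0 | exact: lcap_cup | exact: CapS_Cup | exact: Cap_CupS
        | exact: CupCup | exact: CapCap | exact: CapCup_gt | exact: CapCup_lt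
        | exact: wenzl_coef_rec' | exact: wenzl_coef0 | idtac].

Lemma Encircling_cup N k i v : (i <= N)%N ->
  Encircling N.+2 k (Cup i v) = Cup i (Encircling N k v).
Proof. by move=> iN; apply: (@encircling_cup _ qhalf _ lCup lCap); tl_module. Qed.

Lemma Encircling_last N k v :
  Cap N (Encircling N.+1 k (Cup N v)) = ring_scalar qhalf k *: Encircling N k v.
Proof. by apply: (@encircling_last _ qhalf _ lCup lCap); tl_module. Qed.

Lemma Encircling0 k v : Encircling 0 k v = (dq k.+1 / dq 1) *: v.
Proof.
transitivity (\prod_(i < k) (delta + wenzl_coef i) *: v).
  by rewrite deltaE; apply: (@encircling0 _ qhalf _ lCup lCap); tl_module.
congr (_ *: _); elim: k => [|k IH]; first by rewrite big_ord0 mulfV // dq_neq0.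
by rewrite big_ord_recr IH delta_wenzl /= mulrC -mulrA mulKf // dq_neq0.
Qed.

Lemma Cap_Wenzl k i v : (i.+1 < k)%N -> Cap i (Wenzl k v) = 0.
Proof. by move=> ik; apply: (@cap_wenzl0 _ qhalf _ lCup lCap); tl_module. Qed.

Lemma Wenzl_Cup k i v : (i.+1 < k)%N -> Wenzl k (Cup i v) = 0.
Proof. by move=> ik; apply: (@wenzl_cup0 _ qhalf _ lCup lCap); tl_module. Qed.

Lemma Wenzl_idem k v : Wenzl k (Wenzl k v) = Wenzl k v.
Proof. by apply: (@wenzl_idem _ qhalf _ lCup lCap); tl_module. Qed.

Lemma Wenzl_id k v : (forall i, (i.+1 < k)%N -> Cap i v = 0) -> Wenzl k v = v.
Proof. exact: wenzl_id. Qed.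

Lemma WenzlD k u v : Wenzl k (u + v) = Wenzl k u + Wenzl k v.
Proof. exact: wenzlD. Qed.

Lemma WenzlZ k x v : Wenzl k (x *: v) = x *: Wenzl k v.
Proof. exact: wenzlZ. Qed.

Section OpLinear.
Variables (m n : nat).
Implicit Types (x y : QTL m n) (u v : Vec).

Lemma coordQD x y l : coordQ (x + y) l = coordQ x l + coordQ y l.
Proof. by rewrite /coordQ ffunE. Qed.

Lemma coordQZ c x l : coordQ (c *: x) l = c * coordQ x l.
Proof. by rewrite /coordQ ffunE. Qed.

Lemma op_addl x y v : op (x + y) v = op x v + op y v.
Proof.
apply: funext => s; rewrite /op; apply: etrans (big_split _ _ _ _ _).
by apply: eq_bigr => l _; rewrite coordQD mulrDl.
Qed.

Lemma op_scalel c x v : op (c *: x) v = c *: op x v.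
Proof.
apply: funext => s; rewrite /op; apply: etrans (esym (big_distrr _ _ _)).
by apply: eq_bigr => l _; rewrite coordQZ; exact: (esym (mulrA _ _ _)).
Qed.

Lemma op_of_TLZ (l : TL m n) c v : op_of_TL l (c *: v) = c *: op_of_TL l v.
Proof.
apply: funext => s; rewrite /op_of_TL; apply: etrans (sum_bitsZ _ _ _ _).
by apply: eq_sum_bits => b; rewrite mulrCA.
Qed.

Lemma opZ x c v : op x (c *: v) = c *: op x v.
Proof.
apply: funext => s; rewrite /op; apply: etrans (esym (big_distrr _ _ _)).
by apply: eq_bigr => l _; rewrite op_of_TLZ mulrCA.
Qed.

Lemma op_sum v x : op x v = \sum_(l : TL m n) coordQ x l *: op_of_TL l v.
Proof.
apply: funext => s; rewrite /op.
elim/big_rec2: _ => [//|l y1 y2 _ ->]; by [].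
Qed.

End OpLinear.

Lemma op_crossing n (i : 'I_n.-1) v : op (crossing true i) v = Sigma i v.
Proof.
rewrite /crossing op_addl !op_scalel op_id /Sigma /sigma; congr (_ + _ *: _).
case: n i => [[]|[[]//|n]] //= i.
by rewrite op_comp op_cap op_cup.
Qed.

Lemma op_braid n (w : seq 'I_n.-1) v : op (braid w) v = foldl (fun v i => Sigma i v) v (map val w).
Proof.
rewrite /braid; elim/last_ind: w v => [|w i IH] v; first exact: op_id.
by rewrite foldl_rcons op_comp IH op_crossing map_rcons foldl_rcons.
Qed.

Lemma op_nested_cups k N v : op (nested_cups k N) v = ncups lCup k v.
Proof.
elim: k => [|k IH]; first exact: op_id.
by rewrite [LHS]op_comp IH op_cup inordK // ltnS -addnn -addnA leq_addr.
Qed.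

Lemma op_nested_caps k N v : op (nested_caps k N) v = ncaps lCap k v.
Proof.
elim: k v => [|k IH] v; first exact: op_id.
have e : op (basisQ (capTL (inord k : 'I_(k.*2 + N).+1))) v = Cap k v.
  by rewrite op_cap inordK // ltnS -addnn -addnA leq_addr.
by rewrite [LHS]op_comp IH; exact: (congr1 (ncaps lCap k) e).
Qed.

Notation word_op w v := (foldl (fun v i => Sigma i v) v w).

Lemma rise_word a N v : rise qhalf lCup lCap a N v = word_op [seq (a + b)%N | b <- iota 0 N] v.
Proof.
elim: N => [//|N IH]; rewrite riseS IH -[in RHS]addn1 iotaD map_cat foldl_cat //.
Qed.

Lemma fall_word a N v : fall qhalf lCup lCap a N v = word_op (rev [seq (a + b)%N | b <- iota 0 N]) v.
Proof.
elim: N v => [//|N IH] v; rewrite fallS IH -[in RHS]addn1 iotaD map_cat rev_cat foldl_cat //.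
Qed.

Lemma clasp_over_word a c N v : clasp_over qhalf lCup lCap a c N v =
  word_op [seq (a' + b)%N | a' <- rev (iota a c), b <- iota 0 N] v.
Proof.
elim: c v => [//|c IH] v; rewrite clasp_overS IH rise_word -[in RHS]addn1 iotaD rev_cat.
by rewrite /= foldl_cat.
Qed.

Lemma clasp_under_word a c N v : clasp_under qhalf lCup lCap a c N v =
  word_op (rev [seq (a' + b)%N | a' <- rev (iota a c), b <- iota 0 N]) v.
Proof.
elim: c v => [//|c IH] v; rewrite clasp_underS IH fall_word -[in RHS]addn1 iotaD rev_cat.
by rewrite /= rev_cat foldl_cat.
Qed.

Lemma op_clasp k N v : op (clasp k N) v =
  clasp_under qhalf lCup lCap k k N (clasp_over qhalf lCup lCap k k N v).
Proof.
rewrite /clasp op_braid clasp_under_word clasp_over_word -foldl_cat; congr (foldl _ _ _).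
(* No letter of the word is lost by [insub]: with [a < k.*2] and [b < N], the sum [a + b] is below
   [(k.*2 + N).-1]. *)
have valK (w : seq nat) d : all (fun i => i < d)%N w -> map val (pmap insub w : seq 'I_d) = w.
  elim: w => [//|i w IH] /= /andP[id aw]; rewrite /oapp insubT /= IH //.
apply: valK; rewrite all_cat all_rev andbb; apply/allP => x /allpairsP[[a b] /= [ha hb ->]].
move: ha hb; rewrite mem_rev !mem_iota -addnn; clear; lia.
Qed.

Lemma op_encircle_JW N k v : (forall w, op (JW k) w = Wenzl k w) ->
  op (encircle N k) v = Encircling N k v.
Proof.
move=> h; rewrite /encircle !op_comp op_nested_cups op_widen h op_clasp op_nested_caps //.
Qed.

Lemma delta_neq0 : delta != 0.
Proof.
have := delta_wenzl 0; rewrite wenzl_coef0 addr0 => ->.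
by rewrite mulf_neq0 ?invr_eq0 ?dq_neq0.
Qed.

Lemma op_of_TL_cup m n (l : TL m n) (i j : 'I_n) v : l (inr i) = inr j -> j = i.+1 :> nat ->
  op_of_TL l v = delta^-1 *: Cup i (Cap i (op_of_TL l v)).
Proof.
by move=> lij ji; rewrite (op_of_TL_top lij ji) scalerA mulVf ?scale1r // delta_neq0.
Qed.

(** The Wenzl recursion inside [QTL]. It provides the existence on which [JW], defined by choice,
    depends. *)
Fixpoint wenzlQ k : QTL k k :=
  match k return QTL k k with
  | 0 => idQ 0
  | k'.+1 =>
    match k' return QTL k' k' -> QTL k'.+1 k'.+1 with
    | 0 => fun=> idQ 1
    | k''.+1 => fun P =>
        let W := widenQ (leqnSn k''.+1) P in
        W + wenzl_coef k''.+1 *: compQ W (compQ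
          (compQ (basisQ (cupTL ord_max)) (basisQ (capTL ord_max))) W)
    end (wenzlQ k')
  end.

Lemma op_wenzlQ k v : op (wenzlQ k) v = Wenzl k v.
Proof.
elim: k v => [|[|k] IH] v; [exact: op_id|exact: op_id|].
rewrite [LHS]op_addl op_scalel !op_comp !op_widen !IH op_cap op_cup.
exact: (esym (wenzlS _ _ _ _ _)).
Qed.

Lemma Cup_true i v : Cup i v (fun=> true) = 0.
Proof. by rewrite /Cup mul0r. Qed.

(** A top cup needs opposite spins, so evaluation at the constant spin [true] isolates the
    coefficient of the identity tangle. *)
Lemma op_of_TL_true k (l : TL k k) v : l != idTL k -> op_of_TL l v (fun=> true) = 0.
Proof.
move=> /top_cup [i [j [lij ji]]].
by rewrite (op_of_TL_cup v lij ji); apply: etrans (congr1 _ (Cup_true _ _)) (mulr0 _).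
Qed.

Lemma Wenzl_true k v : Wenzl k v (fun=> true) = v (fun=> true).
Proof.
elim: k v => [//|[//|k] IH] v; rewrite /Wenzl wenzlS -/(Wenzl _ _) -/Wenzl.
apply: etrans (congr2 (fun x y : K => x + wenzl_coef k.+1 * y) (IH v) (IH _)) _.
by rewrite /turnback [X in _ * X]Cup_true mulr0 addr0.
Qed.

Lemma op_JW_coef k (P : QTL k k) : (forall v, op P v = Wenzl k v) -> coordQ P (idTL k) = 1.
Proof.
move=> h; have e := Wenzl_true k (fun=> 1); rewrite -h in e.
have -> : coordQ P (idTL k) = op P (fun=> 1) (fun=> true); last exact: e.
rewrite /op (bigD1 (idTL k)) //= big1 => [|l nl]; last by rewrite op_of_TL_true // mulr0.
by rewrite addr0 -op_basis op_id; exact: (esym (mulr1 _)).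
Qed.

Lemma is_JW_wenzlQ k : is_JW (wenzlQ k).
Proof.
split.
- by apply: op_inj => v; rewrite op_comp !op_wenzlQ Wenzl_idem.
- by apply: op_JW_coef => v; exact: op_wenzlQ.
have op0 v : op (0 : QTL k k) v = 0.
  by rewrite -(scale0r (0 : QTL k k)) op_scalel scale0r.
move=> l nl; split; apply: op_inj => v; rewrite op_comp op0 op_wenzlQ op_basis.
  have [i [j [lij ji]]] := top_cup nl.
  by rewrite (op_of_TL_cup v lij ji) WenzlZ Wenzl_Cup ?scaler0 // -ji ltn_ord.
have [i [j [lij ji]]] := bottom_cap nl.
by apply: (op_of_TL_bottom lij ji); rewrite Cap_Wenzl // -ji ltn_ord.
Qed.

Lemma op_of_TLD m n (l : TL m n) u w : op_of_TL l (u + w) = op_of_TL l u + op_of_TL l w.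
Proof.
apply: funext => s; have E (f g : (nat -> bool) -> K) t :
    sum_bits (iota 0 m) (fun b => f b + g b) t = sum_bits (iota 0 m) f t + sum_bits (iota 0 m) g t.
  have := @sum_bits_sum _ bool [:: true; false] (iota 0 m) (fun c => if c then f else g) t.
  by rewrite !big_cons !big_nil !addr0 => <-; apply: eq_sum_bits => b; rewrite !big_cons big_nil addr0.
apply: etrans (E _ _ _); apply: eq_sum_bits => b; exact: mulrDr.
Qed.

Lemma opD m n (x : QTL m n) u w : op x (u + w) = op x u + op x w.
Proof. by rewrite !op_sum -big_split; apply: eq_bigr => l _; rewrite op_of_TLD scalerDr. Qed.

(** Both are equal to the product of [P] and [P']: when either factor is expanded in the basis, the
    other one kills all terms but the identity. *)
Lemma is_JW_uniq k (P P' : QTL k k) : is_JW P -> is_JW P' -> P = P'.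
Proof.
have expand (R : QTL k k) v : coordQ R (idTL k) = 1 ->
    op R v = v + \sum_(l | l != idTL k) coordQ R l *: op_of_TL l v.
  move=> R1; rewrite op_sum (bigD1 (idTL k)) //= R1 scale1r; congr (_ + _).
  by rewrite -op_basis op_id.
move=> [_ P1 Pl] [_ P'1 P'l]; apply: op_inj => v.
have opl (R : QTL k k) l : op R (op_of_TL l v) = op (compQ R (basisQ l)) v.
  by rewrite op_comp op_basis.
transitivity (op P (op P' v)); last first.
  rewrite (expand P) // big1 ?addr0 // => l nl.
  have [_ h] := P'l l nl; rewrite -op_basis -op_comp h.
  by rewrite -(scale0r (0 : QTL k k)) op_scalel scale0r scaler0.
rewrite (expand P') //.
rewrite opD; have -> : op P (\sum_(l | l != idTL k) coordQ P' l *: op_of_TL l v) = 0.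
  elim/big_ind: _ => [|u w hu hw|l nl].
  - by rewrite -(scale0r (0 : Vec)) opZ !scale0r.
  - by rewrite opD hu hw addr0.
  - have [h _] := Pl l nl; rewrite opZ opl h.
    by rewrite -(scale0r (0 : QTL k k)) op_scalel scale0r scaler0.
by rewrite addr0.
Qed.

Lemma JWE k : JW k = wenzlQ k.
Proof.
apply: (@is_JW_uniq k) (is_JW_wenzlQ k); rewrite /JW.
by case: xgetP => [P _ //|/(_ (wenzlQ k))]; case; exact: is_JW_wenzlQ.
Qed.

Lemma op_encircle N k v : op (encircle N k) v = Encircling N k v.
Proof. by apply: op_encircle_JW => w; rewrite JWE op_wenzlQ. Qed.

(** * Cyclicity of the closure *)

Lemma sum_bits_keep (I : eqType) (L : seq I) g g' (t : I -> bool) :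
  (forall b, (forall j, j \notin L -> b j = t j) -> g b = g' b) ->
  sum_bits L g t = sum_bits L g' t.
Proof.
elim: L g g' t => [|i L IH] g g' t h; first by apply: h.
apply: (IH (fun s => \sum_(b : bool) g (upd s i b)) (fun s => \sum_(b : bool) g' (upd s i b))) => b hb.
apply: eq_bigr => c _; apply: h => j; rewrite inE negb_or /upd => /andP[ji jL].
by rewrite (negbTE ji) hb.
Qed.

Lemma sum_bits_base (I : eqType) (L : seq I) (D : pred I) g (s s' : I -> bool) :
  (forall b b', (forall j, D j -> b j = b' j) -> g b = g b') ->
  (forall j, D j -> j \notin L -> s j = s' j) ->
  sum_bits L g s = sum_bits L g s'.
Proof.
elim: L D g => [|i L IH] D g gD h; first by apply: gD => j Dj; apply: h.
apply: (IH (fun j => D j && (j != i)) (fun s => \sum_(b : bool) g (upd s i b))).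
  move=> b b' hb; apply: eq_bigr => c _; apply: gD => j Dj; rewrite /upd.
  by case: eqP => // /eqP ji; rewrite hb // Dj ji.
by move=> j /andP[Dj ji] jL; apply: h => //; rewrite inE negb_or ji.
Qed.

Lemma ins_skip i c b j : ins i c b (skip i j) = b j.
Proof.
rewrite /ins /skip; case: (ltnP j i) => h; first by rewrite h.
by rewrite ltnNge leqW ?leqW //= !gtn_eqF // ?ltnS // leqW.
Qed.

Lemma upd_ins i c b j d : upd (ins i c b) (skip i j) d = ins i c (upd b j d).
Proof.
apply: funext => k; have [[n1 n2] inj] := (skip_neq i j, @skip_inj i).
case: (boolP ((k == i) || (k == i.+1))) => [/orP[]/eqP ->|].
- by rewrite /upd eq_sym (negbTE n1) !ins_left.
- by rewrite /upd eq_sym (negbTE n2) !ins_right.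
rewrite negb_or => /andP[ki ki1].
have [k' ->] : exists k', k = skip i k'.
  have [h|h] := ltnP k i; [exists k|exists k.-2]; rewrite /skip; first by rewrite h.
  by case: (ltnP k.-2 i) => h2; move: h h2 ki ki1; clear; lia.
rewrite ins_skip /upd (inj_eq inj); case: ifP => // _; exact: ins_skip.
Qed.

Lemma sum_bits_skip i c (L : seq nat) g b :
  sum_bits (map (skip i) L) g (ins i c b) = sum_bits L (fun b => g (ins i c b)) b.
Proof.
elim: L g b => [//|j L IH] g b.
apply: etrans (IH (fun s => \sum_(d : bool) g (upd s (skip i j) d)) b) _.
by apply: (@eq_sum_bits _ L) => t; apply: eq_bigr => d _; rewrite upd_ins.
Qed.

Lemma sum_bits_ins n i g s s' : (i <= n)%N ->
  (forall b, b i = b i.+1 -> g b = 0) -> (forall b b', agree n.+2 b b' -> g b = g b') ->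
  sum_bits (iota 0 n.+2) g s =
  sum_bits (iota 0 n) (fun b => \sum_(c : bool) g (ins i c b)) s'.
Proof.
move=> le_in g0 gE; rewrite (perm_sum_bits _ (perm_skip le_in)) sum_bits_cat sum_bits_sum.
rewrite [LHS]/sum_bits /= -/(sum_bits _ _); apply: eq_bigr => c _.
set t := fun d => upd (upd s i c) i.+1 d.
have tE d : (t d i = c) * (t d i.+1 = d).
  by rewrite /t /upd eqxx ltn_eqF ?eqxx.
rewrite -[LHS]/(\sum_(d : bool) sum_bits (map (skip i) (iota 0 n)) g (t d)).
rewrite (bigD1 (~~ c)) //= big1 ?addr0 => [|d dc].
  rewrite -[t (~~ c)](@ins_del i) ?tE // sum_bits_skip.
  apply: (@sum_bits_base _ _ (fun j => j < n)%N) => [b b' h|j jn]; last first.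
    by rewrite mem_iota /= add0n jn.
  apply: gE => j jn; rewrite /ins; case: ltnP => ji; first by rewrite h // (leq_trans ji).
  by case: eqP => // n1; case: eqP => // n2; apply: h; lia.
have dc' : d = c by case: (d) (c) dc => [] [].
transitivity (sum_bits (map (skip i) (iota 0 n)) (fun=> 0) (t d)).
  apply: sum_bits_keep => b hb; apply: g0; rewrite !hb ?tE //.
    by rewrite mem_skip // ?eqxx ?andbF // !ltnS.
  by rewrite mem_skip // ?eqxx // ltnS leqW.
elim: (map _ _) (t d) => [//|j L IH] u; rewrite -[RHS](IH u).
by apply: (@eq_sum_bits _ L) => w; apply: big1.
Qed.

Lemma eq_kernel m n (x : QTL m n) b b' s s' : agree m b b' -> agree n s s' ->
  kernel x b s = kernel x b' s'.
Proof. by move=> hb hs; apply: eq_bigr => l _; rewrite (eq_weight l hb hs). Qed.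

Lemma kernel_cup n m (i : 'I_n.+1) (x : QTL m n) b s :
  kernel (compQ (basisQ (cupTL i)) x) b s = cup_wt (s i) (s i.+1) * kernel x b (del i s).
Proof. by rewrite !op_kernel op_comp op_cup. Qed.

Lemma cup_wt0 b : cup_wt b b = 0. Proof. by case: b. Qed.

Lemma kernel_compcup n m (i : 'I_n.+1) (x : QTL n.+2 m) b s :
  kernel (compQ x (basisQ (cupTL i))) b s =
  \sum_(c : bool) cup_wt c (~~ c) * kernel x (ins i c b) s.
Proof.
rewrite op_kernel op_comp op_cup opE.
pose g u := kernel x u s * (cup_wt (u i) (u i.+1) * \prod_(j < n) (del i u j == b j)%:R).
have le_in : (i <= n)%N by rewrite -ltnS.
transitivity (sum_bits (iota 0 n.+2) g (fun=> false)).
  apply: (@eq_sum_bits _ (iota 0 n.+2)) => u; rewrite /Cup /g /splice.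
  rewrite !ltnS le_in (leqW le_in); congr (_ * (_ * _)); apply: eq_bigr => j _.
  have jn := ltn_ord j; rewrite /del; case: (ltnP j i) => ji; last by rewrite !ltnS jn.
  by rewrite ltnW // ltnW // !ltnS.
rewrite (sum_bits_ins (i := i) _ b le_in); last 2 first.
- by move=> u e; rewrite /g e cup_wt0 mul0r mulr0.
- move=> u u' h; rewrite /g (@eq_kernel _ _ x u u' s s) // !h ?ltnS ?leqW //; congr (_ * (_ * _)).
  apply: eq_bigr => j _; rewrite /del h //; have := ltn_ord j; case: (ltnP j i) => // _ jn.
  by rewrite ltnW // ltnW // !ltnS.
transitivity (sum_bits (iota 0 n) (fun u => (\prod_(j < n) (u j == b j)%:R) *
   \sum_(c : bool) cup_wt c (~~ c) * kernel x (ins i c u) s) b).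
  apply: (@eq_sum_bits _ (iota 0 n)) => u; rewrite big_distrr; apply: eq_bigr => c _.
  rewrite /g ins_left ins_right del_ins /=.
  by rewrite mulrC mulrAC [RHS]mulrC.
rewrite sum_bits_delta_ord; apply: eq_bigr => c _; congr (_ * kernel x (ins i c _) s).
by apply: funext => j; case: ifP.
Qed.

(** The two ends of a cup carry opposite spins, so their closing weights cancel; this is what makes
    [S3] cyclic with respect to cups. *)
Lemma close_wtN c : close_wt c * close_wt (~~ c) = 1.
Proof. by have q0 := q_neq0; case: c; rewrite /close_wt /= mulrNN ?mulVf ?mulfV. Qed.

Lemma prod_close_ins n i c b : (i <= n)%N ->
  \prod_(j < n.+2) close_wt (ins i c b j) = \prod_(j < n) close_wt (b j).
Proof.
move=> le_in; rewrite (prod_iota n.+2 (fun j => close_wt (ins i c b j))).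
rewrite (perm_big _ (perm_skip le_in)) big_cat !big_cons big_nil big_map /= ins_left ins_right.
rewrite mulr1 [X in _ * X]mulrC close_wtN mulr1 (prod_iota n (fun j => close_wt (b j))).
apply: eq_bigr => j _; congr close_wt; rewrite /ins /skip; case: (ltnP j i) => h; first by rewrite h.
by rewrite ltnNge leqW ?leqW // !gtn_eqF ?ltnS ?leqW.
Qed.

Lemma S3_cup n (i : 'I_n.+1) (x : QTL n.+2 n) :
  S3 (compQ (basisQ (cupTL i)) x) = S3 (compQ x (basisQ (cupTL i))).
Proof.
have le_in : (i <= n)%N by rewrite -ltnS.
rewrite (S3E _ (fun=> false)) (S3E (compQ x _) (fun=> false)).
rewrite (sum_bits_ins (i := i) _ (fun=> false) le_in); last 2 first.
- by move=> u e; rewrite kernel_cup e cup_wt0 mul0r mulr0.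
- move=> u u' h; congr (_ * _); first by apply: eq_bigr => j _; rewrite h.
  exact: eq_kernel.
apply: (@eq_sum_bits _ (iota 0 n)) => b; rewrite kernel_compcup big_distrr; apply: eq_bigr => c _.
by rewrite prod_close_ins // kernel_cup ins_left ins_right del_ins.
Qed.

(** A cup and a cap at [n] close the last strand of [x] on its right; the closing weight appears as
    [cap_wt b * cup_wt b (~~ b)]. *)
Lemma kernel_strand n (x : QTL n.+1 n.+1) (c : nat -> bool) :
  Cap n (op x (Cup n (fun t => \prod_(i < n) (t i == c i)%:R))) c =
  \sum_(b : bool) close_wt b * kernel x (upd c n b) (upd c n b).
Proof.
apply: eq_bigr => b _; set F := Cup n _; set s := ins n b c.
have -> : op x F s = cup_wt b (~~ b) * kernel x (upd c n b) s.
  rewrite op_kernel !opE -sum_bitsZ.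
  apply: (@eq_sum_bits _ (iota 0 n.+1)) => u; rewrite [RHS]mulrCA; congr (_ * _).
  rewrite /F /Cup {1 2}/splice ltnSn ltnn subnn add0n.
  have -> : s n.+1 = ~~ b by exact: ins_right.
  rewrite [X in _ = _ * X]big_ord_recr /= [X in _ = _ * (_ * X)](_ : _ = (u n == b)%:R); last first.
    by rewrite /splice ltnSn /upd eqxx.
  have -> : \prod_(i < n) (del n (splice n.+1 n.+1 u s) i == c i)%:R =
            \prod_(i < n) (splice n.+1 n.+1 u s i == upd c n b i)%:R :> K.
    by apply: eq_bigr => i _; rewrite /del ltn_ord /upd ltn_eqF.
  rewrite [X in _ = _ * X]mulrC mulrA; congr (_ * _).
  by case: (u n); case: (b); rewrite /= ?mulr0 ?mulr1.
rewrite mulrA; congr (_ * _); first by case: b @s => s; rewrite /= ?mulr1 ?mul1r.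
apply: eq_kernel => // j; rewrite ltnS => jn; rewrite /s /ins /upd.
by case: ltngtP jn.
Qed.

Lemma S3_strand n (x : QTL n.+1 n.+1) (y : QTL n n) c :
  (forall v, Cap n (op x (Cup n v)) = c *: op y v) -> S3 x = c * S3 y.
Proof.
move=> h; rewrite (S3E _ (fun=> false)) (S3E y (fun=> false)) -sum_bitsZ.
have p : perm_eq (iota 0 n.+1) (n :: iota 0 n) by rewrite -addn1 iotaD perm_catC.
rewrite (perm_sum_bits _ p).
apply: (@eq_sum_bits _ (iota 0 n)) => b; rewrite mulrCA.
transitivity ((\prod_(i < n) close_wt (b i)) *
  \sum_(d : bool) close_wt d * kernel x (upd b n d) (upd b n d)).
  rewrite big_distrr; apply: eq_bigr => d _; rewrite big_ord_recr /= mulrA; congr (_ * _ * _).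
    by apply: eq_bigr => i _; rewrite /upd ltn_eqF.
  by rewrite /upd eqxx.
congr (_ * _); rewrite -kernel_strand h op_kernel; exact: erefl.
Qed.

(** * Traces *)

Lemma op0 m n v : op (0 : QTL m n) v = 0.
Proof. by rewrite -(scale0r (0 : QTL m n)) op_scalel scale0r. Qed.

Lemma compQA m n p r (x : QTL p r) (y : QTL n p) (z : QTL m n) :
  compQ x (compQ y z) = compQ (compQ x y) z.
Proof. by apply: op_inj => v; rewrite !op_comp. Qed.

Section CompLinear.
Variables m n p : nat.

Lemma compQDl (x x' : QTL n p) (y : QTL m n) : compQ (x + x') y = compQ x y + compQ x' y.
Proof. by apply: op_inj => v; rewrite op_addl !op_comp op_addl. Qed.

Lemma compQDr (x : QTL n p) (y y' : QTL m n) : compQ x (y + y') = compQ x y + compQ x y'.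
Proof. by apply: op_inj => v; rewrite op_addl !op_comp op_addl opD. Qed.

Lemma compQZl c (x : QTL n p) (y : QTL m n) : compQ (c *: x) y = c *: compQ x y.
Proof. by apply: op_inj => v; rewrite op_scalel !op_comp op_scalel. Qed.

Lemma compQZr c (x : QTL n p) (y : QTL m n) : compQ x (c *: y) = c *: compQ x y.
Proof. by apply: op_inj => v; rewrite op_scalel !op_comp op_scalel opZ. Qed.

Lemma compQ0l (y : QTL m n) : compQ (0 : QTL n p) y = 0.
Proof. by apply: op_inj => v; rewrite op_comp !op0. Qed.

Lemma compQ0r (x : QTL n p) : compQ x (0 : QTL m n) = 0.
Proof. by rewrite -(scale0r (0 : QTL m n)) compQZr !scale0r. Qed.

Lemma compQ_suml I r (P : pred I) (F : I -> QTL n p) (y : QTL m n) :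
  compQ (\sum_(i <- r | P i) F i) y = \sum_(i <- r | P i) compQ (F i) y.
Proof. exact: (big_morph (fun x => compQ x y) (fun a b => compQDl a b y) (compQ0l y)). Qed.

Lemma compQ_sumr I r (P : pred I) (F : I -> QTL m n) (x : QTL n p) :
  compQ x (\sum_(i <- r | P i) F i) = \sum_(i <- r | P i) compQ x (F i).
Proof. exact: (big_morph (compQ x) (compQDr x) (compQ0r x)). Qed.

End CompLinear.

Lemma comp_idl m n (x : QTL m n) : compQ (idQ n) x = x.
Proof. by apply: op_inj => v; rewrite op_comp op_id. Qed.

Lemma coordQ0 m n (l : TL m n) : coordQ 0 l = 0.
Proof. by rewrite /coordQ ffunE. Qed.

Lemma coordQ_sum m n I r (P : pred I) (F : I -> QTL m n) l :
  coordQ (\sum_(i <- r | P i) F i) l = \sum_(i <- r | P i) coordQ (F i) l.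
Proof.
exact: (big_morph (fun x : QTL m n => coordQ x l) (fun a b => coordQD a b l) (coordQ0 l)).
Qed.

Lemma coordQ_basis m n (l l' : TL m n) : coordQ (basisQ l) l' = (l' == l)%:R.
Proof. by rewrite /coordQ ffunE. Qed.

Lemma basis_expansion m n (x : QTL m n) : x = \sum_l coordQ x l *: basisQ l.
Proof.
apply/ffunP => l; rewrite -!/(coordQ _ l) coordQ_sum (bigD1 l) //= big1 => [|l' nl].
  by rewrite coordQZ coordQ_basis eqxx mulr1 addr0.
by rewrite coordQZ coordQ_basis eq_sym (negbTE nl) mulr0.
Qed.

Lemma comp_basis m n p (l2 : TL n p) (l1 : TL m n) : exists l : TL m p,
  compQ (basisQ l2) (basisQ l1) = delta ^+ circles l2 l1 *: basisQ l.
Proof.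
have [l [_ _ h]] := op_of_TL_comp l2 l1; exists l.
apply: op_inj => v; rewrite op_comp op_scalel !op_basis; apply: funext => s; exact: h.
Qed.

Lemma S3D n (x y : QTL n n) : S3 (x + y) = S3 x + S3 y.
Proof. by rewrite -big_split; apply: eq_bigr => l _; rewrite coordQD mulrDl. Qed.

Lemma S3Z n c (x : QTL n n) : S3 (c *: x) = c * S3 x.
Proof. by rewrite big_distrr; apply: eq_bigr => l _; rewrite coordQZ -mulrA. Qed.

Lemma S3_0 n : S3 (0 : QTL n n) = 0.
Proof. by rewrite -(scale0r (0 : QTL n n)) S3Z mul0r. Qed.

Lemma S3_sum n I r (P : pred I) (F : I -> QTL n n) :
  S3 (\sum_(i <- r | P i) F i) = \sum_(i <- r | P i) S3 (F i).
Proof. exact: (big_morph (@S3 n) (@S3D n) (S3_0 n)). Qed.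

Lemma TL00 (l : TL 0 0) : l = idTL 0.
Proof. by apply: val_inj; apply/ffunP => -[] []. Qed.

Lemma S3_scalar (x : QTL 0 0) : S3 x = scalarQ x.
Proof.
rewrite /S3 (bigD1 (idTL 0)) //= big1 => [|l]; last by rewrite (TL00 l) eqxx.
rewrite addr0 [closure_circles _](_ : _ = 0%N) ?mulr1 //.
by apply: eq_card0 => -[] [].
Qed.

Lemma S3_encircle N k : S3 (encircle N k) = dq k.+1 / dq 1 * ring_scalar qhalf k ^+ N.
Proof.
elim: N => [|N IH].
  have -> : encircle 0 k = (dq k.+1 / dq 1) *: idQ 0.
    by apply: op_inj => v; rewrite op_encircle op_scalel op_id Encircling0.
  by rewrite S3Z S3_scalar /scalarQ coordQ_basis eqxx expr0.
rewrite (@S3_strand N _ (encircle N k) (ring_scalar qhalf k)) => [|v].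
  by rewrite IH exprS mulrCA.
by rewrite !op_encircle Encircling_last.
Qed.

Lemma encircle_cup N k (i : 'I_N.+1) :
  compQ (encircle N.+2 k) (basisQ (cupTL i)) = compQ (basisQ (cupTL i)) (encircle N k).
Proof.
apply: op_inj => v; rewrite [LHS]op_comp [RHS]op_comp !op_cup !op_encircle; apply: Encircling_cup.
by rewrite -ltnS.
Qed.

Lemma top_cup_factor m n (l : TL m n.+2) (i : 'I_n.+1) : l (inr (cup_left i)) = inr (cup_right i) ->
  basisQ l = delta^-1 *: compQ (basisQ (cupTL i)) (compQ (basisQ (capTL i)) (basisQ l)).
Proof.
move=> h; apply: op_inj => v; rewrite op_scalel !op_comp op_cup op_cap op_basis.
exact: (op_of_TL_cup v h (cup_rightE i)).
Qed.

(** A functional on the spaces [QTL n n] which is cyclic with respect to cups is determined by its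
    values at the identity tangles. *)
Definition cup_trace (T : forall n, QTL n n -> K) :=
  [/\ forall n (x y : QTL n n), T n (x + y) = T n x + T n y,
      forall n c (x : QTL n n), T n (c *: x) = c * T n x
    & forall n (i : 'I_n.+1) (x : QTL n.+2 n),
        T n.+2 (compQ (basisQ (cupTL i)) x) = T n (compQ x (basisQ (cupTL i)))].

Lemma top_cup_ord m n (l : TL m n.+2) (i j : 'I_n.+2) : l (inr i) = inr j -> j = i.+1 :> nat ->
  exists i0 : 'I_n.+1, l (inr (cup_left i0)) = inr (cup_right i0).
Proof.
move=> lij ji; have hi : (i < n.+1)%N by have := ltn_ord j; rewrite ji ltnS.
exists (Ordinal hi); have -> : cup_left (Ordinal hi) = i by exact: val_inj.
by rewrite lij; congr inr; apply: val_inj; exact: etrans ji (esym (cup_rightE (Ordinal hi))).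
Qed.

(** A top cup of [l] is split off at the cost of [delta^-1] and moved to the bottom by cyclicity.
    The remaining tangle and the coefficient do not depend on [T], so that two functionals can be
    reduced in parallel. *)
Lemma cup_trace_reduce n (l : TL n n) : l != idTL n ->
  exists m c (l' : TL m m), n = m.+2 /\
    forall T, cup_trace T -> T n (basisQ l) = delta ^+ c / delta * T m (basisQ l').
Proof.
move=> /top_cup; case: n l => [|[|n]] l [i [j [lij ji]]].
- by have := ltn_ord i.
- by have := ltn_ord j; rewrite ji.
have [i0 top] := top_cup_ord lij ji.
have [l1 e1] := comp_basis (capTL i0) l.
have [l2 e2] := comp_basis l1 (cupTL i0).
exists n, (circles (capTL i0) l + circles l1 (cupTL i0))%N, l2; split=> // T [_ TZ Tcup].
rewrite {1}(top_cup_factor top) TZ Tcup e1 compQZl TZ e2 TZ exprD.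
by rewrite !mulrA; congr (_ * _); rewrite [RHS]mulrC mulrA.
Qed.

Definition action_trace n (x : QTL n n) : K :=
  \sum_(l : TL 0 n) coordQ (compQ x (basisQ l)) l.

Lemma action_traceC m n (x : QTL m n) (y : QTL n m) :
  action_trace (compQ x y) = action_trace (compQ y x).
Proof.
have E p r (a : QTL p r) (b : QTL r p) : action_trace (compQ a b) =
    \sum_(l : TL 0 r) \sum_(l' : TL 0 p) coordQ (compQ b (basisQ l)) l' * coordQ (compQ a (basisQ l')) l.
  apply: eq_bigr => l _; rewrite -compQA {1}[compQ b _]basis_expansion compQ_sumr coordQ_sum.
  by apply: eq_bigr => l' _; rewrite compQZr coordQZ.
rewrite !E exchange_big; apply: eq_bigr => l' _; apply: eq_bigr => l _; exact: mulrC.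
Qed.

Lemma cup_trace_action : cup_trace action_trace.
Proof.
split=> [n x y|n c x|n i x]; last exact: action_traceC.
  by rewrite -big_split; apply: eq_bigr => l _; rewrite compQDl coordQD.
by rewrite /action_trace big_distrr; apply: eq_bigr => l _; rewrite compQZl coordQZ.
Qed.

Lemma cup_trace_expansion T n (x : QTL n n) : cup_trace T ->
  T n x = \sum_l coordQ x l * T n (basisQ l).
Proof.
move=> [TD TZ _]; have T0 : T n 0 = 0 by rewrite -(scale0r (0 : QTL n n)) TZ mul0r.
rewrite {1}[x]basis_expansion (big_morph (T n) (TD n) T0).
by apply: eq_bigr => l _; rewrite TZ.
Qed.

Lemma action_trace_id n : action_trace (idQ n) = #|{: TL 0 n}|%:R.
Proof.
rewrite /action_trace (eq_bigr (fun=> 1)) => [|l _].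
  by rewrite big_const iter_addr_0.
by rewrite comp_idl coordQ_basis eqxx.
Qed.

Lemma cup_trace_encircle k : cup_trace (fun n x => S3 (compQ x (encircle n k))).
Proof.
split=> [n x y|n c x|n i x]; [by rewrite compQDl S3D|by rewrite compQZl S3Z|].
by rewrite -[X in S3 X = _]compQA S3_cup -[X in S3 X = _]compQA -[X in _ = S3 X]compQA encircle_cup.
Qed.

Lemma scalar_mult (x : QTL 0 0) : x = scalarQ x *: idQ 0.
Proof.
rewrite {1}[x]basis_expansion (bigD1 (idTL 0)) //= big1 ?addr0 // => l.
by rewrite (TL00 l) eqxx.
Qed.

(** Each cup of [x] is carried round the closure to [y], which lowers [N] by 2. *)
Lemma S3_comm N (x : QTL 0 N) (y : QTL N 0) : S3 (compQ x y) = scalarQ (compQ y x).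
Proof.
have [d] := ubnP N; elim: d N x y => // d IH [|N] x y Nd.
  rewrite -S3_scalar [x]scalar_mult [y]scalar_mult.
  have E (a b : K) : compQ (a *: idQ 0) (b *: idQ 0) = (a * b) *: compQ (idQ 0) (idQ 0).
    by rewrite compQZl compQZr scalerA.
  apply: etrans (congr1 (@S3 0) (E _ _)) (etrans _ (esym (congr1 (@S3 0) (E _ _)))).
  exact: (congr1 (fun c : K => S3 (c *: _)) (mulrC _ _)).
rewrite [x]basis_expansion compQ_suml compQ_sumr S3_sum /scalarQ coordQ_sum.
apply: eq_bigr => l _; rewrite compQZl compQZr S3Z coordQZ; congr (_ * _) => {x}.
have [i [j [lij ji]]] := top_cup0 l (ltn0Sn N).
case: N l y i j Nd lij ji => [|N] l y i j Nd lij ji; first by move: (ltn_ord j); rewrite ji.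
have [i0 top] := top_cup_ord lij ji.
rewrite (top_cup_factor top) compQZl compQZr S3Z coordQZ; congr (_ * _).
rewrite -compQA S3_cup -compQA IH; last by rewrite -ltnS ltnW.
by rewrite -compQA.
Qed.

Lemma scalar_pairing N (a : TL N 0) (b : TL 0 N) :
  scalarQ (compQ (basisQ a) (basisQ b)) = delta ^+ circles a b.
Proof.
have coord1 (m n : nat) (l : TL m n) : coordQ (basisQ l) l = 1 by rewrite coordQ_basis eqxx.
have coord0 (m n : nat) (l l' : TL m n) : l' != l -> coordQ (basisQ l) l' = 0.
  by move=> nl; rewrite coordQ_basis (negbTE nl).
rewrite /scalarQ {1}/coordQ ffunE (bigD1 a) //= [X in _ + X]big1 => [|a' na]; last first.
  by apply: big1 => b' _; rewrite coord0 // mulr0 mul0r.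
rewrite addr0 (bigD1 b) /=; last by apply/forallP => -[] [].
rewrite big1 => [|b' /andP[_ nb]]; last by rewrite (coord0 _ _ _ _ nb) mulr0.
by rewrite addr0 !coord1; apply: etrans (mulr1 _) (mulr1 _).
Qed.

(** The stacking has endpoints at the middle level only, and both sides glue the same two matchings
    of it. *)
Lemma dual_pairing N (a b : TL 0 N) : circles (dualTL a) b = circles (dualTL b) a.
Proof.
have E : Defs.glue (dualTL a) b =2 Defs.glue (dualTL b) a.
  move=> u v; rewrite /Defs.glue orbC.
  have swap (c : TL 0 N) : [exists e, (u == upper 0 e) && (v == upper 0 (dualTL c e))] =
      [exists e, (u == lower 0 e) && (v == lower 0 (c e))].
    apply/existsP/existsP => -[e he]; exists (flip_end e); move: he.
      by rewrite dualTLE; case: e => [i|[]//] /=; case: (c (inr i)) => [[]//|j].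
    by rewrite dualTLE; case: e => [[]//|i] /=; case: (c (inr i)) => [[]//|j].
  by rewrite !swap.
rewrite /circles (eq_n_comp (eq_connect E)); apply: eq_n_comp_r => z.
rewrite !inE; congr (~~ _).
by apply/existsP/existsP => -[[[]|[]]].
Qed.

Lemma dualTLK m n (l : TL m n) : dualTL (dualTL l) = l.
Proof. by apply: val_inj; apply/ffunP => e; rewrite !dualTLE !flipK. Qed.

(** A vector killed by all caps is fixed by the Jones-Wenzl idempotent, which kills every element of
    [QTL 0 N] when [0 < N]. *)
Lemma pairing_nondegenerate N (x : QTL 0 N) :
  (forall a : TL N 0, scalarQ (compQ (basisQ a) x) = 0) -> x = 0.
Proof.
have [d] := ubnP N; elim: d N x => // d IH [|N] x Nd h.
  by rewrite [x]scalar_mult -(comp_idl x) h scale0r.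
have kill (y : QTL N.+1 0) : scalarQ (compQ y x) = 0.
  rewrite [y]basis_expansion compQ_suml /scalarQ coordQ_sum big1 // => a _.
  by rewrite compQZl coordQZ -/(scalarQ _) h mulr0.
(* Capping [x] gives an element with two strands fewer that still pairs to zero with everything,
   hence vanishes by induction. *)
have Cap0 v i : (i.+1 < N.+1)%N -> Cap i (op x v) = 0.
  case: N x kill Nd {h} => [//|N] x kill Nd iN.
  rewrite -[Cap i]/(Cap (Ordinal (iN : (i < N.+1)%N))) -op_cap -op_comp.
  rewrite [compQ _ x](_ : _ = 0) ?op0 //; apply: IH => [|a]; first by rewrite -ltnS ltnW.
  by rewrite compQA kill.
apply: op_inj => v; rewrite op0 -(@Wenzl_id N.+1 (op x v)); last exact: Cap0.
rewrite op_sum; elim/big_ind: _ => [|u w hu hw|l _].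
- by rewrite -(scale0r (0 : Vec)) WenzlZ !scale0r.
- by rewrite WenzlD hu hw addr0.
have [i [j [lij ji]]] := top_cup0 l (ltn0Sn N).
by rewrite (op_of_TL_cup v lij ji) !WenzlZ Wenzl_Cup ?scaler0 // -ji ltn_ord.
Qed.

(** * The Gram matrix and its inverse *)

Section Gram.
Variable n : nat.

Lemma gramE i j : gram n i j =
  scalarQ (compQ (basisQ (dualTL (enum_val i : crossingless n))) (basisQ (enum_val j : crossingless n))).
Proof. by rewrite mxE. Qed.

Lemma gram_sym i j : gram n i j = gram n j i.
Proof. by rewrite !gramE !scalar_pairing dual_pairing. Qed.

Lemma gram_unit : gram n \in unitmx.
Proof.
rewrite -row_free_unit; apply: inj_row_free => v v0.
(* A row vector killed by the Gram matrix is a combination of matchings pairing to zero with every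
   [TL] tangle to 0 points, since each of these is a dual. *)
pose x : QTL 0 (2 * n) := \sum_j v ord0 j *: basisQ (enum_val j : crossingless n).
have x0 : x = 0.
  apply: pairing_nondegenerate => a.
  have := congr1 (fun w : 'rV_ _ => w ord0 (enum_rank (dualTL a : crossingless n))) v0.
  rewrite !mxE; apply: etrans; rewrite compQ_sumr /scalarQ coordQ_sum; apply: eq_bigr => j _.
  by rewrite compQZr coordQZ gram_sym gramE enum_rankK dualTLK.
apply/rowP => j; have := congr1 (fun y => coordQ y (enum_val j)) x0.
rewrite coordQ_sum coordQ0 mxE; apply: etrans; rewrite (bigD1 j) //= big1 => [|i ij].
  by rewrite coordQZ coordQ_basis eqxx mulr1 addr0.
by rewrite coordQZ coordQ_basis (inj_eq enum_val_inj) eq_sym (negbTE ij) mulr0.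
Qed.

Let sum_enum (F : crossingless n -> K) : \sum_l F l = \sum_(i < #|crossingless n|) F (enum_val i).
Proof. exact: (big_enum_val F). Qed.

Lemma S3_P2n0 (x : QTL (2 * n) (2 * n)) : S3 (compQ (P2n0 n) x) = action_trace x.
Proof.
rewrite compQ_suml S3_sum; under eq_bigr do rewrite compQ_suml S3_sum.
rewrite exchange_big /action_trace (sum_enum (fun l => coordQ (compQ x (basisQ l)) l)).
apply: eq_bigr => j _; set b : QTL 0 (2 * n) := basisQ _; set c := coordQ (compQ x b).
transitivity (\sum_i invmx (gram n) i j * \sum_k c (enum_val k) * gram n i k).
  apply: eq_bigr => i _; rewrite compQZl S3Z; congr (_ * _).
  rewrite -compQA S3_comm -compQA [compQ x b]basis_expansion compQ_sumr /scalarQ coordQ_sum sum_enum.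
  by apply: eq_bigr => k _; rewrite compQZr coordQZ -/(scalarQ _) gramE.
transitivity (\sum_k c (enum_val k) * \sum_i gram n k i * invmx (gram n) i j).
  under eq_bigr do rewrite big_distrr; rewrite exchange_big; apply: eq_bigr => k _.
  rewrite big_distrr; apply: eq_bigr => i _.
  rewrite [in RHS]gram_sym [gram n i k * _]mulrC; exact: mulrCA.
transitivity (\sum_k c (enum_val k) * (1%:M : 'M[K]_#|crossingless n|) k j).
  by apply: eq_bigr => k _; rewrite -(mulmxV gram_unit) mxE.
rewrite (bigD1 j) //= big1 => [|k kj]; last by rewrite mxE (negbTE kj) mulr0.
by rewrite mxE eqxx mulr1 addr0.
Qed.

End Gram.

(** * Values at a point *)

Local Notation tofrac := (@FracField.tofrac {poly rat}).

Lemma frac_repr (f : K) : f * tofrac (frac (repr f)).2 = tofrac (frac (repr f)).1.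
Proof.
set x := repr f; rewrite -[f in LHS]reprK -/x.
apply/eqP; rewrite !piE /equivf /FracField.mulf.
rewrite !numden_Ratio ?mulr1 ?oner_eq0 ?denom_ratioP //.
by rewrite mulrC.
Qed.

Section Evaluation.
Variables (C : numFieldType) (z : C).
Hypothesis z0 : z != 0.

Definition ev (p : {poly rat}) : C := (map_poly ratr p).[z].

Lemma evM p1 p2 : ev (p1 * p2) = ev p1 * ev p2.
Proof. by rewrite /ev rmorphM hornerM. Qed.

Lemma evD p1 p2 : ev (p1 + p2) = ev p1 + ev p2.
Proof. by rewrite /ev rmorphD hornerD. Qed.

(** Any fraction whose denominator does not vanish at [z] may be used, so that this relation, unlike
    [eval_at], passes directly to sums and products. *)
Definition evals (f : K) (c : C) :=
  exists p d, [/\ ev d != 0, f * tofrac d = tofrac p & c = ev p / ev d].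

Lemma ev0 : ev 0 = 0.
Proof. by rewrite /ev rmorph0 horner0. Qed.

Lemma ev_neq0 p : ev p != 0 -> p != 0.
Proof. by apply: contra_neq => ->; exact: ev0. Qed.

(** The denominator in lowest terms divides [d], hence does not vanish at [z] either, and the two
    fractions agree by cross multiplication. *)
Lemma eval_at_evals f c : evals f c -> eval_at z f = c.
Proof.
move=> [p [d [d0 fd ->]]]; rewrite /eval_at.
set num := (frac (repr f)).1; set den := (frac (repr f)).2; set g := gcdp num den.
have den0 : den != 0 by exact: denom_ratioP.
have numE : num %/ g * g = num by rewrite divpK // dvdp_gcdl.
have denE : den %/ g * g = den by rewrite divpK // dvdp_gcdr.
have cross : num * d = p * den.
  apply/eqP; rewrite -tofrac_eq !tofracM -fd -frac_repr -/den; apply/eqP.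
  exact: mulrAC.
have g0 : g != 0 by rewrite gcdp_eq0 negb_and den0 orbT.
have {}cross : num %/ g * d = p * (den %/ g).
  by apply: (mulIf g0); rewrite mulrAC numE -mulrA denE.
have cop : coprimep (den %/ g) (num %/ g).
  by rewrite coprimep_sym coprimep_div_gcd // den0 orbT.
have : den %/ g %| d by rewrite -(Gauss_dvdpr _ cop) cross dvdp_mull.
move=> /dvdpP [e dE]; move: d0; rewrite dE evM mulf_eq0 negb_or => /andP[e0 d'0].
rewrite -!/(ev _); apply/eqP; rewrite eqr_div ?mulf_neq0 //; apply/eqP.
by rewrite -!evM -dE cross.
Qed.

Lemma evalsD f g a b : evals f a -> evals g b -> evals (f + g) (a + b).
Proof.
move=> [p [d [d0 fd ->]]] [p' [d' [d'0 gd' ->]]]; exists (p * d' + p' * d), (d * d'); split.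
- by rewrite evM mulf_neq0.
- rewrite tofracM tofracD !tofracM -fd -gd'; move: (tofrac d) (tofrac d'); clear; move=> x y.
  by rewrite mulrDl mulrA; congr (_ + _); rewrite [x * y]mulrC mulrA.
- by rewrite evD !evM addf_div.
Qed.

Lemma evalsM f g a b : evals f a -> evals g b -> evals (f * g) (a * b).
Proof.
move=> [p [d [d0 fd ->]]] [p' [d' [d'0 gd' ->]]]; exists (p * p'), (d * d'); split.
- by rewrite evM mulf_neq0.
- by rewrite !tofracM -fd -gd' mulrACA.
- by rewrite !evM mulf_div.
Qed.

Lemma evals_poly p : evals (tofrac p) (ev p).
Proof.
have e1 : ev 1 = 1 by rewrite /ev rmorph1 hornerC.
by exists p, 1; rewrite e1 divr1 tofrac1 mulr1 oner_eq0.
Qed.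

Lemma evals_nat n : evals n%:R n%:R.
Proof.
by have := evals_poly n%:R; rewrite /ev !rmorph_nat hornerMn hornerC.
Qed.

Lemma evals_qhalf : evals qhalf z.
Proof. by have := evals_poly 'X; rewrite /ev map_polyX hornerX. Qed.

Lemma evalsV f a : evals f a -> a != 0 -> evals f^-1 a^-1.
Proof.
move=> [p [d [d0 fd ->]]]; rewrite mulf_eq0 invr_eq0 negb_or => /andP[p0 _].
exists d, p; split=> //; last by rewrite invf_div.
rewrite -fd mulrA mulVf ?mul1r //; apply: contraNneq (ev_neq0 p0) => f0.
by rewrite -tofrac_eq0 -fd f0 mul0r.
Qed.

Lemma evalsN f a : evals f a -> evals (- f) (- a).
Proof.
move=> fa; have := evalsM (evals_poly (-1)) fa.
by rewrite /ev tofracN tofrac1 rmorphN rmorph1 hornerN hornerC !mulN1r.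
Qed.

Lemma evalsX f a n : evals f a -> evals (f ^+ n) (a ^+ n).
Proof.
move=> fa; elim: n => [|n IH]; first exact: (evals_nat 1).
by rewrite !exprS; exact: evalsM.
Qed.

Lemma evals_sum I (r : seq I) (P : pred I) (F : I -> K) (a : I -> C) :
  (forall i, P i -> evals (F i) (a i)) ->
  evals (\sum_(i <- r | P i) F i) (\sum_(i <- r | P i) a i).
Proof.
move=> h; elim/big_rec2: _ => [|i b f Pi fb]; first exact: (evals_nat 0).
by apply: evalsD => //; exact: h.
Qed.

Lemma evals_q : evals q (z ^+ 2).
Proof. exact: evalsX evals_qhalf. Qed.

Lemma evals_qV : evals q^-1 (z ^- 2).
Proof. by apply: evalsV evals_q _; rewrite expf_neq0. Qed.

Lemma evals_delta : evals delta (- (z ^+ 2 + z ^- 2)).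
Proof. exact: evalsN (evalsD evals_q evals_qV). Qed.

Definition regular (f : K) := exists c, evals f c.

Lemma regularD f g : regular f -> regular g -> regular (f + g).
Proof. by move=> [a fa] [b gb]; exists (a + b); exact: evalsD. Qed.

Lemma regularM f g : regular f -> regular g -> regular (f * g).
Proof. by move=> [a fa] [b gb]; exists (a * b); exact: evalsM. Qed.

Lemma regular_nat n : regular n%:R.
Proof. by exists n%:R; exact: evals_nat. Qed.

Lemma regular_sum I (r : seq I) (P : pred I) (F : I -> K) :
  (forall i, P i -> regular (F i)) -> regular (\sum_(i <- r | P i) F i).
Proof.
by move=> h; elim/big_ind: _ => //; [exact: (regular_nat 0)|exact: regularD].
Qed.

Definition regularQ m n (x : QTL m n) := forall l, regular (coordQ x l).

Lemma regularQ_basis m n (l : TL m n) : regularQ (basisQ l).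
Proof. by move=> l'; rewrite coordQ_basis; exact: regular_nat. Qed.

Lemma regularQ_comp m n p (x : QTL n p) (y : QTL m n) : regularQ x -> regularQ y -> regularQ (compQ x y).
Proof.
move=> hx hy l; rewrite /coordQ ffunE; apply: regular_sum => l2 _; apply: regular_sum => l1 _.
apply: regularM (hy _); apply: regularM (hx _).
by exists ((- (z ^+ 2 + z ^- 2)) ^+ circles l2 l1); apply: evalsX; exact: evals_delta.
Qed.

Lemma regularQ_bracket m n (t : tangle m n) : regularQ (bracket t).
Proof.
have rq : regular qhalf by exists z; exact: evals_qhalf.
have rqV : regular qhalf^-1 by exists z^-1; exact: evalsV evals_qhalf _.
have hookR (k : nat) (i : 'I_k.-1) : regularQ (hook i).
  case: k i => [|[|k]] i; try by case: i.
  by apply: regularQ_comp; exact: regularQ_basis.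
elim: t => {n} [|n i t IH|n i t IH|n s i t IH]; try by apply: regularQ_comp IH; exact: regularQ_basis.
  exact: regularQ_basis.
apply: regularQ_comp IH => l.
have [r1 r2] : regular (coordQ (idQ n) l) /\ regular (coordQ (hook i) l).
  by split; [exact: regularQ_basis|exact: hookR].
by case: s; rewrite coordQD !coordQZ; apply: regularD; exact: regularM.
Qed.

Definition same_value (f g : K) := exists2 c, evals f c & evals g c.

Lemma same_value_eval f g : same_value f g -> eval_at z f = eval_at z g.
Proof. by move=> [c fc gc]; rewrite (eval_at_evals fc) (eval_at_evals gc). Qed.

Lemma same_valueM h f g : regular h -> same_value f g -> same_value (h * f) (h * g).
Proof. by move=> [a ha] [c fc gc]; exists (a * c); exact: evalsM. Qed.

Lemma same_value_sum I (r : seq I) (P : pred I) (F G : I -> K) :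
  (forall i, P i -> same_value (F i) (G i)) ->
  same_value (\sum_(i <- r | P i) F i) (\sum_(i <- r | P i) G i).
Proof.
move=> h; elim/big_rec2: _ => [|i b f Pi [c fc bc]]; first by exists 0; exact: (evals_nat 0).
by have [a Fa Ga] := h i Pi; exists (a + c); exact: evalsD.
Qed.

End Evaluation.

(** Each reduction divides by [delta] and removes two strands, so it keeps the parity. With at most
    one strand nothing is reduced and [delta] may vanish, as it does at the root of unity for
    [r = 2]. *)
Lemma cup_trace_same_value (C : numFieldType) (z : C) (T U : forall n, QTL n n -> K) N :
  z != 0 -> cup_trace T -> cup_trace U -> ((1 < N)%N -> z ^+ 2 + z ^- 2 != 0) ->
  (forall n, (n <= N)%N -> ~~ odd n -> same_value z (T n (idQ n)) (U n (idQ n))) ->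
  ~~ odd N -> forall x : QTL N N, regularQ z x -> same_value z (T N x) (U N x).
Proof.
move=> z0 Ttr Utr dz id_same oddN x xR.
rewrite (cup_trace_expansion x Ttr) (cup_trace_expansion x Utr).
suff basis_same n (l : TL n n) : ~~ odd n -> (n <= N)%N ->
    same_value z (T n (basisQ l)) (U n (basisQ l)).
  by apply: same_value_sum => l _; apply: same_valueM; [exact: xR|exact: basis_same].
have [d] := ubnP n; elim: d n l => // d IH n l nd oddn nN.
have [-> |nl] := eqVneq l (idTL n); first exact: id_same.
have [m [c [l' [nE red]]]] := cup_trace_reduce nl.
rewrite !red //; apply: same_valueM.
  rewrite nE in nN; have dz0 := dz (leq_trans (isT : (1 < m.+2)%N) nN).
  exists ((- (z ^+ 2 + z ^- 2)) ^+ c / (- (z ^+ 2 + z ^- 2))).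
  apply: evalsM; first by apply: evalsX; exact: evals_delta.
  by apply: evalsV; [exact: evals_delta|rewrite oppr_eq0].
apply: IH; first by rewrite -ltnS (leq_trans _ nd) // nE ltnS leqW.
  by move: oddn; rewrite nE /= negbK.
by apply: leq_trans nN; rewrite nE; do 2!apply: leqW.
Qed.

Definition surgery_trace r n (x : QTL n n) : K :=
  - ((q - q^-1) / (2 * r)%N%:R) *
     \sum_(k < r.-1) (-1) ^+ k * (q ^+ k.+1 - q ^- k.+1) * S3 (compQ x (encircle n k)).

Lemma cup_trace_surgery r : cup_trace (surgery_trace r).
Proof.
split=> [n x y|n c x|n i x]; rewrite /surgery_trace.
- rewrite -mulrDr -big_split; congr (_ * _); apply: eq_bigr => k _ /=.
  by have [-> _ _] := cup_trace_encircle k; rewrite mulrDr.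
- rewrite [RHS]mulrCA; congr (_ * _); rewrite big_distrr; apply: eq_bigr => k _ /=.
  have [_ -> _] := cup_trace_encircle k; exact: mulrCA.
- by congr (_ * _); apply: eq_bigr => k _ /=; have [_ _ ->] := cup_trace_encircle k.
Qed.

(** The prefactor [q - q^-1] cancels the denominator [dq 1] of the trace of the idempotent, and the
    two signs depending on [k] cancel each other. *)
Lemma surgery_trace_id r n : surgery_trace r (idQ n) =
  - ((2 * r)%N%:R^-1 * \sum_(k < r.-1) (q ^+ k.+1 - q ^- k.+1) ^+ 2 * (- (q ^+ k.+1 + q ^- k.+1)) ^+ n).
Proof.
rewrite /surgery_trace mulNr; congr (- _); rewrite big_distrr [RHS]big_distrr.
apply: eq_bigr => k _; rewrite comp_idl S3_encircle.
have -> : ring_scalar qhalf k = - (q ^+ k.+1 + q ^- k.+1) by [].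
have d1 := dq_neq0 0; rewrite /dq /signed_qint !expr1 mulN1r in d1 *.
have gen (F : fieldType) (w a b c s : F) : b != 0 -> s * s = 1 ->
    b * c * (s * a * (- s * a / - b * w)) = c * (a ^+ 2 * w).
  move=> b0 ss; rewrite -[RHS]mul1r -ss; field; rewrite oppr_eq0; exact: b0.
have -> : (-1) ^+ k.+1 = - (-1) ^+ k :> K by rewrite exprS mulN1r.
apply: gen; first by rewrite oppr_eq0 in d1.
by rewrite -expr2 sqrr_sign.
Qed.

(** * Counting crossingless matchings *)

(** The number of walks of [n] unit steps on the natural numbers from [h] to 0. *)
Fixpoint ballot n h : nat :=
  if n is n'.+1 then
    ballot n' h.+1 + (if h is h'.+1 then ballot n' h' else 0)
  else h == 0%N.

Section RootSums.
Variables (C : numFieldType) (w : C) (r : nat).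
Hypotheses (r1 : (1 < r)%N) (wr : w ^+ r = -1).
Hypothesis w_prim : forall a, (0 < a < 2 * r)%N -> w ^+ a != 1.

Let w0 : w != 0.
Proof.
apply: contra_eq_neq wr => ->; rewrite expr0n gtn_eqF ?(ltn_trans _ r1) //=.
by rewrite eq_sym oppr_eq0 oner_eq0.
Qed.

Lemma geometric_sum (y : C) k : y != 1 -> \sum_(j < k) y ^+ j.+1 = (y ^+ k.+1 - y) / (y - 1).
Proof.
rewrite -subr_eq0 => y1; elim: k => [|k IH]; first by rewrite big_ord0 expr1 subrr mul0r.
rewrite big_ord_recr /= IH [in RHS]exprS; field; exact: y1.
Qed.

Let x j := w ^+ j.+1.

Let x_neq0 j : x j != 0. Proof. exact: expf_neq0. Qed.

Definition cosine_sum a := \sum_(j < r.-1) (x j ^+ a + x j ^- a).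

(** Two geometric sums, in [y] and its inverse, with [y ^+ r = (-1) ^+ a]. *)
Lemma cosine_sumE a : (0 < a < 2 * r)%N -> cosine_sum a = - (1 + (-1) ^+ a).
Proof.
move=> ha; set y := w ^+ a; have y1 : y != 1 by exact: w_prim.
have y0 : y != 0 by exact: expf_neq0.
have yV1 : y^-1 != 1 by rewrite invr_eq1.
have yr : y ^+ r = (-1) ^+ a by rewrite /y exprAC wr.
have rK : r.-1.+1 = r by rewrite prednK // ltnW.
have -> : cosine_sum a = \sum_(j < r.-1) y ^+ j.+1 + \sum_(j < r.-1) y^-1 ^+ j.+1.
  rewrite -big_split; apply: eq_bigr => j _ /=.
  by rewrite /x /y exprVn -!exprM mulnC.
rewrite !geometric_sum // rK exprVn yr.
have eps : ((-1) ^+ a)^-1 = (-1) ^+ a :> C by rewrite invr_sign.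
rewrite eps; move: ((-1) ^+ a) => e; field.
by rewrite y0 mulN1r !subr_eq0 eq_sym y1.
Qed.

Lemma cosine_sum0 : cosine_sum 0 = 2 * r%:R - 2.
Proof.
rewrite /cosine_sum (eq_bigr (fun=> 2)) => [|j _]; last by rewrite expr0 invr1.
rewrite sumr_const card_ord -mulr_natr -(prednK (ltnW r1)) -[in RHS]natr1.
by rewrite -(prednK (ltnW r1)) /=; ring.
Qed.

(** At [w = exp(i pi / r)] this is the spectral formula for the walks from [h] to 0 on a path with
    [r - 1] vertices: sines are eigenvectors, [x j + (x j)^-1] are eigenvalues, and the minus sign
    comes from a product of two differences [2i sin]. *)
Definition walk_sum n h : C := - ((2 * r)%N%:R^-1 *
  \sum_(j < r.-1) (x j - (x j)^-1) * (x j ^+ h.+1 - x j ^- h.+1) * (x j + (x j)^-1) ^+ n).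

(** A walk from [h] to 0 in [n] steps rises to at most [(n + h) / 2], so the bound says that the
    upper end of the path, [r - 2], is never exceeded. *)
Lemma walk_sum_ballot n h : (n + h + 2 < 2 * r)%N -> walk_sum n h = (ballot n h)%:R.
Proof.
have r20 : (2 * r)%N%:R != 0 :> C by rewrite pnatr_eq0 muln_eq0 /= gtn_eqF // ltnW.
elim: n h => [|n IH] h hr.
  (* For [n = 0] the product of two sines becomes a difference of cosines: the two sums have equal
     values when [0 < h], and they differ by [2r] when [h = 0]. *)
  have -> : walk_sum 0 h = - ((2 * r)%N%:R^-1 * (cosine_sum h.+2 - cosine_sum h)).
    congr (- (_ * _)); rewrite -sumrB; apply: eq_bigr => j _.
    have := x_neq0 j; move: (x j) => y y0; rewrite expr0 mulr1 !exprS.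
    have := expf_neq0 h y0; move: (y ^+ h) => u u0; field.
    by rewrite y0 u0.
  case: h hr => [|h] hr.
    rewrite cosine_sum0 cosine_sumE ?sqrrN ?expr1n; last by lia.
    by rewrite natrM /=; rewrite natrM in r20; field; move: r20; rewrite mulf_eq0 negb_or => /andP[].
  rewrite !cosine_sumE; [|lia|lia].
  by rewrite -[h.+3]addn2 exprD sqrrN expr1n mulr1 subrr mulr0 oppr0.
have rec u : \sum_(j < r.-1) (x j - (x j)^-1) * (x j ^+ h.+1 - x j ^- h.+1) * (x j + (x j)^-1) ^+ n.+1 = u ->
   walk_sum n.+1 h = - ((2 * r)%N%:R^-1 * u) by move=> <-.
(* Multiplication by [x j + (x j)^-1] shifts [h] both ways; at [h = 0] the downward term is
   [x j ^+ 0 - x j ^- 0], which vanishes. *)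
case: h hr rec => [|h] hr rec /=.
  rewrite addn0 -IH; last by lia.
  apply: rec; apply: eq_bigr => j _; rewrite [_ ^+ n.+1]exprS.
  have := x_neq0 j; move: (x j) => y y0; move: (_ ^+ n) => u.
  by rewrite !expr2; field.
rewrite natrD -!IH; [|lia|lia].
rewrite /walk_sum -opprD -mulrDr; apply: rec; rewrite -big_split; apply: eq_bigr => j _ /=.
rewrite [_ ^+ n.+1]exprS; have := x_neq0 j; move: (x j) => y y0; move: (_ ^+ n) => u.
rewrite !exprS -!/(y ^+ _); have := expf_neq0 h y0; move: (y ^+ h) => v v0.
by field; rewrite y0 v0.
Qed.

End RootSums.

Fixpoint dyck h (s : seq bool) : bool :=
  match s, h with
  | [::], _ => h == 0%N
  | true :: s', _ => dyck h.+1 s'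
  | false :: s', h'.+1 => dyck h' s'
  | false :: _, 0%N => false
  end.

Fixpoint dyck_words n h : seq (seq bool) :=
  if n is n'.+1 then
    map (cons true) (dyck_words n' h.+1) ++
    (if h is h'.+1 then map (cons false) (dyck_words n' h') else [::])
  else if h == 0%N then [:: [::]] else [::].

Lemma size_dyck_words n h : size (dyck_words n h) = ballot n h.
Proof.
elim: n h => [|n IH] h /=; first by case: h.
by rewrite size_cat size_map IH; case: h => [|h] //=; rewrite size_map IH.
Qed.

Lemma mem_dyck_words n h s : (s \in dyck_words n h) = (size s == n) && dyck h s.
Proof.
have cons_mem b c (L : seq (seq bool)) s' : (b :: s' \in map (cons c) L) = (b == c) && (s' \in L).
  apply/mapP/andP => [[u uL [-> ->]]|[/eqP -> sL]]; first by rewrite eqxx.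
  by exists s'.
have nil_mem c (L : seq (seq bool)) : ([::] \in map (cons c) L) = false by apply/mapP => -[].
elim: n h s => [|n IH] h [|b s] /=; rewrite ?mem_cat.
- by case: h.
- by case: h => [|h] /=; rewrite ?inE.
- by rewrite nil_mem; case: h => [|h] /=; rewrite ?nil_mem.
rewrite cons_mem eqSS IH; case: h => [|h]; first by rewrite orbF; case: b; rewrite ?andbF.
by rewrite cons_mem IH; case: b; rewrite ?orbF.
Qed.

Lemma uniq_dyck_words n h : uniq (dyck_words n h).
Proof.
have cons_inj (c : bool) : injective (cons c) by move=> ? ? [].
elim: n h => [|n IH] h /=; first by case: ifP.
rewrite cat_uniq map_inj_uniq // IH /=; case: h => [|h] //=.
rewrite map_inj_uniq // IH andbT; apply/hasPn => _ /mapP[s _ ->].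
by apply/mapP => -[].
Qed.

Lemma dyck_insert h s1 s2 : dyck h (s1 ++ true :: false :: s2) = dyck h (s1 ++ s2).
Proof. by elim: s1 h => [//|[] s1 IH] [|h] /=. Qed.

Lemma dyck_peak h s : dyck h s -> s = nseq h false \/ exists s1 s2, s = s1 ++ true :: false :: s2.
Proof.
elim: s h => [|[] s IH] h; first by move=> /eqP ->; left.
- move=> /IH [->|[s1 [s2 ->]]]; right; first by exists [::], (nseq h false).
  by exists (true :: s1), s2.
- case: h => // h /IH [->|[s1 [s2 ->]]]; [by left|right].
  by exists (false :: s1), s2.
Qed.

(** Positions run along the top from right to left, so the left end of an arc is the one that is not
    an opener; it becomes an upward step of the word read from left to right. *)
Definition word n (l : TL 0 n) : seq bool := [seq ~~ opener l (inr j) | j <- enum 'I_n].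

Lemma size_word n (l : TL 0 n) : size (word l) = n.
Proof. by rewrite size_map size_enum_ord. Qed.

Lemma nth_word n (l : TL 0 n) (j : 'I_n) : nth false (word l) j = ~~ opener l (inr j).
Proof. by rewrite (nth_map j) ?size_enum_ord // nth_ord_enum. Qed.

Lemma word_inj n : injective (@word n).
Proof.
move=> l l' e; apply: opener_inj => -[[]//|j]; apply: negb_inj.
by rewrite -!nth_word e.
Qed.

Lemma inr_inj (A B : Type) (a b : B) : inr a = inr b :> A + B -> a = b.
Proof. by case. Qed.

Section Insert.
Variables (n : nat) (i : 'I_n.+1).

Lemma cup_end (k : 'I_n.+2) :
  [\/ k = cup_left i, k = cup_right i | exists j, k = cup_shift i j].
Proof.
case: (unliftP (cup_left i) k) => [k'|] ->; last by constructor 1.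
by case: (unliftP i k') => [j|] ->; [constructor 3; exists j|constructor 2].
Qed.

Lemma cup_shift_inj : injective (cup_shift i).
Proof. by move=> j k /lift_inj/lift_inj. Qed.

Lemma neq_lr : cup_left i != cup_right i.
Proof. exact: neq_lift. Qed.

Lemma lt_cup_shift j k : (cup_shift i j < cup_shift i k)%N = (j < k)%N.
Proof. by rewrite !cup_shiftE; case: (ltnP j i) => h1; case: (ltnP k i) => h2; lia. Qed.

Lemma lt_pos (m : nat) (j k : 'I_m) : (@pos 0 m (inr j) < @pos 0 m (inr k))%N = (k < j)%N.
Proof. by rewrite /=; have := ltn_ord j; have := ltn_ord k; clear; lia. Qed.

Definition inserted (l' : TL 0 n) (l : TL 0 n.+2) :=
  l (inr (cup_left i)) = inr (cup_right i) /\
  forall j k, l' (inr j) = inr k -> l (inr (cup_shift i j)) = inr (cup_shift i k).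

Lemma TL_top m (l : TL 0 m) j : exists k, l (inr j) = inr k.
Proof. by case: (l (inr j)) => [[]//|k]; exists k. Qed.

(** A cup between adjacent endpoints is a peak of the word, and the order of the ends of the other
    arcs is not affected by its insertion. *)
Lemma word_inserted l' l : inserted l' l ->
  word l = take i (word l') ++ true :: false :: drop i (word l').
Proof.
move=> [ll lshift]; have le_in : (i <= n)%N by rewrite -ltnS.
have size_t : size (take i (word l')) = i by rewrite size_takel // size_word.
apply: (@eq_from_nth _ false).
  by rewrite size_word size_cat size_t /= size_drop size_word !addnS subnKC.
move=> k; rewrite size_word => kn; rewrite -[k]/(nat_of_ord (Ordinal kn)) nth_word.
rewrite nth_cat size_t; case: (cup_end (Ordinal kn)) => [->|->|[j ->]].
- by rewrite /opener ll lt_pos /= ltnn subnn /bump leqnn ltnNge leqnSn.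
- have lr : l (inr (cup_right i)) = inr (cup_left i) by rewrite -ll TLK.
  by rewrite /opener lr lt_pos cup_rightE /= ltnSn ltnNge leqnSn subSnn.
have [m l'j] := TL_top l' j.
have -> : opener l (inr (cup_shift i j)) = opener l' (inr j).
  by rewrite /opener (lshift _ _ l'j) l'j !lt_pos lt_cup_shift.
rewrite -nth_word cup_shiftE; case: (ltnP j i) => ji.
  by rewrite ji nth_take.
have -> : (j.+2 < i)%N = false by apply/negbTE; rewrite -leqNgt ltnW // ltnW // ltnS.
have -> : (j.+2 - i)%N = (j - i).+2 by rewrite -!subSn // ltnW.
by rewrite /= nth_drop subnKC.
Qed.

Lemma insert_ex l' : exists l, inserted l' l.
Proof.
pose f (e : endpoint 0 n.+2) : endpoint 0 n.+2 :=
  match e with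
  | inl z => inl z
  | inr k => match cupTL i (inr k) with
             | inr k' => inr k'
             | inl j => match l' (inr j) with inr j' => inr (cup_shift i j') | inl z => inl z end
             end
  end.
have fl : f (inr (cup_left i)) = inr (cup_right i) by rewrite /f cupTL_left.
have fr : f (inr (cup_right i)) = inr (cup_left i) by rewrite /f cupTL_right.
have fs j k : l' (inr j) = inr k -> f (inr (cup_shift i j)) = inr (cup_shift i k).
  by rewrite /f cupTL_shift => ->.
have f_TL : is_TL [ffun e => f e].
  apply: is_TLP => [[[]//|k]|[[]//|k]|[[]//|k] [[]//|k']]; rewrite !ffunE.
  - case: (cup_end k) => [->|->|[j ->]]; rewrite ?fl ?fr.
    + by move=> h; have e := inr_inj h; have := neq_lr; rewrite -e eqxx.
    + by move=> h; have e := inr_inj h; have := neq_lr; rewrite e eqxx.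
    have [m e] := TL_top l' j; rewrite (fs _ _ e) => h; have jm := cup_shift_inj (inr_inj h).
    by have := TL_neq l' (inr j); rewrite e jm eqxx.
  - case: (cup_end k) => [->|->|[j ->]]; rewrite ?(fl, fr) //.
    have [m e] := TL_top l' j; rewrite (fs _ _ e) (fs m j) //.
    by rewrite -e TLK.
  have adj : (pos (inr (cup_left i) : endpoint 0 n.+2) = (pos (inr (cup_right i) : endpoint 0 n.+2)).+1)%N.
    by rewrite /= /bump leqnn; have := ltn_ord i; clear; lia.
  case: (cup_end k) => [->|->|[j ->]]; rewrite ?(fl, fr).
  + by move=> /ltnW h1 /(leq_ltn_trans h1); rewrite adj ltnNge leqnSn.
  + by rewrite adj ltnS => h1 /(leq_trans h1); rewrite ltnn.
  have [m e] := TL_top l' j; rewrite (fs _ _ e).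
  case: (cup_end k') => [->|->|[j' ->]]; rewrite ?(fl, fr).
  + by move=> _ h1 /(ltn_trans h1); rewrite adj ltnNge leqnSn.
  + by rewrite adj ltnS => _ h1 /(leq_trans h1); rewrite ltnn.
  have [m' e'] := TL_top l' j'; rewrite (fs _ _ e') !lt_pos !lt_cup_shift => h1 h2 h3.
  have := TLP l'; move=> /and3P[_ _ /forallP/(_ (inr j))/forallP/(_ (inr j'))/negP]; apply.
  by rewrite e e' !lt_pos h1 h2 h3.
exists (MkTL f_TL); split; first by rewrite /= ffunE.
by move=> j k e; rewrite /= ffunE; exact: fs.
Qed.

Lemma delete_ex (l : TL 0 n.+2) : l (inr (cup_left i)) = inr (cup_right i) ->
  exists l', inserted l' l.
Proof.
move=> ll; have lr : l (inr (cup_right i)) = inr (cup_left i) by rewrite -ll TLK.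
have ls j : exists k, l (inr (cup_shift i j)) = inr (cup_shift i k).
  have [k lk] := TL_top l (cup_shift i j).
  have lK : l (inr k) = inr (cup_shift i j) by rewrite -lk TLK.
  case: (cup_end k) lK lk => [->|->|[j' ->]]; rewrite ?(ll, lr); last by exists j'.
  - by move=> h; have e := lift_inj (inr_inj h); have := neq_lift i j; rewrite -e eqxx.
  - by move=> h; have e := inr_inj h; have := neq_lift (cup_left i) (lift i j); rewrite -[lift _ _]/(cup_shift i j) -e eqxx.
have [g lg] := boolp.choice ls.
have gK j : g (g j) = j.
  by apply: cup_shift_inj; apply: (@inr_inj 'I_0 'I_n.+2); rewrite -!lg TLK.
pose f (e : endpoint 0 n) : endpoint 0 n := match e with inl z => inl z | inr j => inr (g j) end.
have f_TL : is_TL [ffun e => f e].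
  apply: is_TLP => [[[]//|k]|[[]//|k]|[[]//|k] [[]//|k']]; rewrite !ffunE /f ?gK //.
    move=> h; have gk := inr_inj h; have := TL_neq l (inr (cup_shift i k)); by rewrite lg gk eqxx.
  rewrite !lt_pos => h1 h2 h3.
  have := TLP l; move=> /and3P[_ _ /forallP/(_ (inr (cup_shift i k)))/forallP/(_ (inr (cup_shift i k')))/negP].
  by apply; rewrite !lg !lt_pos !lt_cup_shift h1 h2 h3.
exists (MkTL f_TL); split=> // j k; rewrite /= ffunE => h; rewrite -(inr_inj h); exact: lg.
Qed.

End Insert.

Lemma dyck_word n (l : TL 0 n) : dyck 0 (word l).
Proof.
have [d] := ubnP n; elim: d n l => // d IH [|n] l nd.
  by rewrite (_ : word l = [::]) //; apply: size0nil; rewrite size_word.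
have [i [j [lij ji]]] := top_cup0 l (ltn0Sn n).
case: n l i j lij ji nd => [|n] l i j lij ji nd; first by have := ltn_ord j; rewrite ji.
have [i0 top] := top_cup_ord lij ji; have [l' ins] := delete_ex top.
rewrite (word_inserted ins) dyck_insert cat_take_drop IH //.
by rewrite -ltnS ltnW.
Qed.

(** Removing a peak from the word corresponds to removing a cup from the matching, so the matching
    is rebuilt by inserting one cup per peak. *)
Lemma word_surj n s : size s = n -> dyck 0 s -> exists l : TL 0 n, word l = s.
Proof.
have [d] := ubnP n; elim: d n s => // d IH n s nd sn ds.
have [s0|[s1 [s2 sE]]] := dyck_peak ds.
  rewrite s0 in sn *; case: n / sn nd => _; exists (idTL 0).
  by apply: size0nil; rewrite size_word.
have nE : n = (size s1 + size s2).+2 by rewrite -sn sE size_cat /= !addnS.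
rewrite {}nE in nd sn *.
have [|||l' wl'] := IH (size s1 + size s2)%N (s1 ++ s2).
- by rewrite -ltnS ltnW.
- by rewrite size_cat.
- by rewrite -dyck_insert -sE.
have hi : (size s1 < (size s1 + size s2).+1)%N by rewrite ltnS leq_addr.
have [l ins] := insert_ex (Ordinal hi) l'; exists l.
by rewrite (word_inserted ins) wl' /= take_size_cat // drop_size_cat // sE.
Qed.

Lemma card_TL_ballot n : #|{: TL 0 n}| = ballot n 0.
Proof.
rewrite -size_dyck_words cardE -(size_map (@word n)); apply/perm_size/uniq_perm.
- by rewrite map_inj_uniq ?enum_uniq //; exact: word_inj.
- exact: uniq_dyck_words.
move=> s; rewrite mem_dyck_words; apply/mapP/andP => [[l _ ->]|[/eqP sn ds]].
  by rewrite size_word eqxx dyck_word.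
by have [l <-] := word_surj sn ds; exists l; rewrite ?mem_enum.
Qed.

(** * The root of unity *)

Section Zeta.
Variables (R : realType) (r : nat).
Hypothesis r0 : (0 < r)%N.

Let angle : R := pi / (2 * r)%N%:R.

Lemma zetaX k : zeta R r ^+ k = (cos (k%:R * angle) +i* sin (k%:R * angle))%C.
Proof.
elim: k => [|k IH]; first by rewrite expr0 mul0r cos0 sin0.
rewrite exprSr IH /zeta -/angle -natr1 mulrDl mul1r cosD sinD.
by apply/eqP; rewrite eq_complex /= [X in _ && (X == _)]addrC !eqxx.
Qed.

Let r20 : (2 * r)%N%:R != 0 :> R.
Proof. by rewrite pnatr_eq0 muln_eq0 /= -lt0n. Qed.

Lemma zeta_half_turn : zeta R r ^+ (2 * r) = -1.
Proof.
rewrite zetaX /angle mulrC divfK // cospi sinpi.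
by apply/eqP; rewrite eq_complex /= oppr0 !eqxx.
Qed.

Lemma zeta_neq0 : zeta R r != 0.
Proof.
apply: contra_eq_neq zeta_half_turn => ->; rewrite expr0n muln_eq0 /= gtn_eqF //.
by rewrite eq_sym oppr_eq0 oner_eq0.
Qed.

(** The real part is the cosine of twice [a%:R * angle], that is, 1 minus twice the square of a sine
    taken strictly between 0 and [pi]. *)
Lemma zeta2_prim a : (0 < a < 2 * r)%N -> (zeta R r ^+ 2) ^+ a != 1.
Proof.
move=> /andP[a0 ar]; rewrite -exprM mulnC zetaX; apply/eqP => -[cos1 _].
have sin_pos : 0 < sin (a%:R * angle).
  apply: sin_gt0_pi; rewrite mulr_gt0 ?ltr0n // /angle ?divr_gt0 ?pi_gt0 ?ltr0n ?muln_gt0 //=.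
  by rewrite mulrCA gtr_pMr ?pi_gt0 // ltr_pdivrMr ?mul1r ?ltr_nat // ltr0n muln_gt0.
move: cos1; rewrite (_ : _ * angle = (a%:R * angle) *+ 2); last first.
  by rewrite natrM mulrAC mulr_natr.
rewrite cos_mulr2n cos2sin2 => /eqP; rewrite subr_eq -mulr2n -subr_eq0 -mulrnBl.
by rewrite mulrn_eq0 /= addrAC subrr add0r oppr_eq0 sqrf_eq0 gt_eqF.
Qed.

(** Otherwise the fourth power of [zeta R r ^+ 2] would be 1, although [4 < 2 * r]. *)
Lemma zeta_delta_neq0 : (2 < r)%N -> zeta R r ^+ 2 + zeta R r ^- 2 != 0.
Proof.
move=> r2; have z0 := zeta_neq0; apply/eqP => h.
have : (zeta R r ^+ 2) ^+ 4 != 1 by apply: zeta2_prim; lia.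
have : zeta R r ^+ 2 * zeta R r ^+ 2 = -1.
  have z20 : zeta R r ^+ 2 != 0 by rewrite expf_neq0.
  by rewrite -[X in X * _]addr0 -(subrr (zeta R r ^- 2)) addrA h add0r mulNr mulVf.
by rewrite -expr2 -[4%N]/(2 * 2)%N [_ ^+ (2 * 2)]exprM => ->; rewrite sqrrN expr1n eqxx.
Qed.

End Zeta.

Lemma evals_surgery_trace_id (R : realType) r n : (n + 2 < 2 * r)%N -> ~~ odd n ->
  evals (zeta R r) (surgery_trace r (idQ n)) (ballot n 0)%:R.
Proof.
move=> nr oddn; have [r0 r1] : (0 < r)%N /\ (1 < r)%N by lia.
have z0 := zeta_neq0 R r0; set z := zeta R r in z0 *.
have wr : (z ^+ 2) ^+ r = -1 by rewrite -exprM zeta_half_turn.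
rewrite -(@walk_sum_ballot _ (z ^+ 2) r r1 wr (zeta2_prim R r0) n 0); last by rewrite addn0.
rewrite surgery_trace_id; apply: evalsN; apply: evalsM.
  apply: evalsV (evals_nat _ _) _; rewrite pnatr_eq0 muln_eq0 /= -lt0n //.
apply: evals_sum => k _.
have ek : evals z (q ^+ k.+1) ((z ^+ 2) ^+ k.+1) by apply: evalsX; exact: evals_q.
have ekV : evals z (q ^- k.+1) ((z ^+ 2) ^- k.+1) by apply: evalsV ek _; rewrite !expf_neq0.
(* Each of the [n] rings contributes a sign, and these cancel because [n] is even. *)
rewrite exprNn; have -> : (-1) ^+ n = 1 :> K.
  by rewrite -signr_odd (negbTE oddn).
rewrite mul1r expr1 -expr2.
by apply: evalsM; apply: evalsX; apply: evalsD => //; exact: evalsN.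
Qed.

Theorem theorem3p6 (R : realType) (n : nat) (t : tangle (2 * n) (2 * n))
    (r : nat) (hr : (n + 2 <= r)%N) :
  WRT_S2S1 R r t = eval_at (zeta R r) (S3 (compQ (P2n0 n) (bracket t))).
Proof.
have r0 : (0 < r)%N by lia.
apply: same_value_eval; rewrite S3_P2n0.
apply: (@cup_trace_same_value _ _ (@surgery_trace r)).
- exact: zeta_neq0.
- exact: cup_trace_surgery.
- exact: cup_trace_action.
- by move=> n1; apply: zeta_delta_neq0; lia.
(* Here [N <= 2 * n] and [n + 2 <= r] give [N + 2 < 2 * r], which is the range of the walk
   formula. *)
- move=> N Nn oddN; exists (ballot N 0)%:R.
    by apply: evals_surgery_trace_id => //; lia.
  by rewrite action_trace_id card_TL_ballot; exact: evals_nat.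
- by rewrite oddM.
- by apply: regularQ_bracket; exact: zeta_neq0.
Qed.
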